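(* Let $b\in C^1[0,\infty)$ be real-valued and satisfy (A1) $b(t)\ge 0$ for all $t\in[0,\infty)$, (A2) $|b(t)|\le C_1\langle t\rangle^{-1}$ and $|b'(t)|\le C_2\langle t\rangle^{-2}$ for all $t\ge0$, with constants $C_1,C_2$, and assume that either (C1) $\limsup_{t\to\infty}t\,b(t)<\tfrac12$, or (C2) $\liminf_{t\to\infty}t\,b(t)>\tfrac12$. Put $\overline\mu=\limsup_{t\to\infty}t\,b(t)$, let $\overline\mu^+$ be any number larger than $\overline\mu$, and let $\gamma=\max(\overline\mu^+-1,0)$ and $\lambda(t)=\exp\left(\int_0^tb(\tau)\,d\tau\right)$. Then there exists a bounded operator $W_+:E^{(\gamma)}\to E$ such that for all $(u_1,u_2)\in E^{(\gamma)}$ and $(v_1,v_2)=W_+(u_1,u_2)$ the solutions $u$ of $u''+2b(t)u'+Au=0$, $u(0)=u_1$, $u'(0)=u_2$, and $v$ of $v''+Av=0$, $v(0)=v_1$, $v'(0)=v_2$, satisfy $$\|\lambda(t)(u(t),u'(t))-(v(t),v'(t))\|_E\to0\qquad\text{as }t\to\infty .$$ Furthermore, $\operatorname{Ker}W_+=\{0\}$.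
   Context: $H$ is a separable Hilbert space with norm $\|\cdot\|$, $A$ is a closed, self-adjoint, non-negative operator in $H$ with domain $\mathcal D(A)$, and $\Lambda=\sqrt A$ with domain $\mathcal D(\Lambda)$ and ranges $R(\Lambda^\gamma)$ of its powers. $\langle t\rangle=(1+t^2)^{1/2}$. The abstract energy space $E$ is the closure (completion) of $(\mathcal D(\Lambda)\ominus\operatorname{Ker}\Lambda)\times H$ with respect to the norm $\|(u_1,u_2)\|_E=\|(\Lambda u_1,u_2)\|_{H\times H}$; here $\ominus\operatorname{Ker}\Lambda$ means the part orthogonal to $\operatorname{Ker}\Lambda$. The map $J(u_1,u_2)=(\Lambda u_1,u_2)$ extends to a unitary identification $J:E\to (H\ominus\operatorname{Ker}\Lambda)\times H$. Modified energy space: by the spectral theorem $H$ is identified unitarily with some $L^2(X,d\nu)$ so that $\Lambda$ becomes multiplication by a non-negative measurable function $\Lambda(\xi)$. Fix a number $N>0$ and set $[\Lambda(\xi)]=\min(\Lambda(\xi),N)$ (different $N$ give equivalent norms). For $\gamma\ge0$, $E^{(\gamma)}$ is the closure of $(\mathcal D(\Lambda)\cap R(\Lambda^\gamma)\ominus\operatorname{Ker}\Lambda)\times(R(\Lambda^\gamma)\ominus\operatorname{Ker}\Lambda)$ with respect to the norm $$\|(u_1,u_2)\|_{E^{(\gamma)}}^2=\left\|[\Lambda(\xi)]^{-\gamma-1}\Lambda(\xi)u_1(\xi)\right\|^2_{L^2(X,d\nu)}+\left\|[\Lambda(\xi)]^{-\gamma}u_2(\xi)\right\|^2_{L^2(X,d\nu)}.$$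 In particular $E^{(\gamma)}\subseteq E$ and all data in $E^{(\gamma)}$ have both components orthogonal to $\operatorname{Ker}\Lambda$. Solutions for data in $E$ are understood in the energy space: $U(t)=J(u(t),u'(t))=(\Lambda u,u')$ is the unique (mild) solution of $$U'(t)=\begin{pmatrix}0&\Lambda\\-\Lambda&-2b(t)\end{pmatrix}U(t),\qquad U(0)=J(u_1,u_2),$$ that is, $U\in C([0,\infty);H\times H)$ with $U(t)=\mathcal E_0(t)U(0)-\int_0^t\mathcal E_0(t-s)\begin{pmatrix}0&0\\0&2b(s)\end{pmatrix}U(s)\,ds$, where $\mathcal E_0(t)$ is the unitary group on $H\times H$ generated by the skew-adjoint operator $\begin{pmatrix}0&\Lambda\\-\Lambda&0\end{pmatrix}$ on $\mathcal D(\Lambda)\times\mathcal D(\Lambda)$. Solutions of the free problem $v''+Av=0$ are defined in the same way with $b\equiv0$. *)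

(* Defs.v *)
From HB Require Import structures.
From mathcomp Require Export all_boot all_order all_algebra.
From mathcomp Require Export complex.
From mathcomp Require Export all_classical all_reals all_analysis.
Export Order.TTheory GRing.Theory Num.Theory.
Export numFieldNormedType.Exports.

Set Implicit Arguments.
Unset Strict Implicit.
Unset Printing Implicit Defensive.

Local Open Scope classical_set_scope.
Local Open Scope ring_scope.
Local Open Scope complex_scope.

(** The norm of a normed space over [R[i]] takes its values in [R[i]] (they are
    real and nonnegative); [rnorm] is the same norm with values in [R]. *)
Definition rnorm (R : realType) (V : normedModType R[i]) (x : V) : R :=
  complex.Re `|x|.

(** A Hilbert space is a complete normed space together with an inner product
    (linear in its first argument) that induces the norm. *)
Definition induces_norm (R : realType) (H : normedModType R[i])
    (dot : {dot H for Num.conj}) : Prop :=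
  forall u : H, `|u| ^+ 2 = dot u u.

Definition separable (T : topologicalType) : Prop :=
  exists2 S : set T, countable S & dense S.

(** [H * H] carries the Hilbert inner product [dot2].  The library norm on
    [H * H] is the equivalent maximum norm; only its topology is used. *)
Definition dot2 (R : realType) (H : lmodType R[i]) (dot : H -> H -> R[i])
    (x y : H * H) : R[i] :=
  dot x.1 y.1 + dot x.2 y.2.

(** Pettis integral over [[0, t]]: [v] is the integral of [f] when
    [dot v w] is the integral of [s |-> dot (f s) w] for every [w].  It agrees
    with the Riemann integral for the continuous integrands met below. *)
Definition is_integral (R : realType) (V : Type) (dot : V -> V -> R[i])
    (t : R) (f : R -> V) (v : V) : Prop :=
  let mu := @lebesgue_measure R in
  forall w : V,
    [/\ mu.-integrable `[0, t] (fun s => (complex.Re (dot (f s) w))%:E),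
        mu.-integrable `[0, t] (fun s => (complex.Im (dot (f s) w))%:E) &
        dot v w =
          (\int[mu]_(s in `[0, t]) complex.Re (dot (f s) w))
          +i* (\int[mu]_(s in `[0, t]) complex.Im (dot (f s) w))].

(** The values of [uapp] outside of [udom] are irrelevant. *)
Record uop (V : Type) := Uop { udom : set V ; uapp :> V -> V }.

Definition linear_op (K : pzRingType) (V : lmodType K) (A : uop V) : Prop :=
  udom A 0 /\
  forall (a : K) (u v : V), udom A u -> udom A v ->
    udom A (a *: u + v) /\ A (a *: u + v) = a *: A u + A v.

Definition closed_op (K : numFieldType) (H : normedModType K) (A : uop H) : Prop :=
  closed [set p : H * H | udom A p.1 /\ A p.1 = p.2].

(** [A = A^*]: the right-hand side of the equivalence is the graph of the
    adjoint. *)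
Definition selfadjoint_op (R : realType) (H : normedModType R[i])
    (dot : H -> H -> R[i]) (A : uop H) : Prop :=
  [/\ linear_op A, dense (udom A) &
      forall v w : H, (udom A v /\ A v = w) <->
        (forall u, udom A u -> dot (A u) v = dot u w)].

Definition nonneg_op (R : realType) (H : normedModType R[i])
    (dot : H -> H -> R[i]) (A : uop H) : Prop :=
  forall u, udom A u -> 0 <= dot (A u) u.

(** [L] is the nonnegative self-adjoint square root of [A]; the domain of
    [L \o L] is the natural one. *)
Definition sqrt_op (R : realType) (H : normedModType R[i])
    (dot : H -> H -> R[i]) (A L : uop H) : Prop :=
  [/\ selfadjoint_op dot L, nonneg_op dot L,
      forall u, udom A u <-> udom L u /\ udom L (L u) &
      forall u, udom A u -> A u = L (L u)].

Definition orth_ker (R : realType) (H : normedModType R[i])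
    (dot : H -> H -> R[i]) (L : uop H) : set H :=
  [set u | forall k, udom L k -> L k = 0 -> dot u k = 0].

Definition cabs (R : realType) (z : R[i]) : R := complex.Re `|z|.

Definition L2norm (R : realType) (d : measure_display) (X : measurableType d)
    (nu : {measure set X -> \bar R}) (f : X -> R[i]) : \bar R :=
  Lnorm nu 2%:E (fun x => (cabs (f x))%:E).

(** The complex-valued [L^2 (X, nu)], as a set of representatives. *)
Definition L2 (R : realType) (d : measure_display) (X : measurableType d)
    (nu : {measure set X -> \bar R}) : set (X -> R[i]) :=
  [set f | [/\ measurable_fun [set: X] (fun x => complex.Re (f x)),
               measurable_fun [set: X] (fun x => complex.Im (f x)) &
               (L2norm nu f < +oo)%E]].

(** [F] is a unitary map of [H] onto [L^2 (X, nu)] (given by representatives)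
    carrying [L] to the multiplication by [m], with its maximal domain. *)
Record spectral_rep (R : realType) (H : normedModType R[i]) (L : uop H)
    (d : measure_display) (X : measurableType d)
    (nu : {measure set X -> \bar R})
    (F : H -> X -> R[i]) (m : X -> R) : Prop := SpectralRep {
  sr_measurable : measurable_fun [set: X] m ;
  sr_ge0 : forall x, 0 <= m x ;
  sr_L2 : forall u, L2 nu (F u) ;
  sr_linear : forall (a : R[i]) (u v : H),
    {ae nu, forall x, F (a *: u + v) x = a * F u x + F v x} ;
  sr_isometry : forall u, L2norm nu (F u) = (rnorm u)%:E ;
  sr_onto : forall f, L2 nu f -> exists u, {ae nu, forall x, F u x = f x} ;
  sr_dom : forall u, udom L u <-> L2 nu (fun x => (m x)%:C * F u x) ;
  sr_mult : forall u, udom L u ->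
    {ae nu, forall x, F (L u) x = (m x)%:C * F u x} }.

(** [R(Lambda^g)], where [Lambda^g] is the multiplication by [m `^ g]. *)
Definition range_pow (R : realType) (H : Type)
    (d : measure_display) (X : measurableType d)
    (nu : {measure set X -> \bar R})
    (F : H -> X -> R[i]) (m : X -> R) (g : R) : set H :=
  [set u | exists w, {ae nu, forall x, F u x = (m x `^ g)%:C * F w x}].

(** [E], with [iota], is a completion of the subspace [P] of [V] with respect
    to the norm [nrm] of [P]; the values of [iota] and [nrm] outside of [P] are
    irrelevant. *)
Definition is_completion (R : realType) (V : lmodType R[i]) (P : set V)
    (nrm : V -> R) (E : completeNormedModType R[i]) (iota : V -> E) : Prop :=
  [/\ forall (a : R[i]) (x y : V), P x -> P y ->
        iota (a *: x + y) = a *: iota x + iota y,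
      forall x, P x -> rnorm (iota x) = nrm x &
      dense (iota @` P)].

Definition energy_data (R : realType) (H : normedModType R[i])
    (dot : H -> H -> R[i]) (L : uop H) : set (H * H) :=
  [set p | udom L p.1 /\ orth_ker dot L p.1].

Definition energy_norm (R : realType) (H : normedModType R[i]) (L : uop H)
    (p : H * H) : R :=
  Num.sqrt (rnorm (L p.1) ^+ 2 + rnorm p.2 ^+ 2).

Definition energy_data_g (R : realType) (H : normedModType R[i])
    (dot : H -> H -> R[i]) (L : uop H)
    (d : measure_display) (X : measurableType d)
    (nu : {measure set X -> \bar R})
    (F : H -> X -> R[i]) (m : X -> R) (g : R) : set (H * H) :=
  [set p | [/\ udom L p.1, range_pow nu F m g p.1, orth_ker dot L p.1,
               range_pow nu F m g p.2 & orth_ker dot L p.2]].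

(** Where [m] vanishes both weights are multiplied by [0], since the data are
    orthogonal to [Ker Lambda]. *)
Definition energy_norm_g (R : realType) (H : normedModType R[i])
    (d : measure_display) (X : measurableType d)
    (nu : {measure set X -> \bar R})
    (F : H -> X -> R[i]) (m : X -> R) (N g : R) (p : H * H) : R :=
  let bm x := Num.min (m x) N in
  Num.sqrt
    (fine (L2norm nu (fun x => (bm x `^ (- g - 1) * m x)%:C * F p.1 x)) ^+ 2 +
     fine (L2norm nu (fun x => (bm x `^ (- g))%:C * F p.2 x)) ^+ 2).

(** The unitary identification [J (u1, u2) = (Lambda u1, u2)] of [E] with a
    subspace of [H * H], as the continuous extension from the dense subspace. *)
Definition energy_identification (R : realType) (H : normedModType R[i])
    (dot : H -> H -> R[i]) (L : uop H) (E : normedModType R[i])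
    (iota : H * H -> E) (J : E -> H * H) : Prop :=
  continuous J /\
  forall p, energy_data dot L p -> J (iota p) = (L p.1, p.2).

(** The inclusion of a completion of [P] (for a stronger norm) into the energy
    space, as the continuous extension of the identity of [P]. *)
Definition extends_identity (R : realType) (V : Type) (P : set V)
    (Eg E : normedModType R[i]) (iotag : V -> Eg) (iota : V -> E)
    (inc : Eg -> E) : Prop :=
  continuous inc /\ forall p, P p -> inc (iotag p) = iota p.

Definition wave_op (R : realType) (H : normedModType R[i]) (L : uop H) :
    uop (H * H) :=
  Uop [set x | udom L x.1 /\ udom L x.2] (fun x => (L x.2, - L x.1)).

Record unitary_group (R : realType) (H : normedModType R[i])
    (dot : H -> H -> R[i]) (S : R -> H * H -> H * H) : Prop := UnitaryGroup {
  ug_linear : forall t, linear (S t) ;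
  ug_dot : forall t x y, dot2 dot (S t x) (S t y) = dot2 dot x y ;
  ug_0 : forall x, S 0 x = x ;
  ug_add : forall s t x, S (s + t) x = S s (S t x) ;
  ug_continuous : forall x, continuous (fun t => S t x) }.

Definition generates (R : realType) (V : normedModType R[i]) (G : uop V)
    (S : R -> V -> V) : Prop :=
  forall x y : V, (udom G x /\ G x = y) <->
    ((h^-1)%:C *: (S h x - x) @[h --> 0^'] --> y).

Definition mild_solution (R : realType) (H : normedModType R[i])
    (dot : H -> H -> R[i]) (S : R -> H * H -> H * H) (b : R -> R)
    (U : R -> H * H) : Prop :=
  {within `[0, +oo[, continuous U} /\
  forall t, 0 <= t ->
    exists2 I : H * H,
      is_integral (dot2 dot) t
        (fun s => S (t - s) (0, (2 * b s)%:C *: (U s).2)) I &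
      U t = S t (U 0) - I.

(** [u t] stands for the pair [(u(t), u'(t))] of the energy space. *)
Definition energy_solution (R : realType) (H E : normedModType R[i])
    (dot : H -> H -> R[i]) (S : R -> H * H -> H * H) (J : E -> H * H)
    (b : R -> R) (x : E) (u : R -> E) : Prop :=
  mild_solution dot S b (fun t => J (u t)) /\ u 0 = x.

(** [b] is [C^1] on [[0, +oo[] with derivative [b'] (one-sided at [0]). *)
Definition C1_halfline (R : realType) (b b' : R -> R) : Prop :=
  (forall t, 0 <= t ->
     (s - t)^-1 * (b s - b t) @[s --> within [set s | 0 <= s] t^'] --> b' t) /\
  {within `[0, +oo[, continuous b'}.

Definition japanese (R : realType) (t : R) : R := Num.sqrt (1 + t ^+ 2).

Definition lambda (R : realType) (b : R -> R) (t : R) : R :=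
  expR (\int[@lebesgue_measure R]_(s in `[0, t]) b s).

(* Main.v *)
Require Import Defs.
From HB Require Import structures.
From mathcomp Require Import ring lra measurable_realfun.

(** In the spectral representation the equation decouples into one oscillator
    [u'' + 2 b u' + xi ^+ 2 u = 0] for each value [xi] of [m].  For fixed
    [0 < xi], the pair [(w1, w2) = lam (xi u, u')] solves a system that is the
    rotation with speed [xi], perturbed by the trace-free matrix
    [diag (b, - b)].  The perturbation is only [O(1 / t)], but it anticommutes
    with the generator of the rotation, so that one diagonalization step, by
    [w1 + b / (2 xi) w2] and [w2 + b / (2 xi) w1], leaves an error [O(1 / t ^+ 2)].
    After undoing the rotation, [w] therefore has a limit ([rotated_limit]),
    and the wave operator is the multiplication by the matrix [Z xi] of these
    limits ([wave_matrix]).  Its determinant is [1], whence the trivial kernel.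

    The point is the behaviour as [xi] tends to [0], where [Z] is unbounded.
    Up to a constant, the two columns of the fundamental matrix are at most
    [min (xi, N) `^ (- gamma - 1)] and [min (xi, N) `^ (- gamma)], uniformly in
    time ([propagator_bound]), and these are the weights of the modified energy
    space.  Up to the time [1 / xi] the first column is dominated by
    [lam (1 / xi)], a power of [1 / xi] governed by the upper limit of [t b].
    The second column, with initial value [(0, 1)], is dominated by
    [xi lam P], taken at the time [1 / xi], where [P] is the primitive of
    [lam ^- 2] vanishing at [0] ([low_frequency_second]); that [t b] stays away
    from [1/2] on one side makes [P] comparable to [t / lam ^+ 2], or bounded
    ([lamP_power_bound]).  After the time [1 / xi] an energy corrected by
    [2 (b / xi) w1 w2] is almost conserved ([high_frequency]).  Given the uniform
    bounds, dominated convergence turns the pointwise limits into the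
    convergence in the energy norm ([asymptotics]).

    Two links with the Hilbert space are needed.  A mild solution, known only
    through a weak Duhamel formula, is paired with solutions of the adjoint
    equation that are bounded spectral multipliers with a frequency cut-off;
    the pairing is constant ([dual_path_const]), and choosing the rows of the
    inverse fundamental matrix identifies the solution almost everywhere with
    the fundamental matrix applied to its data ([mild_propagator]).  On the
    other hand, [E] and [Eg] are completions: [J] is an isometry onto the pairs
    whose first component is carried by [0 < m] ([J_norm], [J_range]), and an
    element of [Eg] is represented by a pair [h] of the same norm, from which
    [J (inc z)] is recovered by the bounded inverse weights
    ([represents_exists]).  The composition of [Z] with the inverse weights is
    bounded, so that the wave operator is defined on [h] without further
    approximation. *)

Set Implicit Arguments.
Unset Strict Implicit.
Unset Printing Implicit Defensive.

Local Open Scope classical_set_scope.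
Local Open Scope ring_scope.
Local Open Scope complex_scope.

(** * Derivatives, monotonicity and antiderivatives on the line *)

Section Calculus.
Context {R : realType}.
Implicit Types (f g : R -> R) (x a b t : R).

(** Derivation rules in pointwise form, with the derivative as a separate
    expression, so that [is_deriv_eq] leaves only a [ring] or [field] identity. *)
Lemma is_deriv_eq f x a b : is_derive x 1 f a -> a = b -> is_derive x 1 f b.
Proof. by move=> ? <-. Qed.
Lemma is_deriv_cst (c : R) x : is_derive x 1 (fun=> c) 0.
Proof. exact: is_derive_cst. Qed.
Lemma is_deriv_id x : is_derive x 1 (fun y : R => y) 1.
Proof. exact: is_derive_id. Qed.
Lemma is_derivD f g x a b : is_derive x 1 f a -> is_derive x 1 g b ->
  is_derive x 1 (fun y => f y + g y) (a + b).
Proof. exact: is_deriveD. Qed.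
Lemma is_derivN f x a : is_derive x 1 f a -> is_derive x 1 (fun y => - f y) (- a).
Proof. exact: is_deriveN. Qed.
Lemma is_derivM f g x a b : is_derive x 1 f a -> is_derive x 1 g b ->
  is_derive x 1 (fun y => f y * g y) (a * g x + f x * b).
Proof.
move=> fa gb; have := is_deriveM fa gb; rewrite /GRing.scale/= => h.
by apply: is_deriv_eq h _; rewrite addrC mulrC.
Qed.
Lemma is_deriv_comp f g x a b : is_derive x 1 g a -> is_derive (g x) 1 f b ->
  is_derive x 1 (fun y => f (g y)) (b * a).
Proof. by move=> ga fb; exact: is_derive1_comp. Qed.
Lemma is_derivX f n x a : is_derive x 1 f a ->
  is_derive x 1 (fun y => f y ^+ n) (n%:R * f x ^+ n.-1 * a).
Proof.
by move=> fa; have := is_deriveX n fa; rewrite /GRing.scale/= exprfctE.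
Qed.
Lemma is_derivV f x a : is_derive x 1 f a -> f x != 0 ->
  is_derive x 1 (fun y => (f y)^-1) (- a / f x ^+ 2).
Proof.
move=> fa f0; apply: is_deriv_eq (is_deriveV f0 fa) _.
by rewrite /GRing.scale/= mulNr mulNr mulrC.
Qed.
Lemma is_deriv_cont f x a : is_derive x 1 f a -> {for x, continuous f}.
Proof. by move=> [df _]; apply/differentiable_continuous/derivable1_diffP. Qed.

Lemma deriv_within f f' a b : (forall x, a <= x <= b -> is_derive x 1 f (f' x)) ->
  {within `[a, b], continuous f}.
Proof.
move=> h; apply: derivable_within_continuous => x.
by rewrite in_itv/= => /h [].
Qed.

Lemma deriv_ge0_le f f' a b : a <= b ->
  (forall x, a <= x <= b -> is_derive x 1 f (f' x)) ->
  (forall x, a <= x <= b -> 0 <= f' x) -> f a <= f b.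
Proof.
move=> ab df f'0.
have df' x : x \in `]a, b[ -> is_derive x 1 f (f' x).
  by rewrite in_itv/= => /andP[/ltW ax /ltW xb]; apply: df; rewrite ax.
have [c] := MVT_segment ab df' (@deriv_within f f' a b df).
rewrite in_itv/= => cab e.
by rewrite -subr_ge0 e mulr_ge0 ?subr_ge0// f'0.
Qed.

Lemma deriv_le_le f g f' g' a b : a <= b ->
  (forall x, a <= x <= b -> is_derive x 1 f (f' x)) ->
  (forall x, a <= x <= b -> is_derive x 1 g (g' x)) ->
  (forall x, a <= x <= b -> f' x <= g' x) -> f b - f a <= g b - g a.
Proof.
move=> ab df dg fg; rewrite -subr_ge0.
suff : g a - f a <= g b - f b by lra.
apply: (@deriv_ge0_le (fun x => g x - f x) (fun x => g' x - f' x)) => // x xab.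
  by apply: is_derivD; [exact: dg|apply: is_derivN; exact: df].
by rewrite subr_ge0 fg.
Qed.

(** Increments are dominated as soon as derivatives are: this comparison
    replaces integral estimates throughout. *)
Lemma deriv_le_norm f g f' g' a b : a <= b ->
  (forall x, a <= x <= b -> is_derive x 1 f (f' x)) ->
  (forall x, a <= x <= b -> is_derive x 1 g (g' x)) ->
  (forall x, a <= x <= b -> `|f' x| <= g' x) -> `|f b - f a| <= g b - g a.
Proof.
move=> ab df dg fg; rewrite ler_norml; apply/andP; split; last first.
  by apply: deriv_le_le df dg _ => // x /fg; exact: le_trans (ler_norm _).
have := @deriv_le_le (fun x => - f x) g (fun x => - f' x) g' a b ab.
move=> /(_ _ dg) h; suff : - f b - - f a <= g b - g a by lra.
apply: h => x xab; first by apply: is_derivN; exact: df.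
by apply: le_trans (fg x xab); rewrite -normrN ler_norm.
Qed.

Lemma deriv0_cst f a b : a <= b ->
  (forall x, a <= x <= b -> is_derive x 1 f 0) -> f b = f a.
Proof.
move=> ab df; apply/eqP; rewrite -subr_eq0 -normr_eq0 eq_le normr_ge0 andbT.
have := @deriv_le_norm f (fun=> 0) (fun=> 0) (fun=> 0) a b ab df.
by rewrite subrr => h; apply: h => x _; rewrite ?normr0.
Qed.

Lemma antiderivative_from f a : continuous f ->
  exists G : R -> R, forall x, a < x -> is_derive x 1 G (f x).
Proof.
move=> cf; exists (fun x => \int[@lebesgue_measure R]_(t in `[a, x]) f t) => x ax.
have fi : (@lebesgue_measure R).-integrable `[a, x + 1] (EFin \o f).
  apply: continuous_compact_integrable; first exact: segment_compact.
  by apply: continuous_subspaceT.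
have [] := @continuous_FTC1_closed _ f a x (x + 1) _ fi ax (cf x).
  by rewrite ltrDl.
move=> d1 d2.
apply: DeriveDef.
  by exact: d1.
rewrite -derive1E.
by rewrite d2.
Qed.

(** The integral from a negative integer is an antiderivative to its right; normalized
    at [0], these agree with one another, and the starting point is then chosen according to
    [x]. *)
Lemma antiderivative_exists f : continuous f ->
  exists G : R -> R, G 0 = 0 /\ forall x, is_derive x 1 G (f x).
Proof.
move=> cf.
have /choice[G hG] (n : nat) : exists G : R -> R, G 0 = 0 /\
    forall x, - n.+1%:R < x -> is_derive x 1 G (f x).
  have [G hG] := @antiderivative_from f (- n.+1%:R) cf.
  exists (fun x => G x - G 0); split; first by rewrite subrr.
  move=> x /hG dG; apply: is_deriv_eq.
  by rewrite subr0.
have GE (n k : nat) x : - n.+1%:R < x -> - k.+1%:R < x -> G n x = G k x.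
  move=> xn xk.
  suff H (u v : R) : u <= v -> - n.+1%:R < u -> - k.+1%:R < u ->
      G n v - G k v = G n u - G k u.
    have n0 : - n.+1%:R < 0 :> R by rewrite oppr_lt0.
    have k0 : - k.+1%:R < 0 :> R by rewrite oppr_lt0.
    have Z : G n 0 - G k 0 = 0 by rewrite (hG n).1 (hG k).1 subrr.
    apply/eqP; rewrite -subr_eq0; apply/eqP.
    have [x0|/ltW x0] := leP 0 x; first by rewrite (H 0 x).
    by rewrite -(H x 0).
  move=> uv un uk; apply: (@deriv0_cst (fun x => G n x - G k x)) => // y /andP[uy _].
  apply: is_deriv_eq.
    apply: is_derivD; [apply: (hG n).2|apply: is_derivN; apply: (hG k).2].
      exact: lt_le_trans uy.
    exact: lt_le_trans uy.
  by rewrite subrr.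
(* [N x] serves a whole neighbourhood of [x]. *)
pose N (x : R) := Num.truncn (`|x| + 1).
have Nx (x : R) (y : R) : `|y| < `|x| + 1 -> - (N x).+1%:R < y.
  move=> yx; rewrite ltrNl; apply: le_lt_trans (_ : `|y| < _).
    by rewrite -normrN ler_norm.
  by apply: lt_trans yx _; exact: truncnS_gt.
exists (fun x => G (N x) x); split; first exact: (hG _).1.
move=> x; apply: near_eq_is_derive ((hG (N x)).2 x _); last first.
- by apply: Nx; rewrite ltrDl.
near=> y; apply: GE; apply: Nx; last by rewrite ltrDl.
have : `|x - y| < 1 by near: y; apply: cvgr_dist_lt; rewrite ?ltr01//; exact: cvg_id.
by have := ler_distD x y 0; rewrite !subr0 (distrC y x); lra.
Unshelve. all: by end_near. Qed.

End Calculus.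

(** * A Picard series for planar oscillators *)

Section Picard.
Context {R : realType}.
Implicit Types (f g p q : R -> R) (x a b t xi T K : R).

(** Comparison of series with an explicit bound for the remainder, which is what
    makes a convergence uniform in a parameter. *)
Lemma weierstrass_test (u v : R^nat) : (forall n, `|u n| <= v n) ->
  cvgn (series v) ->
  cvgn (series u) /\
  forall N, `|limn (series u) - series u N| <= limn (series v) - series v N.
Proof.
move=> uv cv.
have cu : cvgn (series u).
  apply: normed_cvg; apply: series_le_cvg cv => // n; first exact: normr_ge0.
  exact: le_trans (normr_ge0 _) (uv n).
split=> // N.
have h : (fun k => `|series u k - series u N|) @ \oo -->
         `|limn (series u) - series u N|.
  by apply: cvg_norm; apply: cvgB => //; exact: cvg_cst.
apply: ler_cvg_to h (_ : (fun k => series v k - series v N) @ \oo --> _) _.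
  by apply: cvgB => //; exact: cvg_cst.
near=> k; have Nk : (N <= k)%N by near: k; exists N.
rewrite !sub_series_geq//.
by apply: le_trans (ler_norm_sum _ _ _) _; apply: ler_sum => i _; exact: uv.
Unshelve. all: by end_near. Qed.

Lemma exp_series_tail (M A : R) :
  cvgn (series (fun n => M * (A ^+ n / n`!%:R))) /\
  (fun N => limn (series (fun n => M * (A ^+ n / n`!%:R)))
    - series (fun n => M * (A ^+ n / n`!%:R)) N) @ \oo --> (0 : R).
Proof.
have e : series (fun n => M * (A ^+ n / n`!%:R)) = fun N => M * series (exp_coeff A) N.
  by apply/funext => N; rewrite /series/= mulr_sumr.
have c : cvgn (series (fun n => M * (A ^+ n / n`!%:R))).
  by rewrite e; apply: is_cvgMr; exact: is_cvg_series_exp_coeff.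
split=> //.
rewrite -[X in _ --> X](subrr (limn (series (fun n => M * (A ^+ n / n`!%:R))))).
by apply: cvgB; [exact: cvg_cst|exact: c].
Qed.

Lemma uniform_limit_continuous (f : nat -> R -> R) (g : R -> R) :
  (forall n, continuous (f n)) ->
  (forall T, exists2 e : R^nat, e @ \oo --> (0 : R) &
     forall n t, `|t| <= T -> `|g t - f n t| <= e n) ->
  continuous g.
Proof.
move=> cf h x; apply/cvgrPdist_lt => eps eps0.
have [e e0 fe] := h (`|x| + 1).
have [N _ /(_ N (leqnn N))/= eN] : \forall n \near \oo, `|e n| < eps / 3.
  by move/cvgr0Pnorm_lt : e0; apply; lra.
have := cf N x => /cvgrPdist_lt/(_ (eps / 3)) cN.
near=> y.
have xy : `|x - y| < 1 by near: y; apply: cvgr_dist_lt; rewrite ?ltr01//; exact: cvg_id.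
have h1 : `|f N x - f N y| < eps / 3 by near: y; apply: cN; lra.
have h2 : `|g x - f N x| <= e N by apply: fe; lra.
have h3 : `|g y - f N y| <= e N.
  by apply: fe; have := ler_distD x y 0; rewrite !subr0 (distrC y x); lra.
have h4 := ler_norm (e N).
have : `|g x - g y| <= `|g x - f N x| + `|f N x - f N y| + `|g y - f N y|.
  rewrite (_ : g x - g y = (g x - f N x) + (f N x - f N y) + (- (g y - f N y))); last by ring.
  apply: le_trans (ler_normD _ _) _; rewrite normrN lerD2r; exact: ler_normD.
lra.
Unshelve. all: by end_near. Qed.

Lemma deriv_continuous (f f' : R -> R) : (forall t, is_derive t 1 f (f' t)) ->
  continuous f.
Proof. by move=> df t; exact: is_deriv_cont (df t). Qed.

(** Two-sided version of [deriv_le_norm]: the majorant depends on [`|t|] only. *)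
Lemma deriv_le_norm_sym (f f' g g' : R -> R) (T : R) t : `|t| <= T ->
  (forall x, `|x| <= T -> is_derive x 1 f (f' x)) ->
  (forall x, 0 <= x <= T -> is_derive x 1 g (g' x)) ->
  (forall x, `|x| <= T -> `|f' x| <= g' `|x|) ->
  `|f t - f 0| <= g `|t| - g 0.
Proof.
move=> tT df dg fg.
have [t0|/ltW t0] := leP 0 t.
  have := tT; rewrite ger0_norm// => tT'.
  apply: (@deriv_le_norm _ f g f' g') => // x /andP[x0 xt].
  - by apply: df; rewrite ger0_norm// (le_trans xt).
  - by apply: dg; rewrite x0/= (le_trans xt).
  - by have := fg x; rewrite ger0_norm//; apply; rewrite (le_trans xt).
have := tT; rewrite ler0_norm// => tT'.
have := @deriv_le_norm _ (fun x => f (- x)) g (fun x => - f' (- x)) g' 0 (- t).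
rewrite opprK oppr0; apply => //; first by rewrite oppr_ge0.
- move=> x /andP[x0 xt]; apply: is_deriv_eq.
    apply: (@is_deriv_comp _ f (fun y => - y)) (is_derivN (is_deriv_id _)) (df _ _).
    by rewrite normrN ger0_norm// (le_trans xt).
  by rewrite mulrN1.
- by move=> x /andP[x0 xt]; apply: dg; rewrite x0/= (le_trans xt).
- move=> x /andP[x0 xt]; rewrite normrN.
  have := fg (- x); rewrite normrN ger0_norm//; apply; by rewrite (le_trans xt).
Qed.

Definition prim (f : R -> R) : R -> R :=
  xget (fun=> 0) [set G | G 0 = 0 /\ forall x, is_derive x 1 G (f x)].

Lemma primP f : continuous f ->
  prim f 0 = 0 /\ forall x, is_derive x 1 (prim f) (f x).
Proof.
move=> /antiderivative_exists cf.
exact: (@xgetPex _ (fun=> 0)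
  [set G : R -> R | G 0 = 0 /\ forall x, is_derive x 1 G (f x)] cf).
Qed.

(** Up to sign, the coefficient of [xi ^+ n] in the solution of the system solved by
    [ode_sol]: iterated antiderivatives with the two coefficients alternating. *)
Fixpoint iterprim (p q : R -> R) n : R -> R :=
  if n is n'.+1 then prim (fun t => p t * iterprim q p n' t) else fun=> 1.

Lemma continuous_mul (f g : R -> R) : continuous f -> continuous g ->
  continuous (fun t => f t * g t).
Proof. by move=> cf cg t; apply: cvgM; [exact: cf|exact: cg]. Qed.

Lemma iterprim_continuous n p q : continuous p -> continuous q ->
  continuous (iterprim p q n).
Proof.
elim: n p q => [|n IHn] p q cp cq /=; first by move=> t; exact: cvg_cst.
by have [_ /deriv_continuous] := primP (continuous_mul cp (IHn _ _ cq cp)).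
Qed.

Lemma iterprimS n p q : continuous p -> continuous q ->
  iterprim p q n.+1 0 = 0 /\
  forall t, is_derive t 1 (iterprim p q n.+1) (p t * iterprim q p n t).
Proof.
by move=> cp cq; apply: primP; apply: continuous_mul => //; exact: iterprim_continuous.
Qed.

Lemma iterprim_bound n p q K T : continuous p -> continuous q ->
  (forall t, `|t| <= T -> `|p t| <= K) -> (forall t, `|t| <= T -> `|q t| <= K) ->
  forall t, `|t| <= T -> `|iterprim p q n t| <= (K * `|t|) ^+ n / n`!%:R.
Proof.
elim: n p q => [|n IHn] p q cp cq pK qK t tT.
  by rewrite /= expr0 fact0 divr1 normr1.
have [i0 di] := iterprimS n cp cq.
have K0 : 0 <= K by rewrite (le_trans _ (pK t tT)).
pose g (x : R) := (K * x) ^+ n.+1 / n.+1`!%:R.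
have g0 : g 0 = 0 by rewrite /g mulr0 expr0n/= mul0r.
suff : `|iterprim p q n.+1 t - iterprim p q n.+1 0| <= g `|t| - g 0.
  by rewrite i0 g0 !subr0.
apply: (@deriv_le_norm_sym _ (fun x => p x * iterprim q p n x) _
  (fun x => K * ((K * x) ^+ n / n`!%:R)) T) => //.
- move=> x _; apply: is_deriv_eq.
    apply: is_derivM (is_derivX n.+1 (is_derivM (is_deriv_cst _ _) (is_deriv_id _))) (is_deriv_cst _ _).
  rewrite /= mul0r add0r mulr1 mulr0 addr0 factS natrM; field.
  by rewrite nat1r !pnatr_eq0 -lt0n fact_gt0.
- move=> x xT; rewrite normrM; apply: ler_pM => //; first exact: pK.
  exact: IHn.
Qed.

(** The signs, and the alternation between the two initial values, in the powers of
    a quarter turn. *)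
Fixpoint turn (c : R * R) n : R * R :=
  if n is n'.+1 then let d := turn c n' in (d.2, - d.1) else c.

(** Solution of [v1' = xi p v2], [v2' = - xi q v1], [v 0 = c], as a power series in
    [xi].  The series form gives the measurability in [xi] for free. *)
Definition ode_sol (p q : R -> R) (c : R * R) (xi t : R) : R * R :=
  (limn (series (fun n => (turn c n).1 * xi ^+ n * iterprim p q n t)),
   limn (series (fun n => (turn c n).2 * xi ^+ n * iterprim q p n t))).

Lemma turn_bound c n : `|(turn c n).1| <= `|c.1| + `|c.2| /\
  `|(turn c n).2| <= `|c.1| + `|c.2|.
Proof.
elim: n => [|n [h1 h2]] /=; first by rewrite lerDl lerDr !normr_ge0.
by rewrite normrN.
Qed.

Lemma continuous_bounded (f : R -> R) (T : R) : continuous f ->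
  exists K, forall t, `|t| <= T -> `|f t| <= K.
Proof.
move=> cf.
have /compact_bounded[M [_ hM]] : compact (f @` `[- T, T]).
  by apply: continuous_compact; [exact: continuous_subspaceT|exact: segment_compact].
exists (M + 1) => t tT; apply: (hM (M + 1)); first by rewrite ltrDl.
by exists t => //=; rewrite in_itv/= -ler_norml.
Qed.

Lemma ode_term_bound p q K T c xi (s : bool) : continuous p -> continuous q ->
  (forall t, `|t| <= T -> `|p t| <= K) -> (forall t, `|t| <= T -> `|q t| <= K) ->
  forall n t, `|t| <= T ->
  `|(if s then (turn c n).1 else (turn c n).2) * xi ^+ n * iterprim p q n t| <=
  (`|c.1| + `|c.2|) * ((`|xi| * K * T) ^+ n / n`!%:R).
Proof.
move=> cp cq pK qK n t tT.
have K0 : 0 <= K by rewrite (le_trans _ (pK t tT)).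
rewrite !normrM -mulrA; apply: ler_pM; rewrite ?mulr_ge0//.
  by have [] := turn_bound c n; case: s.
rewrite normrX -mulrA exprMn -mulrA ler_wpM2l ?exprn_ge0//.
apply: le_trans (iterprim_bound n cp cq pK qK tT) _.
rewrite ler_wpM2r ?invr_ge0 ?ler0n//.
by apply: lerXn2r; rewrite ?nnegrE ?mulr_ge0 ?(le_trans _ tT)// ler_wpM2l.
Qed.

Lemma series_shift0 (u : R^nat) N : series u N.+1 = u 0%N + series (fun n => u n.+1) N.
Proof. by rewrite /series/= big_nat_recl. Qed.

(** Both sides are compared with an antiderivative [G] of the expected derivative:
    the partial sums have derivatives close to that of [G], uniformly on compact
    sets, hence they stay close to [G] up to a constant. *)
Lemma deriv_series (u w : nat -> R -> R) (r : R -> R) :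
  continuous r -> (forall n, continuous (w n)) ->
  (forall t, u 0%N t = u 0%N 0) ->
  (forall n t, is_derive t 1 (u n.+1) (r t * w n t)) ->
  (forall T, exists M A : R, forall n t, `|t| <= T ->
     `|u n t| <= M * (A ^+ n / n`!%:R) /\ `|w n t| <= M * (A ^+ n / n`!%:R)) ->
  forall t, is_derive t 1 (fun t => limn (series (u ^~ t)))
     (r t * limn (series (w ^~ t))).
Proof.
move=> cr cw u0 du bd.
set U := fun t => limn _; pose V t := limn (series (w ^~ t)).
change (forall t, is_derive t 1 U (r t * V t)).
have swc N : continuous (fun t => series (w ^~ t) N).
  elim: N => [|N IHN] t.
    by rewrite (_ : (fun t => _) = (fun=> 0)); [exact: cvg_cst|apply/funext => s; rewrite /series/= big_geq].
  rewrite (_ : (fun t => _) = (fun t => series (w ^~ t) N + w N t)).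
    by apply: cvgD; [exact: IHN|exact: cw].
  by apply/funext => s; rewrite /series/= big_nat_recr.
have cV : continuous V.
  apply: (@uniform_limit_continuous (fun N t => series (w ^~ t) N)) => // T.
  have [M [A h]] := bd T; have [cv e0] := exp_series_tail M A.
  eexists; first exact: e0.
  by move=> N t tT; apply: (weierstrass_test _ cv).2 => n; exact: (h n t tT).2.
have [G0 dG] := primP (continuous_mul cr cV).
set G := prim _ in G0 dG.
suff UG t : U t = G t + U 0.
  move=> t; have -> : U = fun t => G t + U 0 by apply/funext.
  by apply: is_deriv_eq (is_derivD (dG t) (is_deriv_cst _ _)) _; rewrite addr0.
have [M [A h]] := bd `|t|; have [cv e0] := exp_series_tail M A.
set e := fun N => _ in e0.
have [K rK] := continuous_bounded `|t| cr.
have K0 : 0 <= K by rewrite (le_trans _ (rK t (lexx _))).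
have uP s : `|s| <= `|t| -> series (u ^~ s) @ \oo --> U s.
  by move=> st; apply: (weierstrass_test _ cv).1 => n; exact: (h n s st).1.
have wP s N : `|s| <= `|t| -> `|V s - series (w ^~ s) N| <= e N.
  by move=> st; apply: (weierstrass_test _ cv).2 => n; exact: (h n s st).2.
have dU N (s : R) : is_derive s 1 (fun s => series (u ^~ s) N.+1) (r s * series (w ^~ s) N).
  rewrite (_ : (fun s => _) = (fun s => u 0%N 0 + series (fun n => u n.+1 s) N)); last first.
    by apply/funext => x; rewrite series_shift0 u0.
  elim: N => [|N IHN].
    rewrite (_ : (fun s => _) = (fun=> u 0%N 0 + 0)); last by apply/funext => x; rewrite /series/= big_geq.
    by apply: is_deriv_eq (is_deriv_cst _ _) _; rewrite /series/= big_geq// mulr0.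
  rewrite (_ : (fun s => _) = (fun s => u 0%N 0 + series (fun n => u n.+1 s) N + u N.+1 s)); last first.
    by apply/funext => x; rewrite /series/= big_nat_recr//= addrA.
  by apply: is_deriv_eq (is_derivD IHN (du _ _)) _; rewrite /series/= big_nat_recr//= mulrDr.
(* The partial sums are shifted by one because differentiation lowers the index. *)
have key N : `|(series (u ^~ t) N.+1 - G t) - (series (u ^~ 0) N.+1 - G 0)| <= K * e N * `|t|.
  have := @deriv_le_norm_sym (fun s => series (u ^~ s) N.+1 - G s)
    (fun s => r s * series (w ^~ s) N - r s * V s) (fun x => K * e N * x)
    (fun=> K * e N) `|t| t (lexx _).
  rewrite mulr0 subr0.
  move=> /(_ (fun x _ => is_derivD (dU N x) (is_derivN (dG x)))); apply.
  - move=> x _; apply: is_deriv_eq (is_derivM (is_deriv_cst _ _) (is_deriv_id _)) _.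
    by rewrite mul0r add0r mulr1.
  - move=> x xt; rewrite -mulrBr normrM distrC; apply: ler_pM => //; first exact: rK.
    exact: wP.
have l0 : (fun N => K * e N * `|t|) @ \oo --> (0 : R).
  rewrite -(mul0r `|t|) -(mulr0 K).
  by apply: cvgM (cvg_cst _); apply: cvgM (cvg_cst _) e0.
have l1 : (fun N => `|(series (u ^~ t) N.+1 - G t) - (series (u ^~ 0) N.+1 - G 0)|) @ \oo
   --> `|(U t - G t) - (U 0 - G 0)|.
  apply: cvg_norm; apply: cvgB; apply: cvgB; try exact: cvg_cst.
    by rewrite (cvg_shiftS (series (u ^~ t))); exact: uP.
  by rewrite (cvg_shiftS (series (u ^~ 0))); apply: uP; rewrite normr0.
have : `|(U t - G t) - (U 0 - G 0)| <= 0.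
  by apply: ler_cvg_to l1 l0 _; apply: nearW => N; exact: key.
by rewrite normr_le0 G0 => /eqP; lra.
Qed.

Lemma ode_term_majorant p q c xi : continuous p -> continuous q ->
  forall T, exists M A : R, forall (s : bool) n t, `|t| <= T ->
  `|(if s then (turn c n).1 else (turn c n).2) * xi ^+ n * iterprim p q n t| <= M * (A ^+ n / n`!%:R) /\
  `|(if s then (turn c n).1 else (turn c n).2) * xi ^+ n * iterprim q p n t| <= M * (A ^+ n / n`!%:R).
Proof.
move=> cp cq T.
  have [K1 h1] := continuous_bounded T cp; have [K2 h2] := continuous_bounded T cq.
  exists (`|c.1| + `|c.2|), (`|xi| * Num.max K1 K2 * T) => s n t tT.
  by split; apply: ode_term_bound => // x /[dup] /h1 ? /h2 ?; rewrite le_max; apply/orP; auto.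
Qed.

Lemma ode_solP p q c xi : continuous p -> continuous q ->
  ode_sol p q c xi 0 = c /\
  forall t,
   is_derive t 1 (fun t => (ode_sol p q c xi t).1) (xi * p t * (ode_sol p q c xi t).2) /\
   is_derive t 1 (fun t => (ode_sol p q c xi t).2) (- (xi * q t * (ode_sol p q c xi t).1)).
Proof.
move=> cp cq.
have bd := ode_term_majorant c xi cp cq.
have lim0 (u : R^nat) x : u 0%N = x -> (forall n, u n.+1 = 0) -> limn (series u) = x.
  move=> u0 uS; apply/cvg_lim => //; rewrite -(cvg_shiftS (series u)).
  rewrite (_ : (fun n => _) = (fun=> x)); first exact: cvg_cst.
  apply/funext => n; rewrite series_shift0 u0 /series/= big1 ?addr0// => i _.
split.
  rewrite /ode_sol; case: c bd => c1 c2 _; congr pair; apply: lim0 => [|n].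
  - by rewrite /= expr0 !mulr1.
  - by rewrite (iterprimS n cp cq).1 mulr0.
  - by rewrite /= expr0 !mulr1.
  - by rewrite (iterprimS n cq cp).1 mulr0.
move=> t; split.
  apply: is_deriv_eq (@deriv_series (fun n t => (turn c n).1 * xi ^+ n * iterprim p q n t)
     (fun n t => (turn c n).2 * xi ^+ n * iterprim q p n t) (fun t => xi * p t) _ _ _ _ _ t) _.
  - by apply: continuous_mul => // x; exact: cvg_cst.
  - by move=> n; apply: continuous_mul; [move=> x; exact: cvg_cst|exact: iterprim_continuous].
  - by [].
  - move=> n x; apply: is_deriv_eq (is_derivM (is_deriv_cst _ _) ((iterprimS n cp cq).2 x)) _.
    by rewrite /= mul0r add0r exprS; ring.
  - move=> T; have [M [A h]] := bd T; exists M, A => n x xT.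
    by split; [exact: (h true n x xT).1|exact: (h false n x xT).2].
  - by [].
apply: is_deriv_eq (@deriv_series (fun n t => (turn c n).2 * xi ^+ n * iterprim q p n t)
   (fun n t => (turn c n).1 * xi ^+ n * iterprim p q n t) (fun t => - xi * q t) _ _ _ _ _ t) _.
- by apply: continuous_mul => // x; exact: cvg_cst.
- by move=> n; apply: continuous_mul; [move=> x; exact: cvg_cst|exact: iterprim_continuous].
- by [].
- move=> n x; apply: is_deriv_eq (is_derivM (is_deriv_cst _ _) ((iterprimS n cq cp).2 x)) _.
  by rewrite /= mul0r add0r exprS; ring.
- move=> T; have [M [A h]] := bd T; exists M, A => n x xT.
  by split; [exact: (h false n x xT).2|exact: (h true n x xT).1].
- by rewrite /ode_sol/=; ring.
Qed.

(** For fixed [t] this is a pointwise limit of polynomials in [xi]. *)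
Lemma measurable_ode_sol p q c t : continuous p -> continuous q ->
  measurable_fun [set: R] (fun xi => (ode_sol p q c xi t).1) /\
  measurable_fun [set: R] (fun xi => (ode_sol p q c xi t).2).
Proof.
move=> cp cq.
have mser (a : nat -> R) : (forall xi, cvgn (series (fun n => a n * xi ^+ n))) ->
    measurable_fun [set: R] (fun xi => limn (series (fun n => a n * xi ^+ n))).
  move=> ca; apply: (@measurable_realfun.measurable_fun_cvg _ _ R setT
     (fun N xi => series (fun n => a n * xi ^+ n) N)) => [N|xi _]; last exact: ca.
  by apply: measurable_sum => n; apply: measurable_funM.
have rw (u v : R^nat) xi : (fun n => u n * xi ^+ n * v n) = (fun n => (u n * v n) * xi ^+ n).
  by apply/funext => n; ring.
split; rewrite /ode_sol/=; under eq_fun do rewrite rw; apply: mser => xi; rewrite -rw.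
  have [M [A h]] := ode_term_majorant c xi cp cq `|t|.
  apply: (weierstrass_test _ (exp_series_tail M A).1).1 => n; exact: (h true n t (lexx _)).1.
have [M [A h]] := ode_term_majorant c xi cp cq `|t|.
apply: (weierstrass_test _ (exp_series_tail M A).1).1 => n; exact: (h false n t (lexx _)).2.
Qed.

End Picard.

(** * Energy estimates for a single mode *)

Section Energy.
Context {R : realType}.
Implicit Types (f g w b lam : R -> R) (x s t xi T K C D : R).

(** If [u'' + 2 b u' + xi ^+ 2 u = 0], then [(w1, w2) = lam (xi u, u')] satisfies this
    system: the factor [lam] splits the damping evenly, so that the trace vanishes. *)
Definition scaled_mode b xi w1 w2 := forall t,
  is_derive t 1 w1 (b t * w1 t + xi * w2 t) /\
  is_derive t 1 w2 (- (xi * w1 t) - b t * w2 t).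

(** [lam] is the exponential of the antiderivative of [b] vanishing at [0], described by
    its equation; the undamped problem is the case [b = 0], [lam = 1]. *)
Definition is_lam b (lam : R -> R) := lam 0 = 1 /\ (forall t, 0 < lam t) /\
  forall t, is_derive t 1 lam (b t * lam t).

Lemma lam_ndecr b lam s t : (forall t, 0 <= b t) -> is_lam b lam -> s <= t ->
  lam s <= lam t.
Proof.
move=> b0 [_ [l0 dl]] st; apply: (deriv_ge0_le st (fun x _ => dl x)) => x _.
by rewrite mulr_ge0// ltW.
Qed.

Lemma lam_ge1 b lam t : (forall t, 0 <= b t) -> is_lam b lam -> 0 <= t -> 1 <= lam t.
Proof. by move=> b0 hl t0; rewrite -hl.1; exact: lam_ndecr hl t0. Qed.

(** The unscaled energy [(w1 ^+ 2 + w2 ^+ 2) / lam ^+ 2] is dissipated. *)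
Lemma energy_growth b lam xi w1 w2 s t : (forall t, 0 <= b t) -> is_lam b lam ->
  scaled_mode b xi w1 w2 -> s <= t ->
  (w1 t ^+ 2 + w2 t ^+ 2) * lam s ^+ 2 <= (w1 s ^+ 2 + w2 s ^+ 2) * lam t ^+ 2.
Proof.
move=> b0 [_ [l0 dl]] hw st.
pose v x := - ((w1 x ^+ 2 + w2 x ^+ 2) * (lam x ^+ 2)^-1).
have ln x : lam x ^+ 2 != 0 by rewrite expf_neq0// gt_eqF.
have dv x : is_derive x 1 v (4%:R * b x * w2 x ^+ 2 / lam x ^+ 2).
  apply: is_deriv_eq (is_derivN (is_derivM (is_derivD (is_derivX 2 (hw x).1)
    (is_derivX 2 (hw x).2)) (is_derivV (is_derivX 2 (dl x)) (ln x)))) _.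
  by rewrite /=; field; rewrite gt_eqF.
have : v s <= v t.
  apply: (deriv_ge0_le st (fun x _ => dv x)) => x _.
  apply: divr_ge0; last exact: sqr_ge0.
  by apply: mulr_ge0; [exact: mulr_ge0|exact: sqr_ge0].
by rewrite /v lerN2 ler_pdivrMr ?exprn_gt0// mulrAC ler_pdivlMr ?exprn_gt0.
Qed.

(** Up to the time [1 / xi] the crude bound by [lam] is wasteful for data [(0, 1)].
    The quotient [phi = w1 / (xi lam)] has derivative [w2 / lam], and [lam w2] is
    [1] up to an error controlled by the maximum of [phi]; since [xi t <= 1] this
    error is absorbed, and [phi] is at most twice [P], the primitive of
    [1 / lam ^+ 2]. *)
Lemma low_frequency_second b lam P xi w1 w2 t : (forall t, 0 <= b t) -> is_lam b lam ->
  P 0 = 0 -> (forall t, is_derive t 1 P (lam t ^+ 2)^-1) ->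
  scaled_mode b xi w1 w2 -> w1 0 = 0 -> w2 0 = 1 -> 0 < xi -> 0 <= t <= xi^-1 ->
  `|w1 t| <= 1 + 2 * xi * lam xi^-1 * P xi^-1 /\
  `|w2 t| <= 1 + 2 * xi * lam xi^-1 * P xi^-1.
Proof.
move=> b0 hl P0 dP hw w10 w20 xi0 ht.
have [l0 [lp dl]] := hl.
set T := xi^-1 in ht *.
have T0 : 0 < T by rewrite invr_gt0.
have xiT : xi * T = 1 by rewrite divff// gt_eqF.
have xi_neq0 : xi != 0 by rewrite gt_eqF.
have ln x : lam x != 0 by rewrite gt_eqF.
have Pnd x y : x <= y -> P x <= P y.
  move=> xy; apply: (deriv_ge0_le xy (fun z _ => dP z)) => z _.
  by rewrite invr_ge0 sqr_ge0.
pose phi x := w1 x * (xi * lam x)^-1.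
have dphi x : is_derive x 1 phi (w2 x * (lam x)^-1).
  have ne : xi * lam x != 0 by rewrite mulf_neq0.
  apply: is_deriv_eq (is_derivM (hw x).1 (is_derivV (is_derivM (is_deriv_cst _ _) (dl x)) ne)) _.
  by field; rewrite ln.
have cphi : {within `[0, T], continuous (fun x => `|phi x|)}.
  apply: continuous_subspaceT => x.
  by apply: continuous_comp; [exact: is_deriv_cont (dphi x)|exact: norm_continuous].
have [c] := EVT_max (ltW T0) cphi.
rewrite in_itv/= => /andP[c0 cT] hc; set Phi := `|phi c| in hc.
have Phi0 : 0 <= Phi by rewrite normr_ge0.
have phiP x : 0 <= x <= T -> `|phi x| <= Phi by move=> hx; apply: hc; rewrite in_itv.
have w1E x : w1 x = xi * lam x * phi x by rewrite /phi; field; rewrite xi_neq0 ln.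
(* [lam w2] has derivative [- xi ^+ 2 lam ^+ 2 phi]; the majorant uses that [lam] is monotone. *)
have yb x : 0 <= x <= T -> `|lam x * w2 x - 1| <= xi ^+ 2 * Phi * (x * lam x ^+ 2).
  move=> /andP[x0 xT].
  have := @deriv_le_norm _ (fun x => lam x * w2 x) (fun x => xi ^+ 2 * Phi * (x * lam x ^+ 2))
    (fun x => - (xi ^+ 2 * lam x ^+ 2 * phi x))
    (fun x => xi ^+ 2 * Phi * (lam x ^+ 2 + 2 * x * b x * lam x ^+ 2)) 0 x x0.
  rewrite l0 w20 mul1r mul0r mulr0 subr0; apply.
  - move=> z _; apply: is_deriv_eq (is_derivM (dl z) (hw z).2) _.
    by rewrite w1E; ring.
  - move=> z _; apply: is_deriv_eq (is_derivM (is_deriv_cst _ _)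
     (is_derivM (is_deriv_id _) (is_derivX 2 (dl z)))) _.
    by rewrite /=; ring.
  - move=> z /andP[z0 zx]; rewrite normrN 2!normrM (ger0_norm (sqr_ge0 xi)) (ger0_norm (sqr_ge0 (lam z))).
    have := phiP z; rewrite z0 (le_trans zx xT) => /(_ isT) h.
    rewrite -[leLHS]mulrA -[leRHS]mulrA; apply: ler_wpM2l; first exact: sqr_ge0.
    rewrite mulrC; apply: ler_pM => //; first exact: sqr_ge0.
    by rewrite lerDl; apply: mulr_ge0 (sqr_ge0 _); rewrite mulr_ge0// mulr_ge0.
have dphib x : 0 <= x <= T -> `|w2 x / lam x| <= (lam x ^+ 2)^-1 + xi ^+ 2 * Phi * x.
  move=> hx; have := yb x hx; set D := lam x * w2 x - 1.
  have -> : w2 x / lam x = (lam x ^+ 2)^-1 * (1 + D) by rewrite /D; field; rewrite ln.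
  move=> hD; rewrite normrM ger0_norm ?invr_ge0 ?sqr_ge0//.
  have -> : (lam x ^+ 2)^-1 + xi ^+ 2 * Phi * x =
     (lam x ^+ 2)^-1 * (1 + xi ^+ 2 * Phi * (x * lam x ^+ 2)) by field; rewrite ln.
  apply: ler_wpM2l; first by rewrite invr_ge0 sqr_ge0.
  by apply: le_trans (ler_normD _ _) _; rewrite normr1 lerD2l.
have phib x : 0 <= x <= T -> `|phi x| <= P x + xi ^+ 2 * Phi * (x ^+ 2 / 2).
  move=> /andP[x0 xT].
  have := @deriv_le_norm _ phi (fun x => P x + xi ^+ 2 * Phi * (x ^+ 2 / 2))
    (fun x => w2 x / lam x)
    (fun x => (lam x ^+ 2)^-1 + xi ^+ 2 * Phi * x) 0 x x0 (fun z _ => dphi z).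
  have phi0 : phi 0 = 0 by rewrite /phi w10 mul0r.
  rewrite phi0 subr0 P0 expr0n/= mul0r mulr0 addr0 subr0; apply.
  - move=> z _; apply: is_deriv_eq (is_derivD (dP z) (is_derivM (is_deriv_cst _ _)
      (is_derivM (is_derivX 2 (is_deriv_id z)) (is_deriv_cst _ _)))) _.
    by rewrite /=; field.
  - by move=> z /andP[z0 zx]; apply: dphib; rewrite z0 (le_trans zx).
(* At its maximum, [phi] is at most [P T] plus half of itself. *)
have PhiT : Phi <= 2 * P T.
  have := phib c; rewrite c0 cT => /(_ isT); rewrite -/Phi => h.
  have : xi ^+ 2 * Phi * (c ^+ 2 / 2) <= xi ^+ 2 * Phi * (T ^+ 2 / 2).
    apply: ler_wpM2l; first by rewrite mulr_ge0// sqr_ge0.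
    by rewrite ler_wpM2r// lerXn2r// nnegrE// ltW.
  have -> : xi ^+ 2 * Phi * (T ^+ 2 / 2) = (xi * T) ^+ 2 * Phi / 2 by field.
  have := Pnd c T cT; rewrite xiT; lra.
have lT x : 0 <= x <= T -> lam x <= lam T by move=> /andP[_ xT]; exact: lam_ndecr hl xT.
have lge1 x : 0 <= x -> 1 <= lam x by exact: lam_ge1 hl.
have bound : xi * lam T * Phi <= 2 * xi * lam T * P T.
  have -> : 2 * xi * lam T * P T = xi * lam T * (2 * P T) by ring.
  by rewrite ler_wpM2l// mulr_ge0// ltW.
split.
  have -> : `|w1 t| = xi * lam t * `|phi t|.
    by rewrite w1E 2!normrM (gtr0_norm xi0) (gtr0_norm (lp t)).
  apply: le_trans (_ : xi * lam T * Phi <= _); last by lra.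
  apply: ler_pM; rewrite ?mulr_ge0 ?(ltW xi0) ?(ltW (lp _))//; last exact: phiP.
  by rewrite ler_wpM2l ?(ltW xi0)// lT.
have -> : w2 t = (lam t)^-1 * (1 + (lam t * w2 t - 1)) by field.
have [t0 tT] := andP ht.
rewrite normrM gtr0_norm ?invr_gt0//.
apply: le_trans (_ : (lam t)^-1 * (1 + xi ^+ 2 * Phi * (t * lam t ^+ 2)) <= _).
  apply: ler_wpM2l; first by rewrite invr_ge0 ltW.
  by apply: le_trans (ler_normD _ _) _; rewrite normr1 lerD2l yb.
have -> : (lam t)^-1 * (1 + xi ^+ 2 * Phi * (t * lam t ^+ 2)) =
   (lam t)^-1 + (xi * t) * (xi * lam t * Phi) by field.
apply: lerD; first by rewrite invf_le1// lge1.
apply: le_trans bound; rewrite -[leRHS]mul1r; apply: ler_pM.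
- by rewrite mulr_ge0// ltW.
- by rewrite !mulr_ge0// ltW.
- by rewrite -xiT ler_wpM2l// ltW.
- by rewrite ler_wpM2r// ler_wpM2l ?(ltW xi0)// lT.
Qed.

Lemma prod2_le (x y : R) : `|2 * x * y| <= x ^+ 2 + y ^+ 2.
Proof.
rewrite ler_norml; apply/andP; split.
  by have := sqr_ge0 (x + y); rewrite sqrrD; lra.
by have := sqr_ge0 (x - y); rewrite sqrrB; lra.
Qed.

(** The energy has derivative [2 b (w1 ^+ 2 - w2 ^+ 2)], of size [1 / t], which is not
    integrable.  But the leading part is the derivative of [- 2 (b / xi) w1 w2]:
    after adding this correction, only a term with [b'] remains, of size
    [1 / (xi t ^+ 2)], and Gronwall's argument applies.  The correction is
    harmless once [xi t >= 2 C1]. *)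
Lemma high_frequency b b' xi w1 w2 C1 C2 s t : 0 < xi ->
  (forall t, 0 < t -> is_derive t 1 b (b' t)) ->
  (forall t, 0 < t -> `|b t| <= C1 / t) -> (forall t, 0 < t -> `|b' t| <= C2 / t ^+ 2) ->
  scaled_mode b xi w1 w2 -> 0 < s -> 2 * C1 <= xi * s -> s <= t ->
  w1 t ^+ 2 + w2 t ^+ 2 <= 3 * expR (2 * C2 / (xi * s)) * (w1 s ^+ 2 + w2 s ^+ 2).
Proof.
move=> xi0 db bC1 bC2 hw s0 hs st.
have xi_neq0 : xi != 0 by rewrite gt_eqF.
pose En x := w1 x ^+ 2 + w2 x ^+ 2.
(* The corrected energy; from [s] on it lies between [En / 2] and [3 En / 2]. *)
pose En' x := En x + b x / xi * (2 * w1 x * w2 x).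
have pos x : s <= x -> 0 < x by move=> sx; exact: lt_le_trans s0 sx.
have small x : s <= x -> `|b x / xi| <= 2^-1.
  move=> sx; have x0 := pos x sx.
  rewrite normrM normfV (gtr0_norm xi0) ler_pdivrMr//.
  apply: le_trans (bC1 x x0) _; rewrite ler_pdivrMr//.
  have : xi * s <= xi * x by rewrite ler_wpM2l// ltW.
  by rewrite -mulrA; lra.
have cross x : s <= x -> `|b x / xi * (2 * w1 x * w2 x)| <= 2^-1 * En x.
  by move=> sx; rewrite normrM ler_pM// ?small// prod2_le.
have dw x : is_derive x 1 (fun x => 2 * w1 x * w2 x) (2 * xi * (w2 x ^+ 2 - w1 x ^+ 2)).
  apply: is_deriv_eq (is_derivM (is_derivM (is_deriv_cst _ _) (hw x).1) (hw x).2) _.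
  by ring.
have dE x : 0 < x -> is_derive x 1 En' (b' x / xi * (2 * w1 x * w2 x)).
  move=> x0.
  apply: is_deriv_eq (is_derivD (is_derivD (is_derivX 2 (hw x).1)
    (is_derivX 2 (hw x).2)) (is_derivM (is_derivM (db x x0) (is_deriv_cst _ _)) (dw x))) _.
  by rewrite /=; field.
(* The Gronwall factor: its logarithmic derivative is [- 2 C2 / (xi x ^+ 2)]. *)
pose e x := expR (2 * C2 / xi * x^-1).
have de x : 0 < x -> is_derive x 1 e (- (2 * C2 / xi / x ^+ 2) * e x).
  move=> x0; have xn : x != 0 by rewrite gt_eqF.
  apply: is_deriv_eq (@is_deriv_comp _ expR _ x _ _ (is_derivM (is_deriv_cst (2 * C2 / xi) _)
     (is_derivV (is_deriv_id _) xn)) (is_derive_expR _)) _.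
  by rewrite /e; field; rewrite xn.
have C20 : 0 <= C2.
  have := bC2 s s0; have := normr_ge0 (b' s) => h1 h2.
  have := le_trans h1 h2; rewrite pmulr_lge0// invr_gt0 exprn_gt0//.
have mono : En' t * e t <= En' s * e s.
  rewrite -lerN2.
  apply: (@deriv_ge0_le _ (fun x => - (En' x * e x))
     (fun x => (2 * C2 / xi / x ^+ 2 * En' x - b' x / xi * (2 * w1 x * w2 x)) * e x) s t st) => x /andP[sx _].
    have x0 := pos x sx.
    apply: is_deriv_eq (is_derivN (is_derivM (dE x x0) (de x x0))) _; ring.
  have x0 := pos x sx; apply: mulr_ge0; last exact: expR_ge0.
  rewrite subr_ge0; apply: le_trans (ler_norm _) _.
  rewrite normrM normrM normfV (gtr0_norm xi0).
  have h1 := cross x sx.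
  have h2 : 2^-1 * En x <= En' x.
    by rewrite /En'; move: h1; rewrite ler_norml => /andP[]; lra.
  apply: le_trans (_ : (C2 / x ^+ 2 / xi) * (2 * En' x) <= _).
    apply: ler_pM; rewrite ?mulr_ge0 ?invr_ge0 ?(ltW xi0)//.
      by rewrite ler_wpM2r ?invr_ge0 ?(ltW xi0)// bC2.
    by apply: le_trans (prod2_le _ _) _; rewrite -/(En x); lra.
  by rewrite le_eqVlt; apply/orP; left; apply/eqP; field; rewrite gt_eqF.
have et : 1 <= e t.
  rewrite -expR0 ler_expR mulr_ge0// ?invr_ge0 ?(ltW (pos _ st))//.
  by rewrite divr_ge0// ?(ltW xi0)// mulr_ge0.
have h1 := cross _ (lexx s); have h2 := cross t st.
have h3 : En t <= 2 * En' t.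
  by rewrite /En'; move: h2; rewrite ler_norml => /andP[]; lra.
have h4 : En' s <= 3 / 2 * En s.
  by rewrite /En'; move: h1; rewrite ler_norml => /andP[]; lra.
have h5 : En' t <= En' t * e t.
  have : 0 <= En' t by have : 0 <= En t := addr_ge0 (sqr_ge0 _) (sqr_ge0 _); lra.
  by move=> h; rewrite -[leLHS]mulr1 ler_wpM2l.
have h6 : En' s * e s <= 3 / 2 * En s * e s by rewrite ler_wpM2r// expR_ge0.
rewrite -/(En t) -/(En s) (_ : expR _ = e s); last first.
  by rewrite /e; congr expR; field; rewrite (gt_eqF s0).
have -> : 3 * e s * En s = 2 * (3 / 2 * En s * e s) by field.
by lra.
Qed.

(** [ln lam] has derivative at most [C1 / t]. *)
Lemma lam_doubling b lam C1 K x : is_lam b lam -> (forall t, 0 < t -> `|b t| <= C1 / t) ->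
  0 < x -> 1 <= K -> lam (K * x) <= expR (C1 * ln K) * lam x.
Proof.
move=> [_ [lp dl]] bC x0 K1.
have xK : x <= K * x by rewrite ler_peMl// ltW.
have K0 : 0 < K by lra.
have h := @deriv_le_le _ (fun y => ln (lam y)) (fun y => C1 * ln y) b (fun y => C1 / y) x (K * x) xK.
have pos y : x <= y <= K * x -> 0 < y by move=> /andP[xy _]; exact: lt_le_trans xy.
rewrite -[leLHS]lnK ?posrE// -[lam x]lnK ?posrE// -expRD ler_expR.
rewrite -lerBlDr; apply: le_trans (h _ _ _) _.
- move=> y hy; apply: is_deriv_eq (@is_deriv_comp _ (@ln R) _ y _ _ (dl y) (is_derive1_ln (lp y))) _.
  by field; rewrite gt_eqF.
- move=> y hy; apply: is_deriv_eq (is_derivM (is_deriv_cst _ _) (is_derive1_ln (pos y hy))) _.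
  by rewrite mul0r add0r.
- by move=> y hy; apply: le_trans (ler_norm _) (bC y (pos y hy)).
rewrite lnM ?posrE//; lra.
Qed.

(** Three zones: the hypothesis covers [t <= 1 / xi]; up to [K / xi] the energy grows at
    most like [lam ^+ 2], that is by a fixed factor; afterwards the corrected energy
    is almost conserved. *)
Lemma energy_all_times b b' lam C1 C2 : (forall t, 0 <= b t) -> is_lam b lam ->
  (forall t, 0 < t -> is_derive t 1 b (b' t)) ->
  (forall t, 0 < t -> `|b t| <= C1 / t) -> (forall t, 0 < t -> `|b' t| <= C2 / t ^+ 2) ->
  exists C, 0 <= C /\ forall xi w1 w2 (D : R), 0 < xi -> scaled_mode b xi w1 w2 ->
   (forall t, 0 <= t <= xi^-1 -> `|w1 t| <= D /\ `|w2 t| <= D) ->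
   forall t, 0 <= t -> `|w1 t| <= C * D /\ `|w2 t| <= C * D.
Proof.
move=> b0 hl db bC1 bC2.
have [l0 [lp dl]] := hl.
(* From the time [K / xi] on, [high_frequency] applies. *)
pose K := Num.max 1 (2 * C1).
have K1 : 1 <= K by rewrite le_max lexx.
have KC : 2 * C1 <= K by rewrite le_max lexx orbT.
have K0 : 0 < K by lra.
pose A := expR (C1 * ln K) ^+ 2.
pose B := 3 * expR (2 * C2 / K).
have C20 : 0 <= C2.
  by apply: le_trans (normr_ge0 (b' 1)) _; have := bC2 1 ltr01; rewrite expr1n divr1.
have C10 : 0 <= C1.
  by apply: le_trans (normr_ge0 (b 1)) _; have := bC1 1 ltr01; rewrite divr1.
have A1 : 1 <= A.
  by rewrite -(expr1n _ 2) lerXn2r ?nnegrE ?expR_ge0// -expR0 ler_expR mulr_ge0// ln_ge0.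
have B1 : 1 <= B.
  have : 1 <= expR (2 * C2 / K) by rewrite -expR0 ler_expR divr_ge0 ?mulr_ge0// ltW.
  by rewrite /B; lra.
exists (2 * A * B).
have A0 : 0 <= A by lra.
have B0 : 0 <= B by lra.
have AB : 1 <= A * B by rewrite -[leLHS]mulr1 ler_pM.
split; first by rewrite !mulr_ge0.
move=> xi w1 w2 D xi0 hw hD t t0.
have xi_neq0 : xi != 0 by rewrite gt_eqF.
have iv0 : 0 < xi^-1 by rewrite invr_gt0.
have D0 : 0 <= D by apply: le_trans (normr_ge0 (w1 0)) (hD 0 _).1; rewrite lexx ltW.
pose En x := w1 x ^+ 2 + w2 x ^+ 2.
have EnD : En xi^-1 <= 2 * D ^+ 2.
  have [|h1 h2] := hD xi^-1; first by rewrite lexx ltW.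
  have : w1 xi^-1 ^+ 2 <= D ^+ 2 by rewrite -real_normK ?num_real// lerXn2r ?nnegrE.
  have : w2 xi^-1 ^+ 2 <= D ^+ 2 by rewrite -real_normK ?num_real// lerXn2r ?nnegrE.
  by rewrite /En; lra.
suff En_le : xi^-1 <= t -> En t <= A * B * (2 * D ^+ 2).
  have [tx|/ltW xt] := leP t xi^-1.
    have [|h1 h2] := hD t; first by rewrite t0.
    have : D <= 2 * A * B * D.
      by rewrite -[leLHS]mul1r ler_wpM2r// -mulrA; lra.
    by move=> h; split; lra.
  have h : A * B * (2 * D ^+ 2) <= (2 * A * B * D) ^+ 2.
    have -> : (2 * A * B * D) ^+ 2 = (A * B) * ((2 * D ^+ 2) * (2 * (A * B))) by ring.
    apply: ler_wpM2l; first exact: mulr_ge0.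
    by rewrite -[leLHS]mulr1 ler_wpM2l ?mulr_ge0 ?sqr_ge0//; lra.
  have {}h := le_trans (En_le xt) h.
  have Z : 0 <= 2 * A * B * D by rewrite !mulr_ge0.
  split; rewrite -(ger0_norm Z) -ler_sqr ?nnegrE// !real_normK ?num_real//.
    by apply: le_trans h; rewrite lerDl sqr_ge0.
  by apply: le_trans h; rewrite lerDr sqr_ge0.
move=> xt.
have mid y : xi^-1 <= y <= K * xi^-1 -> En y <= A * (2 * D ^+ 2).
  move=> /andP[y1 y2].
  have := energy_growth b0 hl hw y1; rewrite -/(En _) -/(En _) => h.
  have l1 : 0 < lam xi^-1 ^+ 2 by rewrite exprn_gt0.
  have : lam y ^+ 2 <= A * lam xi^-1 ^+ 2.
    rewrite /A -exprMn lerXn2r ?nnegrE ?mulr_ge0 ?expR_ge0 ?(ltW (lp _))//.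
    apply: le_trans (lam_ndecr b0 hl y2) _; exact: lam_doubling hl bC1 _ _.
  move=> h2; rewrite -(ler_pM2r l1); apply: le_trans h _.
  apply: le_trans (_ : En xi^-1 * (A * lam xi^-1 ^+ 2) <= _).
    by rewrite ler_wpM2l// addr_ge0// sqr_ge0.
  rewrite [leLHS]mulrCA mulrA ler_wpM2r ?(ltW l1)//.
  by rewrite ler_wpM2l.
have [tK|/ltW Kt] := leP t (K * xi^-1).
  apply: le_trans (mid t _) _; first by rewrite xt.
  rewrite -[leRHS]mulrA ler_wpM2l// -[leLHS]mul1r ler_wpM2r//.
  by rewrite mulr_ge0// sqr_ge0.
have := @high_frequency b b' xi w1 w2 C1 C2 (K * xi^-1) t xi0 db bC1 bC2 hw.
have -> : xi * (K * xi^-1) = K by field.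
rewrite -/B -/(En _) -/(En _) => /(_ _ _ Kt) h.
apply: le_trans (h _ _) _ => //; first by rewrite mulr_gt0.
rewrite (mulrC A B) -[leRHS]mulrA ler_wpM2l//.
by apply: mid; rewrite lexx ler_peMl// ltW.
Qed.

End Energy.

(** * Asymptotic phases and the growth of the integrating factor *)

Section Limit.
Context {R : realType}.
Implicit Types (f g w b lam P : R -> R) (x s t xi T K C D a k : R).

Lemma norm_cos_le1 x : `|cos x| <= 1.
Proof. by rewrite ler_norml cos_geN1 cos_le1. Qed.
Lemma norm_sin_le1 x : `|sin x| <= 1.
Proof. by rewrite ler_norml sin_geN1 sin_le1. Qed.

(** The Cauchy criterion, with [- C / t] as a majorant. *)
Lemma cvg_of_deriv_bound (z z' : R -> R) C :
  (forall t, 0 < t -> is_derive t 1 z (z' t)) ->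
  (forall t, 0 < t -> `|z' t| <= C / t ^+ 2) -> exists l : R, z t @[t --> +oo] --> l.
Proof.
move=> dz bz; suff : cvg (z t @[t --> +oo]) by move=> cz; exists (lim (z t @[t --> +oo])).
have C0 : 0 <= C.
  by apply: le_trans (normr_ge0 _) _; last (have := bz 1 ltr01; rewrite expr1n divr1; exact).
apply: cauchy_cvg; apply: cauchy_exP => eps eps0.
pose s := C / eps + 1.
have s0 : 0 < s by rewrite ltr_wpDl// divr_ge0// ltW.
exists (z s); exists s; split; first exact: num_real.
move=> t st; rewrite /= /ball/= distrC.
have h := @deriv_le_norm _ z (fun t => - (C * t^-1)) z' (fun t => C / t ^+ 2) s t (ltW st).
have pos y : s <= y <= t -> 0 < y by move=> /andP[sy _]; exact: lt_le_trans sy.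
apply: le_lt_trans (h _ _ _) _.
- by move=> y /pos; exact: dz.
- move=> y /pos y0; have yn : y != 0 by rewrite gt_eqF.
  apply: is_deriv_eq (is_derivN (is_derivM (is_deriv_cst _ _) (is_derivV (is_deriv_id _) yn))) _.
  by field.
- by move=> y /pos; exact: bz.
have t0 : 0 < t by exact: lt_trans st.
apply: le_lt_trans (_ : C / s < _).
  by rewrite opprK gerDr oppr_le0 mulr_ge0// invr_ge0 ltW.
by rewrite ltr_pdivrMr// /s mulrDr mulr1 mulrC divfK ?gt_eqF// ltrDl.
Qed.

Lemma cvg0_inv_bound f C : (forall t, 0 < t -> `|f t| <= C / t) ->
  f t @[t --> +oo] --> 0.
Proof.
move=> bf; apply/cvgr0Pnorm_lt => eps eps0.
have C0 : 0 <= C.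
  by apply: le_trans (normr_ge0 _) _; last (have := bf 1 ltr01; rewrite divr1; exact).
near=> t; have t0 : 0 < t by [].
apply: le_lt_trans (bf t t0) _; rewrite ltr_pdivrMr// mulrC -ltr_pdivrMr//.
by near: t; apply: nbhs_pinfty_gt; exact: num_real.
Unshelve. all: by end_near. Qed.

(** Let [be = b / (2 xi)].  The variables [(w1 + be w2, w2 + be w1)] diagonalize the
    system up to terms with [b'] and [b ^+ 2], both of size [1 / t ^+ 2]; after
    undoing the free rotation their derivative is integrable, so they converge.
    The correction by [be] tends to [0]. *)
Lemma rotated_limit b b' xi w1 w2 C1 C2 (M : R) : 0 < xi ->
  (forall t, 0 < t -> is_derive t 1 b (b' t)) ->
  (forall t, 0 < t -> `|b t| <= C1 / t) -> (forall t, 0 < t -> `|b' t| <= C2 / t ^+ 2) ->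
  scaled_mode b xi w1 w2 -> (forall t, 0 <= t -> `|w1 t| <= M /\ `|w2 t| <= M) ->
  exists l : R * R,
   (cos (xi * t) * w1 t - sin (xi * t) * w2 t) @[t --> +oo] --> l.1 /\
   (sin (xi * t) * w1 t + cos (xi * t) * w2 t) @[t --> +oo] --> l.2.
Proof.
move=> xi0 db bC1 bC2 hw hM.
have xin : xi != 0 by rewrite gt_eqF.
have M0 : 0 <= M by apply: le_trans (normr_ge0 _) (hM 0 (lexx _)).1.
have C10 : 0 <= C1.
  by apply: le_trans (normr_ge0 _) _; last (have := bC1 1 ltr01; rewrite divr1; exact).
pose be t := b t / (2 * xi).
pose h1 t := w1 t + be t * w2 t; pose h2 t := w2 t + be t * w1 t.
pose r1 t := (b' t / (2 * xi) - be t * b t) * w2 t.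
pose r2 t := (b' t / (2 * xi) + be t * b t) * w1 t.
have dbe t : 0 < t -> is_derive t 1 be (b' t / (2 * xi)).
  by move=> t0; apply: is_deriv_eq (is_derivM (db t t0) (is_deriv_cst _ _)) _; rewrite mulr0 addr0.
have dh1 t : 0 < t -> is_derive t 1 h1 (xi * h2 t + r1 t).
  move=> t0; apply: is_deriv_eq (is_derivD (hw t).1 (is_derivM (dbe t t0) (hw t).2)) _.
  by rewrite /h2 /r1 /be; field.
have dh2 t : 0 < t -> is_derive t 1 h2 (- (xi * h1 t) + r2 t).
  move=> t0; apply: is_deriv_eq (is_derivD (hw t).2 (is_derivM (dbe t t0) (hw t).1)) _.
  by rewrite /h1 /r2 /be; field.
have dxi t : is_derive t 1 (fun t => xi * t) xi.
  by apply: is_deriv_eq (is_derivM (is_deriv_cst _ _) (is_deriv_id _)) _; rewrite mul0r add0r mulr1.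
have dc t : is_derive t 1 (fun t => cos (xi * t)) (- sin (xi * t) * xi).
  exact: (@is_deriv_comp _ cos _ t) (dxi t) (is_derive_cos _).
have ds t : is_derive t 1 (fun t => sin (xi * t)) (cos (xi * t) * xi).
  exact: (@is_deriv_comp _ sin _ t) (dxi t) (is_derive_sin _).
have be_bd t : 0 < t -> `|be t| <= C1 / (2 * xi) / t.
  move=> t0; rewrite normrM normfV (gtr0_norm (_ : 0 < 2 * xi)) ?mulr_gt0//.
  by rewrite mulrAC ler_wpM2r ?bC1// invr_ge0 mulr_ge0// ltW.
pose Q := (C2 / (2 * xi) + C1 / (2 * xi) * C1).
have aux t : 0 < t -> `|b' t / (2 * xi)| + `|be t * b t| <= Q / t ^+ 2.
  move=> t0; rewrite [leRHS]mulrDl lerD//.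
    rewrite normrM normfV (gtr0_norm (_ : 0 < 2 * xi)) ?mulr_gt0//.
    by rewrite mulrAC ler_wpM2r ?bC2// invr_ge0 mulr_ge0// ltW.
  have -> : C1 / (2 * xi) * C1 / t ^+ 2 = (C1 / (2 * xi) / t) * (C1 / t).
    by field; rewrite xin gt_eqF.
  by rewrite normrM ler_pM// ?be_bd// bC1.
have rb1 t : 0 < t -> `|r1 t| <= Q / t ^+ 2 * M.
  move=> t0; rewrite normrM ler_pM//; last exact: (hM t (ltW t0)).2.
  by apply: le_trans (aux t t0); exact: ler_normB.
have rb2 t : 0 < t -> `|r2 t| <= Q / t ^+ 2 * M.
  move=> t0; rewrite normrM ler_pM//; last exact: (hM t (ltW t0)).1.
  by apply: le_trans (aux t t0); exact: ler_normD.
have comb (x y u v : R) : `|x| <= 1 -> `|y| <= 1 -> `|x * u + y * v| <= `|u| + `|v|.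
  move=> x1 y1; apply: le_trans (ler_normD _ _) _; rewrite !normrM.
  by apply: lerD; rewrite -[leRHS]mul1r ler_wpM2r.
have cs1 := norm_cos_le1; have sn1 := norm_sin_le1.
have rb t (x y : R) : 0 < t -> `|x| <= 1 -> `|y| <= 1 ->
    `|x * r1 t + y * r2 t| <= 2 * Q * M / t ^+ 2.
  move=> tp x1 y1; apply: le_trans (comb _ _ _ _ x1 y1) _.
  have -> : 2 * Q * M / t ^+ 2 = Q / t ^+ 2 * M + Q / t ^+ 2 * M by ring.
  by apply: lerD; [exact: rb1|exact: rb2].
pose z1 t := cos (xi * t) * h1 t - sin (xi * t) * h2 t.
pose z2 t := sin (xi * t) * h1 t + cos (xi * t) * h2 t.
have dz1 t : 0 < t -> is_derive t 1 z1 (cos (xi * t) * r1 t + - sin (xi * t) * r2 t).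
  move=> tp; apply: is_deriv_eq (is_derivD (is_derivM (dc t) (dh1 t tp))
    (is_derivN (is_derivM (ds t) (dh2 t tp)))) _; ring.
have dz2 t : 0 < t -> is_derive t 1 z2 (sin (xi * t) * r1 t + cos (xi * t) * r2 t).
  move=> tp; apply: is_deriv_eq (is_derivD (is_derivM (ds t) (dh1 t tp))
    (is_derivM (dc t) (dh2 t tp))) _; ring.
have [t tp|l1 cl1] := cvg_of_deriv_bound dz1 (C := 2 * Q * M).
  by apply: rb => //; rewrite normrN.
have [t tp|l2 cl2] := cvg_of_deriv_bound dz2 (C := 2 * Q * M); first exact: rb.
exists (l1, l2) => /=.
(* Going back from [h1, h2] to [w1, w2] changes the rotated quantities by [O(be)]. *)
have corr (x y : R -> R) : (forall t, `|x t| <= 1) -> (forall t, `|y t| <= 1) ->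
   be t * (x t * w1 t + y t * w2 t) @[t --> +oo] --> 0.
  move=> x1 y1; apply: (@cvg0_inv_bound _ (C1 / (2 * xi) * (M + M))) => t t0.
  rewrite normrM [leRHS]mulrAC; apply: ler_pM => //; first exact: be_bd.
  apply: le_trans (comb _ _ _ _ (x1 t) (y1 t)) _.
  by have [? ?] := hM t (ltW t0); apply: lerD.
split.
  have -> : (fun t => cos (xi * t) * w1 t - sin (xi * t) * w2 t) =
      (fun t => z1 t - be t * (- sin (xi * t) * w1 t + cos (xi * t) * w2 t)).
    by apply/funext => t; rewrite /z1 /h1 /h2; ring.
  rewrite -[l1]subr0; apply: cvgB cl1 _.
  by apply: (corr (fun t => - sin (xi * t))) => t; rewrite ?normrN.
have -> : (fun t => sin (xi * t) * w1 t + cos (xi * t) * w2 t) =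
    (fun t => z2 t - be t * (cos (xi * t) * w1 t + sin (xi * t) * w2 t)).
  by apply/funext => t; rewrite /z2 /h1 /h2; ring.
rewrite -[l2]subr0; apply: cvgB cl2 _.
exact: (corr (fun t => cos (xi * t))).
Qed.

(** [ln lam] has derivative at most [mu / t] for large [t]. *)
Lemma lam_power_bound b lam mu a t0 : (forall t, 0 <= b t) -> is_lam b lam ->
  (forall t, t0 <= t -> t * b t <= mu) -> 0 <= a -> mu <= a ->
  exists C, 0 < C /\ forall t, 0 <= t -> lam t <= C * (Num.max 1 t) `^ a.
Proof.
move=> b0 hl hmu a0 mua; have [l0 [lp dl]] := hl.
pose t1 := Num.max 1 t0.
have t11 : 1 <= t1 by rewrite le_max lexx.
exists (lam t1); split => // t tp.
have m1 : 1 <= Num.max 1 t by rewrite le_max lexx.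
have [tt|/ltW tt] := leP t t1.
  apply: le_trans (lam_ndecr b0 hl tt) _.
  rewrite ler_peMr ?(ltW (lp _))// -[leLHS](powRr0 (Num.max 1 t)).
  exact: ler_powR.
have pos y : t1 <= y <= t -> 0 < y by move=> /andP[sy _]; lra.
have h := @deriv_le_le _ (fun y => ln (lam y)) (fun y => mu * ln y) b (fun y => mu / y) t1 t tt.
have t0' : 0 < t by lra.
have tm : Num.max 1 t = t by apply/max_idPr; lra.
rewrite tm /powR (gt_eqF t0').
rewrite -[leLHS]lnK ?posrE// -[lam t1]lnK ?posrE// -expRD ler_expR.
rewrite -lerBlDl; apply: le_trans (h _ _ _) _.
- move=> y hy; apply: is_deriv_eq (@is_deriv_comp _ (@ln R) _ y _ _ (dl y) (is_derive1_ln (lp y))) _.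
  by field; rewrite gt_eqF.
- move=> y hy; apply: is_deriv_eq (is_derivM (is_deriv_cst _ _) (is_derive1_ln (pos y hy))) _.
  by rewrite mul0r add0r.
- move=> y hy; rewrite ler_pdivlMr ?pos// mulrC hmu//.
  by have /andP[+ _] := hy; rewrite /t1 ge_max => /andP[].
have ln1 : 0 <= ln t1 by rewrite ln_ge0.
have ln2 : ln t1 <= ln t by rewrite ler_ln ?posrE; lra.
rewrite -mulrBr; apply: le_trans (_ : a * (ln t - ln t1) <= _).
  by rewrite ler_wpM2r//; lra.
by rewrite ler_wpM2l//; lra.
Qed.

(** The derivative of [t / lam ^+ 2] is [(1 - 2 t b) / lam ^+ 2].  If [t b] stays below
    [1/2], the primitive [P] of [1 / lam ^+ 2] is therefore dominated by
    [t / lam ^+ 2], and the quotient is bounded; if [t b] stays above [1/2], then [P]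
    itself is bounded, and the quotient is [O(lam / t)].  This is where the
    critical value [1/2] is excluded. *)
Lemma lamP_power_bound b lam P mu a t0 : (forall t, 0 <= b t) -> is_lam b lam ->
  P 0 = 0 -> (forall t, is_derive t 1 P (lam t ^+ 2)^-1) ->
  (forall t, t0 <= t -> t * b t <= mu) -> 0 <= a -> mu <= a + 1 ->
  (exists2 k, k < 2^-1 & forall t, t0 <= t -> t * b t <= k) \/
  (exists2 k, 2^-1 < k & forall t, t0 <= t -> k <= t * b t) ->
  exists C, 0 < C /\ forall t, 0 < t -> lam t * P t / t <= C * (Num.max 1 t) `^ a.
Proof.
move=> b0 hl P0 dP hmu a0 mua hk; have [l0 [lp dl]] := hl.
pose t1 := Num.max 1 t0.
have t11 : 1 <= t1 by rewrite le_max lexx.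
have t1t0 t : t1 <= t -> t0 <= t by rewrite /t1 ge_max => /andP[].
have Plt t : 0 <= t -> P t <= t.
  move=> tp; have := deriv_le_le tp (fun x _ => dP x) (fun x _ => is_deriv_id x).
  rewrite P0 !subr0; apply => x /andP[x0 _].
  by rewrite invf_le1 ?exprn_gt0// exprn_ege1// (lam_ge1 b0 hl).
have P0' t : 0 <= t -> 0 <= P t.
  move=> tp; rewrite -P0; apply: deriv_ge0_le tp (fun x _ => dP x) _ => x _.
  by rewrite invr_ge0 sqr_ge0.
have m1 t : 1 <= Num.max 1 t by rewrite le_max lexx.
have pw1 t : 1 <= (Num.max 1 t) `^ a.
  by rewrite -[leLHS](powRr0 (Num.max 1 t)); exact: ler_powR.
suff [D [D0 hD]] : exists D, 0 < D /\ forall t, t1 <= t -> lam t * P t / t <= D * t `^ a.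
  exists (lam t1 + D); split; first by rewrite addr_gt0.
  move=> t tp; have [tt|/ltW tt] := leP t t1.
    apply: le_trans (_ : lam t1 <= _).
      rewrite ler_pdivrMr// ler_pM ?(ltW (lp _)) ?P0' ?Plt ?(ltW tp)//.
      exact: lam_ndecr hl tt.
    have : lam t1 <= (lam t1 + D) * 1 by lra.
    by move=> /le_trans; apply; rewrite ler_wpM2l// addr_ge0// ltW.
  have tm : Num.max 1 t = t by apply/max_idPr; lra.
  apply: le_trans (hD t tt) _; rewrite tm ler_wpM2r ?powR_ge0//.
  by rewrite lerDr ltW.
(* The identity by which [t b] is compared with [1/2]. *)
have dtl x : is_derive x 1 (fun x => x * (lam x ^+ 2)^-1) ((lam x ^+ 2)^-1 * (1 - 2 * (x * b x))).
  have ln : lam x ^+ 2 != 0 by rewrite expf_neq0// gt_eqF.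
  apply: is_deriv_eq (is_derivM (is_deriv_id _) (is_derivV (is_derivX 2 (dl x)) ln)) _.
  by rewrite /=; field; rewrite gt_eqF.
case: hk => -[k kh hk].
  have [C [C0 hC]] := lam_power_bound (a := 1) b0 hl hk ler01 ltac:(lra).
  have k0 : 0 < 1 - 2 * k by lra.
  exists (t1 * C + (1 - 2 * k)^-1); split.
    by rewrite addr_gt0 ?invr_gt0// mulr_gt0//; lra.
  move=> t tt; have tp : 0 < t by lra.
  have tm : Num.max 1 t = t by apply/max_idPr; lra.
  have h : P t - P t1 <= (1 - 2 * k)^-1 * (t * (lam t ^+ 2)^-1) -
                         (1 - 2 * k)^-1 * (t1 * (lam t1 ^+ 2)^-1).
    apply: (@deriv_le_le _ P (fun x => (1 - 2 * k)^-1 * (x * (lam x ^+ 2)^-1))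
     (fun x => (lam x ^+ 2)^-1) (fun x => (1 - 2 * k)^-1 * ((lam x ^+ 2)^-1 * (1 - 2 * (x * b x)))) t1 t tt) => x.
    move=> /andP[tx _]; have := hk x (t1t0 _ tx) => hkx.
    rewrite mulrCA ler_peMr ?invr_ge0 ?sqr_ge0//.
    by rewrite mulrC ler_pdivlMr//; lra.
  have hP : P t <= t1 + (1 - 2 * k)^-1 * (t * (lam t ^+ 2)^-1).
    have := Plt t1 ltac:(lra).
    have : 0 <= (1 - 2 * k)^-1 * (t1 * (lam t1 ^+ 2)^-1).
      by rewrite !mulr_ge0 ?invr_ge0 ?sqr_ge0//; lra.
    by lra.
  apply: le_trans (_ : (t1 * C + (1 - 2 * k)^-1) * 1 <= _); last first.
    rewrite ler_wpM2l// ?addr_ge0 ?invr_ge0 ?mulr_ge0//; try lra.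
    by rewrite -tm.
  rewrite mulr1 ler_pdivrMr//.
  apply: le_trans (_ : lam t * (t1 + (1 - 2 * k)^-1 * (t * (lam t ^+ 2)^-1)) <= _).
    by rewrite ler_wpM2l// ltW.
  have -> : lam t * (t1 + (1 - 2 * k)^-1 * (t * (lam t ^+ 2)^-1)) =
     t1 * lam t + (1 - 2 * k)^-1 * t * (lam t)^-1.
    by field; rewrite (gt_eqF k0) (gt_eqF (lp t)).
  rewrite [leRHS]mulrDl; apply: lerD.
    rewrite -mulrA ler_wpM2l//; first lra.
    by have := hC t (ltW tp); rewrite tm powRr1// ltW.
  rewrite ler_piMr ?mulr_ge0 ?invr_ge0 ?(ltW k0) ?(ltW tp)//.
  by rewrite invf_le1// (lam_ge1 b0 hl)// ltW.
have [C [C0 hC]] := lam_power_bound (a := a + 1) b0 hl hmu (addr_ge0 a0 ler01) mua.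
have k0 : 0 < 2 * k - 1 by lra.
exists (C * (t1 + (2 * k - 1)^-1 * t1)); split.
  by rewrite mulr_gt0// addr_gt0 ?mulr_gt0 ?invr_gt0//; lra.
move=> t tt; have tp : 0 < t by lra.
have tm : Num.max 1 t = t by apply/max_idPr; lra.
have h : P t - P t1 <= - (2 * k - 1)^-1 * (t * (lam t ^+ 2)^-1) -
                       - (2 * k - 1)^-1 * (t1 * (lam t1 ^+ 2)^-1).
  apply: (@deriv_le_le _ P (fun x => - (2 * k - 1)^-1 * (x * (lam x ^+ 2)^-1))
   (fun x => (lam x ^+ 2)^-1) (fun x => - (2 * k - 1)^-1 * ((lam x ^+ 2)^-1 * (1 - 2 * (x * b x)))) t1 t tt) => x.
  move=> /andP[tx _]; have := hk x (t1t0 _ tx) => hkx.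
  rewrite mulrCA ler_peMr ?invr_ge0 ?sqr_ge0//.
  rewrite mulNr -mulrN mulrC ler_pdivlMr//; lra.
have hP : P t <= t1 + (2 * k - 1)^-1 * t1.
  have := Plt t1 ltac:(lra).
  have : 0 <= (2 * k - 1)^-1 * (t * (lam t ^+ 2)^-1).
    by rewrite !mulr_ge0 ?invr_ge0 ?sqr_ge0//; lra.
  have : (2 * k - 1)^-1 * (t1 * (lam t1 ^+ 2)^-1) <= (2 * k - 1)^-1 * t1.
    rewrite ler_wpM2l ?invr_ge0 ?(ltW k0)//.
    rewrite ler_pdivrMr ?exprn_gt0// ler_peMr//; first by lra.
    by rewrite exprn_ege1// (lam_ge1 b0 hl)//; lra.
  by lra.
rewrite ler_pdivrMr//.
apply: le_trans (_ : C * t `^ (a + 1) * (t1 + (2 * k - 1)^-1 * t1) <= _).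
  apply: ler_pM; rewrite ?P0' ?(ltW (lp _)) ?(ltW tp)//.
  by have := hC t (ltW tp); rewrite tm.
rewrite powRD; last by rewrite (gt_eqF tp) implybT.
by rewrite powRr1 ?(ltW tp)// le_eqVlt; apply/orP; left; apply/eqP; ring.
Qed.

Lemma max_inv_bound a N : 0 <= a -> 0 < N -> exists C, 0 < C /\
  forall xi, 0 < xi -> (Num.max 1 xi^-1) `^ a <= C * (Num.min xi N) `^ (- a).
Proof.
move=> a0 N0; exists ((Num.max 1 N) `^ a); split.
  by rewrite powR_gt0// lt_max ltr01.
move=> xi xi0.
have mi0 : 0 < Num.min xi N by rewrite lt_min xi0.
have hx : Num.max 1 xi^-1 * Num.min xi N <= Num.max 1 N.
  have [xi1|xi1] := leP 1 xi^-1; last by rewrite mul1r ge_min [N <= _]le_max lexx !orbT.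
  apply: le_trans (_ : xi^-1 * xi <= _).
    by rewrite ler_wpM2l ?invr_ge0 ?(ltW xi0)// ge_min lexx.
  by rewrite mulVf ?gt_eqF// le_max lexx.
have m0 : 0 <= Num.max 1 xi^-1 by rewrite le_max ler01.
rewrite powRN -ler_pdivrMr ?invr_gt0 ?powR_gt0// invrK -powRM ?(ltW mi0)//.
apply: ge0_ler_powR => //; rewrite ?nnegrE ?mulr_ge0 ?(ltW mi0)//.
by rewrite le_max ler01.
Qed.

End Limit.

(** * The fundamental matrix of the modes *)

Section Propagator.
Context {R : realType}.
Implicit Types (f b lam P : R -> R) (x s t xi T K C D a k g N mu : R) (j : bool).
Implicit Types (w : bool -> R -> R -> R * R).

(** Column [j] of [w] is the mode with initial value [(1, 0)] if [j] is [true], and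
    [(0, 1)] otherwise. *)
Record propagator b lam w : Prop := Propagator {
  pr_lam : is_lam b lam ;
  pr_mode : forall j xi,
    scaled_mode b xi (fun t => (w j xi t).1) (fun t => (w j xi t).2) ;
  pr_init : forall j xi, w j xi 0 = (j%:R, (~~ j)%:R) ;
  pr_meas1 : forall j t, measurable_fun [set: R] (fun xi => (w j xi t).1) ;
  pr_meas2 : forall j t, measurable_fun [set: R] (fun xi => (w j xi t).2) }.

(** The unscaled quantities [(w1 / lam, lam w2)] satisfy a system without diagonal
    terms, with coefficients [xi / lam ^+ 2] and [xi lam ^+ 2]. *)
Lemma propagator_exists b : continuous b ->
  exists w, propagator b (fun t => expR (prim b t)) w.
Proof.
move=> cb; have [B0 dB] := primP cb.
pose lam t := expR (prim b t).
have dl t : is_derive t 1 lam (b t * lam t).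
  apply: is_deriv_eq (@is_deriv_comp _ expR _ t _ _ (dB t) (is_derive_expR _)) _.
  by rewrite mulrC.
have hl : is_lam b lam.
  by split; [rewrite /lam B0 expR0|split => // t; exact: expR_gt0].
have ln t : lam t != 0 by rewrite gt_eqF// hl.2.1.
have ln2 t : lam t ^+ 2 != 0 by rewrite expf_neq0.
have cq : continuous (fun t => lam t ^+ 2).
  by move=> t; exact: is_deriv_cont (is_derivX 2 (dl t)).
have cp : continuous (fun t => (lam t ^+ 2)^-1).
  by move=> t; exact: is_deriv_cont (is_derivV (is_derivX 2 (dl t)) (ln2 t)).
have [v [v0 [dv mv]]] : exists v : bool -> R -> R -> R * R,
    (forall j xi, v j xi 0 = (j%:R, (~~ j)%:R)) /\
    (forall j xi t,
      is_derive t 1 (fun t => (v j xi t).1) (xi * (lam t ^+ 2)^-1 * (v j xi t).2) /\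
      is_derive t 1 (fun t => (v j xi t).2) (- (xi * lam t ^+ 2 * (v j xi t).1))) /\
    (forall j t, measurable_fun [set: R] (fun xi => (v j xi t).1) /\
                 measurable_fun [set: R] (fun xi => (v j xi t).2)).
  exists (fun j => ode_sol (fun t => (lam t ^+ 2)^-1) (fun t => lam t ^+ 2) (j%:R, (~~ j)%:R)).
  split; first by move=> j xi; exact: (ode_solP _ xi cp cq).1.
  split; first by move=> j xi; exact: (ode_solP _ xi cp cq).2.
  by move=> j t; exact: measurable_ode_sol.
exists (fun j xi t => (lam t * (v j xi t).1, (lam t)^-1 * (v j xi t).2)).
split => //.
- move=> j xi t /=; have [d1 d2] := dv j xi t; split.
    by apply: is_deriv_eq (is_derivM (dl t) d1) _; field.
  by apply: is_deriv_eq (is_derivM (is_derivV (dl t) (ln t)) d2) _; field.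
- by move=> j xi; rewrite v0/= hl.1 invr1 !mul1r.
- by move=> j t; apply: measurable_funM => //; exact: (mv j t).1.
- by move=> j t; apply: measurable_funM => //; exact: (mv j t).2.
Qed.

Definition rotation (j : bool) xi t : R * R :=
  if j then (cos (xi * t), - sin (xi * t)) else (sin (xi * t), cos (xi * t)).

Lemma rotation_propagator : propagator (fun=> 0) (fun=> 1) rotation.
Proof.
have dxi xi t : is_derive t 1 (fun t => xi * t) xi.
  by apply: is_deriv_eq (is_derivM (is_deriv_cst _ _) (is_deriv_id _)) _; rewrite mul0r add0r mulr1.
have dc xi t : is_derive t 1 (fun t => cos (xi * t)) (- sin (xi * t) * xi).
  exact: (@is_deriv_comp _ cos _ t) (dxi xi t) (is_derive_cos _).
have ds xi t : is_derive t 1 (fun t => sin (xi * t)) (cos (xi * t) * xi).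
  exact: (@is_deriv_comp _ sin _ t) (dxi xi t) (is_derive_sin _).
have mc t : measurable_fun [set: R] (fun xi : R => cos (xi * t)).
  apply: (measurableT_comp (f := @cos R)); first by apply: continuous_measurable_fun; exact: continuous_cos.
  by apply: measurable_funM.
have ms t : measurable_fun [set: R] (fun xi : R => sin (xi * t)).
  apply: (measurableT_comp (f := @sin R)); first by apply: continuous_measurable_fun; exact: continuous_sin.
  by apply: measurable_funM.
split.
- split=> //; split => // t.
  by apply: is_deriv_eq (is_deriv_cst _ _) _; rewrite mul0r.
- move=> [] xi t /=; split.
  + by apply: is_deriv_eq (dc xi t) _; ring.
  + by apply: is_deriv_eq (is_derivN (ds xi t)) _; ring.
  + by apply: is_deriv_eq (ds xi t) _; ring.
  + by apply: is_deriv_eq (dc xi t) _; ring.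
- by move=> [] xi /=; rewrite mulr0 sin0 cos0 ?oppr0.
- by case=> t /=.
- by case=> t /=; [apply: measurableT_comp|].
Qed.

(** Liouville's formula for a system with trace zero. *)
Lemma propagator_det b lam w xi t : propagator b lam w ->
  (w true xi t).1 * (w false xi t).2 - (w false xi t).1 * (w true xi t).2 = 1.
Proof.
move=> hw.
pose D t := (w true xi t).1 * (w false xi t).2 - (w false xi t).1 * (w true xi t).2.
have dD s : is_derive s 1 D 0.
  apply: is_deriv_eq (is_derivD (is_derivM (pr_mode hw true xi s).1 (pr_mode hw false xi s).2)
    (is_derivN (is_derivM (pr_mode hw false xi s).1 (pr_mode hw true xi s).2))) _.
  ring.
have D0 : D 0 = 1 by rewrite /D !(pr_init hw) /=; ring.
have [t0|/ltW t0] := leP 0 t; rewrite -/(D t).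
  by rewrite (deriv0_cst t0).
by rewrite -(deriv0_cst t0).
Qed.

Lemma norm_le_of_sqr (x y A : R) : 0 <= A -> x ^+ 2 + y ^+ 2 <= A ^+ 2 ->
  `|x| <= A /\ `|y| <= A.
Proof.
move=> A0 h; split; rewrite -(ger0_norm A0) -ler_sqr ?nnegrE// !real_normK ?num_real//.
  by apply: le_trans h; rewrite lerDl sqr_ge0.
by apply: le_trans h; rewrite lerDr sqr_ge0.
Qed.

Lemma propagator_le_lam b lam w j xi t : (forall t, 0 <= b t) -> propagator b lam w ->
  0 <= t -> `|(w j xi t).1| <= lam t /\ `|(w j xi t).2| <= lam t.
Proof.
move=> b0 hw t0; have hl := pr_lam hw; apply: norm_le_of_sqr; first exact/ltW/hl.2.1.
have := energy_growth b0 hl (pr_mode hw j xi) t0.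
have e : (j%:R ^+ 2 + (~~ j)%:R ^+ 2 : R) = 1.
  by case: j; rewrite /= expr1n expr0n/= ?addr0 ?add0r.
by rewrite (pr_init hw) hl.1 /= expr1n mulr1 e mul1r.
Qed.

(** Bounds, as [xi] tends to [0], for the two columns of the fundamental matrix; they
    are the weights of the energy space of order [g], the first column being more
    singular by one power. *)
Definition weight (N g : R) (j : bool) xi : R :=
  (Num.min xi N) `^ (- (if j then g + 1 else g)).

Lemma weight_ge0 N g j xi : 0 <= weight N g j xi. Proof. exact: powR_ge0. Qed.

Definition dissipation b b' C1 C2 : Prop :=
  [/\ continuous b, forall t, 0 <= b t,
   forall t, 0 < t -> is_derive t 1 b (b' t),
   forall t, 0 < t -> `|b t| <= C1 / t & forall t, 0 < t -> `|b' t| <= C2 / t ^+ 2].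

Definition non_critical b mu t0 : Prop :=
  (forall t, t0 <= t -> t * b t <= mu) /\
  ((exists2 k, k < 2^-1 & forall t, t0 <= t -> t * b t <= k) \/
   (exists2 k, 2^-1 < k & forall t, t0 <= t -> k <= t * b t)).

(** By [energy_all_times] it is enough to consider [t <= 1 / xi].  There the first
    column is at most [lam (1 / xi)], and the second one is estimated in
    [low_frequency_second]; both quantities are dominated by powers of [1 / xi]. *)
Lemma propagator_bound b b' lam w C1 C2 mu t0 N g :
  dissipation b b' C1 C2 -> non_critical b mu t0 -> propagator b lam w ->
  0 < N -> 0 <= g -> mu <= g + 1 ->
  exists C, 0 <= C /\ forall j xi t, 0 < xi -> 0 <= t ->
    `|(w j xi t).1| <= C * weight N g j xi /\ `|(w j xi t).2| <= C * weight N g j xi.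
Proof.
move=> [cb b0 db bC1 bC2] [hmu hk] hw N0 g0 mug.
have hl := pr_lam hw; have [l0 [lp dl]] := hl.
have g10 : 0 <= g + 1 by lra.
have ln2 t : lam t ^+ 2 != 0 by rewrite expf_neq0// gt_eqF.
have cp : continuous (fun t => (lam t ^+ 2)^-1).
  by move=> t; exact: is_deriv_cont (is_derivV (is_derivX 2 (dl t)) (ln2 t)).
have [P0 dP] := primP cp; set P := prim _ in P0 dP.
have [A [A0 hA]] := energy_all_times b0 hl db bC1 bC2.
have [B [B0 hB]] := lam_power_bound b0 hl hmu g10 mug.
have [D [D0 hD]] := lamP_power_bound b0 hl P0 dP hmu g0 mug hk.
have [M1 [M10 hM1]] := max_inv_bound g10 N0.
have [M2 [M20 hM2]] := max_inv_bound g0 N0.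
exists (A * (B * M1 + (1 + 2 * D) * M2)); split.
  apply: mulr_ge0 => //; apply: addr_ge0; first by rewrite ltW// mulr_gt0.
  by rewrite mulr_ge0 ?(ltW M20)//; lra.
move=> j xi t xi0 tp.
have iv0 : 0 < xi^-1 by rewrite invr_gt0.
set S := B * M1 + _.
suff h s : 0 <= s <= xi^-1 -> `|(w j xi s).1| <= S * weight N g j xi /\
    `|(w j xi s).2| <= S * weight N g j xi.
  by rewrite -mulrA; exact: (hA xi _ _ _ xi0 (pr_mode hw j xi) h).
move=> hs; have [s0 sx] := andP hs.
have [S1 S2] : B * M1 <= S /\ (1 + 2 * D) * M2 <= S.
  rewrite /S lerDl lerDr; split; first by rewrite mulr_ge0 ?(ltW M20)//; lra.
  by rewrite ltW// mulr_gt0.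
have Z := weight_ge0 N g j xi.
case: j Z => Z.
  have hb : lam xi^-1 <= S * weight N g true xi.
    apply: le_trans (hB _ (ltW iv0)) _.
    apply: le_trans (_ : B * (M1 * weight N g true xi) <= _).
      by rewrite ler_wpM2l ?(ltW B0)// hM1.
    by rewrite mulrA ler_wpM2r.
  have ls := lam_ndecr b0 hl sx.
  have [h1 h2] := propagator_le_lam true xi b0 hw s0.
  by split; apply: le_trans hb; [apply: le_trans h1 ls|apply: le_trans h2 ls].
have i := pr_init hw false xi.
have [h1 h2] := low_frequency_second b0 hl P0 dP (pr_mode hw false xi)
  (congr1 fst i) (congr1 snd i) xi0 hs.
suff hb : 1 + 2 * xi * lam xi^-1 * P xi^-1 <= S * weight N g false xi.
  by split; apply: le_trans hb.
have e : 2 * xi * lam xi^-1 * P xi^-1 = 2 * (lam xi^-1 * P xi^-1 / xi^-1).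
  by rewrite invrK; ring.
rewrite e; have := hD _ iv0; set Y := _ / _ => hY.
have m1 : 1 <= (Num.max 1 xi^-1) `^ g.
  have m : 1 <= Num.max 1 xi^-1 by rewrite le_max lexx.
  by rewrite -[leLHS](powRr0 (Num.max 1 xi^-1)); exact: ler_powR.
apply: le_trans (_ : (1 + 2 * D) * (Num.max 1 xi^-1) `^ g <= _); first by lra.
apply: le_trans (_ : (1 + 2 * D) * (M2 * weight N g false xi) <= _).
  by rewrite ler_wpM2l ?hM2//; lra.
by rewrite mulrA ler_wpM2r.
Qed.

Definition rotated xi t (v : R * R) : R * R :=
  (cos (xi * t) * v.1 - sin (xi * t) * v.2, sin (xi * t) * v.1 + cos (xi * t) * v.2).

Lemma rotated_bound xi t (v : R * R) C : `|v.1| <= C -> `|v.2| <= C ->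
  `|(rotated xi t v).1| <= 2 * C /\ `|(rotated xi t v).2| <= 2 * C.
Proof.
move=> h1 h2.
have cs1 := @norm_cos_le1 R; have sn1 := @norm_sin_le1 R.
have e : 2 * C = 1 * C + 1 * C by ring.
rewrite e; split.
  by apply: le_trans (ler_normB _ _) _; rewrite !normrM; apply: lerD; apply: ler_pM.
by apply: le_trans (ler_normD _ _) _; rewrite !normrM; apply: lerD; apply: ler_pM.
Qed.

(** [Z] collects the limits of the columns rotated back to time [0].  Its determinant is
    [1] because rotations and the fundamental matrix have determinant [1], and it
    inherits the bounds of the columns. *)
Lemma wave_matrix b b' lam w C1 C2 mu t0 N g :
  dissipation b b' C1 C2 -> non_critical b mu t0 -> propagator b lam w ->
  0 < N -> 0 <= g -> mu <= g + 1 ->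
  exists (Z : bool -> R -> R * R) C,
   [/\ forall j, measurable_fun [set: R] (fun xi => (Z j xi).1) /\
                 measurable_fun [set: R] (fun xi => (Z j xi).2),
    0 <= C,
    forall j xi t, 0 < xi -> 0 <= t ->
     [/\ `|(w j xi t).1| <= C * weight N g j xi, `|(w j xi t).2| <= C * weight N g j xi,
         `|(Z j xi).1| <= C * weight N g j xi & `|(Z j xi).2| <= C * weight N g j xi],
    forall xi, 0 < xi ->
     (Z true xi).1 * (Z false xi).2 - (Z false xi).1 * (Z true xi).2 = 1 &
    forall j xi, 0 < xi ->
     ((w j xi t).1 - ((rotation true xi t).1 * (Z j xi).1 + (rotation false xi t).1 * (Z j xi).2)
        @[t --> +oo] --> 0) /\
     ((w j xi t).2 - ((rotation true xi t).2 * (Z j xi).1 + (rotation false xi t).2 * (Z j xi).2)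
        @[t --> +oo] --> 0)].
Proof.
move=> hb hk hw N0 g0 mug.
have [C [C0 hC]] := propagator_bound hb hk hw N0 g0 mug.
have [cb b0 db bC1 bC2] := hb.
have lim j xi : 0 < xi -> exists l : R * R,
   (rotated xi t (w j xi t)).1 @[t --> +oo] --> l.1 /\
   (rotated xi t (w j xi t)).2 @[t --> +oo] --> l.2.
  move=> xi0; apply: (rotated_limit xi0 db bC1 bC2 (pr_mode hw j xi)).
  by move=> t t0'; exact: hC.
have /choice[Z hZ] (p : bool * R) : exists l : R * R, if 0 < p.2 then
   (rotated p.2 t (w p.1 p.2 t)).1 @[t --> +oo] --> l.1 /\
   (rotated p.2 t (w p.1 p.2 t)).2 @[t --> +oo] --> l.2 else l = (0, 0).
  by case: (boolP (0 < p.2)) => [|_]; [exact: lim|exists (0, 0)].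
(* Rotating a vector at most doubles a bound for its components. *)
exists (fun j xi => Z (j, xi)), (2 * C).
have nat_inf : (fun n : nat => n%:R : R) @ \oo --> +oo by exact: cvgr_idn.
have ms t : measurable_fun [set: R] (fun xi : R => sin (xi * t)) := pr_meas1 rotation_propagator false t.
have mc t : measurable_fun [set: R] (fun xi : R => cos (xi * t)) := pr_meas1 rotation_propagator true t.
have mpos : measurable_fun [set: R] (fun xi : R => 0 < xi) by exact: measurable_fun_ltr.
split.
- move=> j; split.
    apply: (@measurable_realfun.measurable_fun_cvg _ _ R setT
      (fun n xi => if 0 < xi then (rotated xi n%:R (w j xi n%:R)).1 else 0)) => [n|xi _].
      apply: measurable_fun_ifT => //; apply: measurable_funB; apply: measurable_funM => //.
        exact: pr_meas1 hw _ _.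
      exact: pr_meas2 hw _ _.
    have := hZ (j, xi) => /=; case: ifPn => [_ [h _]|_ ->]; last exact: cvg_cst.
    exact: (cvg_comp _ _ nat_inf h).
  apply: (@measurable_realfun.measurable_fun_cvg _ _ R setT
    (fun n xi => if 0 < xi then (rotated xi n%:R (w j xi n%:R)).2 else 0)) => [n|xi _].
    apply: measurable_fun_ifT => //; apply: measurable_funD; apply: measurable_funM => //.
      exact: pr_meas1 hw _ _.
    exact: pr_meas2 hw _ _.
  have := hZ (j, xi) => /=; case: ifPn => [_ [_ h]|_ ->]; last exact: cvg_cst.
  exact: (cvg_comp _ _ nat_inf h).
- by rewrite mulr_ge0.
- move=> j xi t xi0 t0'; have := hZ (j, xi) => /=; rewrite xi0 => -[z1 z2].
  have [h1 h2] := hC j xi t xi0 t0'.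
  have le2 : C * weight N g j xi <= 2 * C * weight N g j xi.
    by rewrite -mulrA ler_peMl ?mulr_ge0 ?weight_ge0//; lra.
  have near_bd : \forall s \near +oo,
      `|(rotated xi s (w j xi s)).1| <= 2 * C * weight N g j xi /\
      `|(rotated xi s (w j xi s)).2| <= 2 * C * weight N g j xi.
    near=> s; have [? ?] : `|(w j xi s).1| <= C * weight N g j xi /\
       `|(w j xi s).2| <= C * weight N g j xi by apply: hC.
    by rewrite -mulrA; exact: rotated_bound.
  split; [exact: le_trans le2|exact: le_trans le2| |].
    apply: (ler_cvg_to (cvg_norm z1) (cvg_cst _)).
    by apply: filterS near_bd => s [].
  apply: (ler_cvg_to (cvg_norm z2) (cvg_cst _)).
  by apply: filterS near_bd => s [].
- move=> xi xi0.
  have := hZ (true, xi) => /=; rewrite xi0 => -[a1 a2].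
  have := hZ (false, xi) => /=; rewrite xi0 => -[c1 c2].
  pose D t := (rotated xi t (w true xi t)).1 * (rotated xi t (w false xi t)).2 -
              (rotated xi t (w false xi t)).1 * (rotated xi t (w true xi t)).2.
  have h : D t @[t --> +oo] --> (Z (true, xi)).1 * (Z (false, xi)).2 -
      (Z (false, xi)).1 * (Z (true, xi)).2.
    by apply: cvgB; apply: cvgM.
  have E : D = fun=> 1.
    apply/funext => t.
    rewrite -[RHS]mulr1 -[X in _ = X * _](cos2Dsin2 (xi * t)) -(propagator_det xi t hw).
    by rewrite /D /rotated /=; ring.
  by rewrite E in h; rewrite -(cvg_lim _ h)// lim_cst.
- move=> j xi xi0; have := hZ (j, xi) => /=; rewrite xi0 => -[z1 z2].
  have cs1 := @norm_cos_le1 R; have sn1 := @norm_sin_le1 R.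
  pose e t := `|(rotated xi t (w j xi t)).1 - (Z (j, xi)).1| +
              `|(rotated xi t (w j xi t)).2 - (Z (j, xi)).2|.
  have e0 : e t @[t --> +oo] --> 0.
    rewrite -(addr0 0); apply: cvgD; rewrite -(normr0 R); apply: cvg_norm.
      by rewrite -(subrr (Z (j, xi)).1); apply: cvgB z1 (cvg_cst _).
    by rewrite -(subrr (Z (j, xi)).2); apply: cvgB z2 (cvg_cst _).
  have sq (f : R -> R) : (forall t, `|f t| <= e t) -> f t @[t --> +oo] --> 0.
    move=> fe; apply/norm_cvg0P; apply: (squeeze_cvgr _ (cvg_cst 0) e0).
    by apply: nearW => t; rewrite normr_ge0 fe.
  have id t (p : R) : p = (cos (xi * t) ^+ 2 + sin (xi * t) ^+ 2) * p.
    by rewrite cos2Dsin2 mul1r.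
  split; apply: sq => t.
    have -> : (w j xi t).1 - ((rotation true xi t).1 * (Z (j, xi)).1 +
          (rotation false xi t).1 * (Z (j, xi)).2) =
        cos (xi * t) * ((rotated xi t (w j xi t)).1 - (Z (j, xi)).1) +
        sin (xi * t) * ((rotated xi t (w j xi t)).2 - (Z (j, xi)).2).
      by rewrite [X in X - _](id t) /=; ring.
    apply: le_trans (ler_normD _ _) _; rewrite !normrM.
    by apply: lerD; rewrite ler_piMl.
  have -> : (w j xi t).2 - ((rotation true xi t).2 * (Z (j, xi)).1 +
        (rotation false xi t).2 * (Z (j, xi)).2) =
      - sin (xi * t) * ((rotated xi t (w j xi t)).1 - (Z (j, xi)).1) +
      cos (xi * t) * ((rotated xi t (w j xi t)).2 - (Z (j, xi)).2).
    by rewrite [X in X - _](id t) /=; ring.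
  apply: le_trans (ler_normD _ _) _; rewrite !normrM normrN.
  by apply: lerD; rewrite ler_piMl.
Unshelve. all: by end_near. Qed.

End Propagator.

(** * Real-valued norms and inner products *)

Section RealNorm.
Context {R : realType}.
Local Notation Re := complex.Re.
Local Notation Im := complex.Im.

Lemma ReD (x y : R[i]) : Re (x + y) = Re x + Re y.
Proof. by case: x; case: y. Qed.
Lemma ReZ (r : R) (x : R[i]) : Re (r%:C * x) = r * Re x.
Proof. by case: x => a c /=; rewrite mul0r subr0. Qed.
Lemma ImZ (r : R) (x : R[i]) : Im (r%:C * x) = r * Im x.
Proof. by case: x => a c /=; rewrite mul0r addr0. Qed.

Lemma ge0_ReE (x : R[i]) : 0 <= x -> x = (Re x)%:C.
Proof. by move=> x0; rewrite RRe_real// ger0_real. Qed.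

Context {V : normedModType R[i]}.
Implicit Types (u v : V) (r : R).

Lemma normE u : `|u| = (rnorm u)%:C.
Proof. by rewrite /rnorm -ge0_ReE. Qed.

Lemma rnorm_ge0 u : 0 <= rnorm u.
Proof. by rewrite -ler0c -normE normr_ge0. Qed.

Lemma rnorm0 : rnorm (0 : V) = 0.
Proof. by rewrite /rnorm normr0. Qed.

Lemma rnorm0_eq0 u : rnorm u = 0 -> u = 0.
Proof. by move=> h; apply/eqP; rewrite -normr_eq0 normE h. Qed.

Lemma rnormN u : rnorm (- u) = rnorm u.
Proof. by rewrite /rnorm normrN. Qed.

Lemma rnormD u v : rnorm (u + v) <= rnorm u + rnorm v.
Proof. by rewrite -lecR -!normE rmorphD /= -!normE ler_normD. Qed.

Lemma rnorm_sub_le u v : `|rnorm u - rnorm v| <= rnorm (u - v).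
Proof.
rewrite ler_norml; apply/andP; split.
  have := rnormD (v - u) u; rewrite subrK -(rnormN (v - u)) opprB; lra.
have := rnormD (u - v) v; rewrite subrK; lra.
Qed.

(** Convergence for a norm with values in [R[i]], expressed with real numbers only. *)
Lemma rcvgP {T : Type} {F : set_system T} {FF : Filter F} (f : T -> V) (l : V) :
  f @ F --> l <-> (fun t => rnorm (f t - l)) @ F --> (0 : R).
Proof.
split.
  move=> /cvgrPdist_lt h; apply/cvgr0Pnorm_lt => e e0.
  have := h e%:C; rewrite -{1}(rmorph0 (real_complex R)) ltcR => /(_ e0).
  apply: filterS => t; rewrite distrC normE ltcR ger0_norm//.
  exact: rnorm_ge0.
move=> /cvgr0Pnorm_lt h; apply/cvgrPdist_lt => e e0.
have eE : e = (Re e)%:C by apply: ge0_ReE; exact: ltW.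
have := h (Re e); rewrite -ltcR -eE => /(_ e0).
apply: filterS => t; rewrite ger0_norm ?rnorm_ge0// distrC normE eE ltcR.
done.
Qed.

Lemma rnorm_cvg {T : Type} {F : set_system T} {FF : Filter F} (f : T -> V) (l : V) :
  f @ F --> l -> rnorm (f t) @[t --> F] --> rnorm l.
Proof.
move=> /rcvgP h; apply/subr_cvg0/norm_cvg0P.
apply: (squeeze_cvgr _ (cvg_cst 0) h); apply: nearW => t.
by rewrite normr_ge0 rnorm_sub_le.
Qed.

Lemma rcvg_unique {T : Type} {F : set_system T} {FF : ProperFilter F} (f : T -> V) (l l' : V) :
  f @ F --> l -> f @ F --> l' -> l = l'.
Proof. by move=> h h'; apply: (cvg_unique _ h h'); exact: norm_hausdorff. Qed.

(** Stated for semidefinite forms over the scalars [R], so that it applies to the real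
    parts of the inner products of [H] and of [H * H] alike. *)
Lemma cauchy_schwarz (W : lmodType R[i]) (q : W -> W -> R) :
  (forall x y z, q (x + y) z = q x z + q y z) ->
  (forall r x y, q (r%:C *: x) y = r * q x y) ->
  (forall x y, q x y = q y x) -> (forall x, 0 <= q x x) ->
  forall x y, `|q x y| <= Num.sqrt (q x x) * Num.sqrt (q y y).
Proof.
move=> qD qZ qC q0 x y.
have key (s t : R) : 0 <= s ^+ 2 * q x x + 2 * s * t * q x y + t ^+ 2 * q y y.
  have := q0 (s%:C *: x + t%:C *: y).
  by rewrite !(qD, qZ) ![q _ (_ + _)]qC !(qD, qZ) (qC y x); lra.
rewrite -sqrtrM// -(sqrtr_sqr (q x y)) ler_wsqrtr//.
have [y0|y0] := eqVneq (q y y) 0.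
  rewrite y0 mulr0; case: (eqVneq (q x y) 0) => [->|n0]; first by rewrite expr0n.
  have := key 1 (- (q x x + 1) / (2 * q x y)); rewrite y0.
  have -> : 2 * 1 * (- (q x x + 1) / (2 * q x y)) * q x y = - (q x x + 1) by field.
  lra.
have := key (q y y) (- q x y).
have -> : q y y ^+ 2 * q x x + 2 * q y y * - q x y * q x y + (- q x y) ^+ 2 * q y y =
  q y y * (q x x * q y y - q x y ^+ 2) by ring.
by rewrite pmulr_rge0 ?subr_ge0// lt_neqAle eq_sym y0/=.
Qed.

End RealNorm.

Section RealDot.
Context {R : realType} {H : normedModType R[i]} (dot : {dot H for Num.conj}).
Hypothesis hdot : induces_norm dot.
Implicit Types (u v w : H) (x y z : H * H) (r : R).
Local Notation Re := complex.Re.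

Definition rdot u v : R := Re (dot u v).

Lemma rdotDl u v w : rdot (u + v) w = rdot u w + rdot v w.
Proof. by rewrite /rdot linearDl ReD. Qed.
Lemma rdotZl r u v : rdot (r%:C *: u) v = r * rdot u v.
Proof. by rewrite /rdot linearZl_LR ReZ. Qed.
Lemma rdotC u v : rdot u v = rdot v u.
Proof.
have h (z : R[i]) : Re (Num.conj z) = Re z by case: z.
by rewrite /rdot hermC expr0 mul1r h.
Qed.
Lemma rdotE u : rdot u u = rnorm u ^+ 2.
Proof. by rewrite /rdot -hdot normE -rmorphXn. Qed.
Lemma rdot_ge0 u : 0 <= rdot u u. Proof. by rewrite rdotE sqr_ge0. Qed.
Lemma rdotDr u v w : rdot w (u + v) = rdot w u + rdot w v.
Proof. by rewrite rdotC rdotDl !(rdotC _ w). Qed.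
Lemma rdotZr r u v : rdot v (r%:C *: u) = r * rdot v u.
Proof. by rewrite rdotC rdotZl rdotC. Qed.

Definition rdot2 x y : R := rdot x.1 y.1 + rdot x.2 y.2.
(** The Hilbert norm of [H * H], equivalent to its maximum norm. *)
Definition norm2 x : R := Num.sqrt (rnorm x.1 ^+ 2 + rnorm x.2 ^+ 2).

Lemma rdot2E x y : Re (dot2 dot x y) = rdot2 x y.
Proof. by rewrite /dot2 ReD. Qed.
Lemma rdot2Dl x y z : rdot2 (x + y) z = rdot2 x z + rdot2 y z.
Proof. by rewrite /rdot2 !rdotDl addrACA. Qed.
Lemma rdot2Zl r x y : rdot2 (r%:C *: x) y = r * rdot2 x y.
Proof. by rewrite /rdot2 !rdotZl mulrDr. Qed.
Lemma rdot2C x y : rdot2 x y = rdot2 y x.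
Proof. by rewrite /rdot2 rdotC (rdotC x.2). Qed.
Lemma rdot2_ge0 x : 0 <= rdot2 x x.
Proof. by rewrite addr_ge0// rdot_ge0. Qed.
Lemma rdot2_norm x : rdot2 x x = norm2 x ^+ 2.
Proof. by rewrite sqr_sqrtr ?addr_ge0 ?sqr_ge0// /rdot2 !rdotE. Qed.
Lemma rdot2Dr x y z : rdot2 z (x + y) = rdot2 z x + rdot2 z y.
Proof. by rewrite rdot2C rdot2Dl !(rdot2C _ z). Qed.
Lemma rdot2Zr r x y : rdot2 y (r%:C *: x) = r * rdot2 y x.
Proof. by rewrite rdot2C rdot2Zl rdot2C. Qed.
Lemma rdot2Nl x y : rdot2 (- x) y = - rdot2 x y.
Proof. by have := rdot2Zl (-1) x y; rewrite rmorphN1 scaleN1r mulN1r. Qed.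
Lemma rdot2Nr x y : rdot2 y (- x) = - rdot2 y x.
Proof. by rewrite rdot2C rdot2Nl rdot2C. Qed.

Lemma norm2_ge0 x : 0 <= norm2 x. Proof. exact: sqrtr_ge0. Qed.

Lemma rdot2_CS x y : `|rdot2 x y| <= norm2 x * norm2 y.
Proof.
have := cauchy_schwarz rdot2Dl rdot2Zl rdot2C rdot2_ge0 x y.
by rewrite !rdot2_norm !sqrtr_sqr (ger0_norm (norm2_ge0 x)) (ger0_norm (norm2_ge0 y)).
Qed.

Lemma norm2_fst x : rnorm x.1 <= norm2 x.
Proof.
by rewrite -(ger0_norm (rnorm_ge0 x.1)) -sqrtr_sqr ler_wsqrtr// lerDl sqr_ge0.
Qed.
Lemma norm2_snd x : rnorm x.2 <= norm2 x.
Proof.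
by rewrite -(ger0_norm (rnorm_ge0 x.2)) -sqrtr_sqr ler_wsqrtr// lerDr sqr_ge0.
Qed.
Lemma norm2_le x : norm2 x <= rnorm x.1 + rnorm x.2.
Proof.
rewrite -[leRHS]ger0_norm ?addr_ge0 ?rnorm_ge0// -sqrtr_sqr ler_wsqrtr//.
by rewrite sqrrD -addrA lerD2l lerDr mulrn_wge0// mulr_ge0 ?rnorm_ge0.
Qed.
Lemma norm2D x y : norm2 (x + y) <= norm2 x + norm2 y.
Proof.
rewrite -[leLHS]ger0_norm ?norm2_ge0// -[leRHS]ger0_norm ?addr_ge0 ?norm2_ge0//.
rewrite -ler_sqr ?nnegrE// !real_normK ?num_real// -rdot2_norm.
rewrite rdot2Dl !rdot2Dr !rdot2_norm (rdot2C y x).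
have := le_trans (ler_norm _) (rdot2_CS x y).
by rewrite sqrrD; lra.
Qed.
Lemma norm2N x : norm2 (- x) = norm2 x.
Proof. by rewrite /norm2 /= !rnormN. Qed.
Lemma rcvg2P {T : Type} {F : set_system T} {FF : Filter F} (f : T -> H * H) (l : H * H) :
  f @ F --> l <-> norm2 (f t - l) @[t --> F] --> (0 : R).
Proof.
split.
  move=> h.
  have h1 : (f t).1 @[t --> F] --> l.1 by apply: cvg_comp h _; exact: cvg_fst.
  have h2 : (f t).2 @[t --> F] --> l.2 by apply: cvg_comp h _; exact: cvg_snd.
  move/rcvgP : h1 => h1; move/rcvgP : h2 => h2.
  have h3 : (rnorm ((f t).1 - l.1) + rnorm ((f t).2 - l.2)) @[t --> F] --> (0 : R).
    by rewrite -(addr0 0); apply: cvgD.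
  apply: (squeeze_cvgr _ (cvg_cst 0) h3); apply: nearW => t.
  by rewrite norm2_ge0/= norm2_le.
move=> h; rewrite (surjective_pairing l).
have -> : f = fun t => ((f t).1, (f t).2) by apply/funext => t; rewrite -surjective_pairing.
apply: cvg_pair; apply/rcvgP; apply: (squeeze_cvgr _ (cvg_cst 0) h); apply: nearW => t.
  by rewrite rnorm_ge0/= (norm2_fst (f t - l)).
by rewrite rnorm_ge0/= (norm2_snd (f t - l)).
Qed.

Lemma norm2_sub_le x y : `|norm2 x - norm2 y| <= norm2 (x - y).
Proof.
rewrite ler_norml; apply/andP; split.
  have := norm2D (y - x) x; rewrite subrK -(norm2N (y - x)) opprB; lra.
have := norm2D (x - y) y; rewrite subrK; lra.
Qed.

Lemma norm2_cvg {T : Type} {F : set_system T} {FF : Filter F} (f : T -> H * H) (l : H * H) :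
  f @ F --> l -> norm2 (f t) @[t --> F] --> norm2 l.
Proof.
move=> /rcvg2P h; apply/subr_cvg0/norm_cvg0P.
apply: (squeeze_cvgr _ (cvg_cst 0) h); apply: nearW => t.
by rewrite normr_ge0 norm2_sub_le.
Qed.

Lemma rdot2_cvg {T : Type} {F : set_system T} {FF : Filter F} (f g : T -> H * H) (l k : H * H) :
  f @ F --> l -> g @ F --> k -> rdot2 (f t) (g t) @[t --> F] --> rdot2 l k.
Proof.
move=> hf hg; apply/subr_cvg0/norm_cvg0P.
have h1 := norm2_cvg hf; move/rcvg2P : hf => hf; move/rcvg2P : hg => hg.
have h3 : (norm2 (f t) * norm2 (g t - k) + norm2 (f t - l) * norm2 k) @[t --> F] --> (0 : R).
  rewrite -(addr0 0) -[X in _ --> X + _](mulr0 (norm2 l)) -[X in _ --> _ + X](mul0r (norm2 k)).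
  by apply: cvgD; apply: cvgM => //; [exact: h1|exact: cvg_cst].
apply: (squeeze_cvgr _ (cvg_cst 0) h3); apply: nearW => t.
rewrite normr_ge0/=.
have -> : rdot2 (f t) (g t) - rdot2 l k = rdot2 (f t) (g t - k) + rdot2 (f t - l) k.
  by rewrite rdot2Dr rdot2Dl rdot2Nr rdot2Nl; ring.
by apply: le_trans (ler_normD _ _) _; apply: lerD; exact: rdot2_CS.
Qed.

End RealDot.

(** * Bounded multipliers in the spectral representation *)

Section SquareIntegrable.
Context {R : realType} {d : measure_display} {X : measurableType d}.
Variable nu : {measure set X -> \bar R}.
Local Notation Re := complex.Re.
Local Notation Im := complex.Im.
Implicit Types (f : X -> R[i]) (g h : X -> R).

Definition csq (z : R[i]) : R := Re z ^+ 2 + Im z ^+ 2.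
Definition L2sq f : \bar R := (\int[nu]_x (csq (f x))%:E)%E.

Lemma csq_ge0 z : 0 <= csq z. Proof. by rewrite addr_ge0// sqr_ge0. Qed.
Lemma csq0_eq0 z : csq z = 0 -> z = 0.
Proof.
case: z => a c /eqP; rewrite /csq /= paddr_eq0 ?sqr_ge0// !sqrf_eq0.
by move=> /andP[/eqP-> /eqP->].
Qed.
Lemma csqZ (r : R) z : csq (r%:C * z) = r ^+ 2 * csq z.
Proof. by rewrite /csq ReZ ImZ; ring. Qed.
Lemma cabs_csq z : cabs z ^+ 2 = csq z.
Proof. by rewrite /cabs normc_def /= sqr_sqrtr ?addr_ge0 ?sqr_ge0. Qed.

Definition cmeasurable f : Prop :=
  measurable_fun [set: X] (fun x => Re (f x)) /\ measurable_fun [set: X] (fun x => Im (f x)).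

Lemma csq_measurable f : cmeasurable f -> measurable_fun [set: X] (fun x => csq (f x)).
Proof.
by move=> [m1 m2]; apply: measurable_funD; apply: measurable_funX.
Qed.

Lemma cmeasurableM g f : measurable_fun [set: X] g -> cmeasurable f ->
  cmeasurable (fun x => (g x)%:C * f x).
Proof.
move=> mg [m1 m2]; split.
  by under eq_fun do rewrite ReZ; exact: measurable_funM.
by under eq_fun do rewrite ImZ; exact: measurable_funM.
Qed.

Lemma L2sqE f : L2sq f = (L2norm nu f `^ 2)%E.
Proof.
rewrite /L2norm poweR_Lnorm ?pnatr_eq0//; apply: eq_integral => x _.
rewrite /= ger0_norm; last by rewrite /cabs -ler0c -ge0_ReE.
by rewrite powR_mulrn ?cabs_csq// /cabs -ler0c -ge0_ReE.
Qed.

Lemma L2sq_ge0 f : (0 <= L2sq f)%E.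
Proof. by apply: integral_ge0 => x _; rewrite lee_fin csq_ge0. Qed.

Lemma L2P f : L2 nu f <-> cmeasurable f /\ (L2sq f < +oo)%E.
Proof.
split.
  move=> [m1 m2 l]; split; first by split.
  by rewrite L2sqE; exact: poweR_lty.
move=> [[m1 m2] l]; split => //.
have : (L2norm nu f = (L2sq f) `^ 2^-1)%E.
  by rewrite L2sqE -poweRrM mulfV ?pnatr_eq0// poweRe1// Lnorm_ge0.
by move=> ->; exact: poweR_lty.
Qed.

Lemma L2sq_ae f f' : cmeasurable f -> cmeasurable f' ->
  {ae nu, forall x, f x = f' x} -> L2sq f = L2sq f'.
Proof.
move=> mf mf' h; apply: ge0_ae_eq_integral => //.
- by apply/measurable_EFinP; exact: csq_measurable.
- by apply/measurable_EFinP; exact: csq_measurable.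
- by move=> x _; rewrite lee_fin csq_ge0.
- by move=> x _; rewrite lee_fin csq_ge0.
by apply: filterS h => x -> _.
Qed.

Lemma L2sq_mul_le g f C : measurable_fun [set: X] g -> cmeasurable f ->
  (forall x, `|g x| <= C) ->
  (L2sq (fun x => (g x)%:C * f x)%R <= (C ^+ 2)%:E * L2sq f)%E.
Proof.
move=> mg mf gC; rewrite -ge0_integralZl_EFin ?sqr_ge0//; first last.
- by apply/measurable_EFinP; exact: csq_measurable.
- by move=> x _; rewrite lee_fin csq_ge0.
apply: ge0_le_integral => //.
- by move=> x _; rewrite lee_fin csq_ge0.
- by apply/measurable_EFinP; apply: csq_measurable; exact: cmeasurableM.
- by apply/measurable_EFinP; apply: measurable_funM => //; exact: csq_measurable.
move=> x _; rewrite -EFinM lee_fin csqZ ler_wpM2r ?csq_ge0//.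
by rewrite -real_normK ?num_real// lerXn2r ?nnegrE// (le_trans _ (gC x)).
Qed.

Lemma L2sq_eq0 f : cmeasurable f -> L2sq f = 0%E -> {ae nu, forall x, f x = 0}.
Proof.
move=> mf h.
have : (\int[nu]_x `|(csq (f x))%:E| = 0)%E.
  by rewrite -h; apply: eq_integral => x _; rewrite gee0_abs// lee_fin csq_ge0.
move/ae_eq_integral_abs => /(_ measurableT) H.
have {}H := H _; apply: filterS (H _) => [x /(_ I)[] /csq0_eq0//|].
by apply/measurable_EFinP; exact: csq_measurable.
Qed.

End SquareIntegrable.

Section Multipliers.
Context {R : realType} {H : completeNormedModType R[i]} (dot : {dot H for Num.conj}).
Hypothesis hdot : induces_norm dot.
Context {L : uop H} {d : measure_display} {X : measurableType d}.
Context {nu : {measure set X -> \bar R}} {F : H -> X -> R[i]} {m : X -> R}.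
Hypothesis hF : spectral_rep L nu F m.
Implicit Types (u v : H) (f : X -> R[i]) (g h : X -> R) (r C : R).

Lemma ae_and (P Q : X -> Prop) : {ae nu, forall x, P x} -> {ae nu, forall x, Q x} ->
  {ae nu, forall x, P x /\ Q x}.
Proof. by move=> p q; apply: filterS2 p q => x. Qed.

Lemma F_meas u : cmeasurable (F u).
Proof. by have /L2P[] := sr_L2 hF u. Qed.

Lemma F_norm u : L2sq nu (F u) = (rnorm u ^+ 2)%:E.
Proof. by rewrite L2sqE (sr_isometry hF) poweR_EFin powR_mulrn// rnorm_ge0. Qed.

Lemma F_lin (a : R[i]) u v : {ae nu, forall x, F (a *: u + v) x = a * F u x + F v x}.
Proof. exact: sr_linear hF a u v. Qed.

Lemma F0 : {ae nu, forall x, F 0 x = 0}.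
Proof.
by apply: L2sq_eq0 (F_meas 0) _; rewrite F_norm rnorm0 expr0n.
Qed.

Lemma F_add u v : {ae nu, forall x, F (u + v) x = F u x + F v x}.
Proof. by apply: filterS (F_lin 1 u v) => x; rewrite scale1r mul1r. Qed.

Lemma F_scale (a : R[i]) u : {ae nu, forall x, F (a *: u) x = a * F u x}.
Proof.
apply: filterS2 (F_lin a u 0) F0 => x.
by rewrite addr0 => -> ->; rewrite addr0.
Qed.

Lemma F_opp u : {ae nu, forall x, F (- u) x = - F u x}.
Proof. by apply: filterS (F_scale (-1) u) => x; rewrite scaleN1r mulN1r. Qed.

Lemma F_sub u v : {ae nu, forall x, F (u - v) x = F u x - F v x}.
Proof. by apply: filterS2 (F_add u (- v)) (F_opp v) => x -> ->. Qed.

Lemma F_eq0 u : {ae nu, forall x, F u x = 0} -> u = 0.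
Proof.
move=> h; apply: rnorm0_eq0; apply/eqP; rewrite -sqrf_eq0 -eqe -F_norm.
rewrite (L2sq_ae (F_meas u) (_ : cmeasurable (fun=> 0)) h); last by split => /=.
apply/eqP; rewrite /L2sq /csq /= expr0n /= addr0.
by apply: integral0_eq.
Qed.

Lemma F_inj u v : {ae nu, forall x, F u x = F v x} -> u = v.
Proof.
move=> h; apply/eqP; rewrite -subr_eq0; apply/eqP/F_eq0.
by apply: filterS2 (F_sub u v) h => x -> ->; rewrite subrr.
Qed.

Lemma F_surj f : cmeasurable f -> (L2sq nu f < +oo)%E ->
  exists u, {ae nu, forall x, F u x = f x}.
Proof. by move=> mf lf; apply: (sr_onto hF); apply/L2P. Qed.

Definition bmeas g := measurable_fun [set: X] g /\ exists C, forall x, `|g x| <= C.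

Lemma bmeasM g h : bmeas g -> bmeas h -> bmeas (fun x => g x * h x).
Proof.
move=> [mg [C gC]] [mh [D hD]]; split; first exact: measurable_funM.
by exists (C * D) => x; rewrite normrM ler_pM.
Qed.
Lemma bmeasD g h : bmeas g -> bmeas h -> bmeas (fun x => g x + h x).
Proof.
move=> [mg [C gC]] [mh [D hD]]; split; first exact: measurable_funD.
by exists (C + D) => x; apply: le_trans (ler_normD _ _) _; exact: lerD.
Qed.
Lemma bmeas_cst r : bmeas (fun=> r).
Proof. by split => //; exists `|r|. Qed.
Lemma bmeasN g : bmeas g -> bmeas (fun x => - g x).
Proof.
move=> [mg [C gC]]; split; first exact: measurableT_comp.
by exists C => x; rewrite normrN.
Qed.

(** The operator that multiplies by [g] in the spectral representation; it is
    determined by [g], since [F] is injective. *)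
Definition mulop g u : H := xget 0 [set v | {ae nu, forall x, F v x = (g x)%:C * F u x}].

Lemma mulopP g u : bmeas g -> {ae nu, forall x, F (mulop g u) x = (g x)%:C * F u x}.
Proof.
move=> [mg [C gC]].
apply: (@xgetPex _ 0 [set v | {ae nu, forall x, F v x = (g x)%:C * F u x}]).
apply: F_surj; first exact: cmeasurableM (F_meas u).
apply: le_lt_trans (L2sq_mul_le nu mg (F_meas u) gC) _.
by rewrite F_norm -EFinM ltry.
Qed.

Lemma mulop_unique g u v : bmeas g ->
  {ae nu, forall x, F v x = (g x)%:C * F u x} -> v = mulop g u.
Proof.
by move=> bg h; apply: F_inj; apply: filterS2 h (mulopP u bg) => x -> ->.
Qed.

Lemma mulop_add g u v : bmeas g -> mulop g (u + v) = mulop g u + mulop g v.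
Proof.
move=> bg; apply/esym/mulop_unique => //.
have h := ae_and (F_add (mulop g u) (mulop g v)) (F_add u v).
apply: filterS3 h (mulopP u bg) (mulopP v bg) => x [-> ->] -> ->.
by rewrite mulrDr.
Qed.

Lemma mulop_scale g (a : R[i]) u : bmeas g -> mulop g (a *: u) = a *: mulop g u.
Proof.
move=> bg; apply/esym/mulop_unique => //.
apply: filterS3 (F_scale a (mulop g u)) (mulopP u bg) (F_scale a u) => x -> -> ->.
by rewrite mulrCA.
Qed.

Lemma mulop_opp g u : bmeas g -> mulop g (- u) = - mulop g u.
Proof. by move=> bg; rewrite -scaleN1r mulop_scale// scaleN1r. Qed.

Lemma mulop_norm g u C : bmeas g -> (forall x, `|g x| <= C) ->
  rnorm (mulop g u) <= C * rnorm u.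
Proof.
move=> bg gC.
have C0 (x : X) : 0 <= C by rewrite (le_trans _ (gC x)).
have : (L2sq nu (F (mulop g u)) <= (C ^+ 2)%:E * L2sq nu (F u))%E.
  rewrite (L2sq_ae (F_meas _) (cmeasurableM bg.1 (F_meas u)) (mulopP u bg)).
  exact: L2sq_mul_le bg.1 (F_meas u) gC.
rewrite !F_norm -EFinM lee_fin -exprMn.
case: (pselect (exists x : X, True)) => [[x _]|nX].
  rewrite ler_sqr ?nnegrE ?rnorm_ge0//.
  by rewrite mulr_ge0 ?rnorm_ge0 ?C0.
have Z v : v = 0 by apply: F_eq0; apply: aeW => x; exfalso; apply: nX; exists x.
by rewrite (Z (mulop g u)) (Z u) rnorm0 mulr0.
Qed.

Lemma mulop_comp g h u : bmeas g -> bmeas h ->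
  mulop g (mulop h u) = mulop (fun x => g x * h x) u.
Proof.
move=> bg bh; apply: mulop_unique; first exact: bmeasM.
apply: filterS2 (mulopP (mulop h u) bg) (mulopP u bh) => x -> ->.
by rewrite rmorphM mulrA.
Qed.

Lemma mulop_plus g h u : bmeas g -> bmeas h ->
  mulop (fun x => g x + h x) u = mulop g u + mulop h u.
Proof.
move=> bg bh; apply/esym/mulop_unique; first exact: bmeasD.
apply: filterS3 (F_add (mulop g u) (mulop h u)) (mulopP u bg) (mulopP u bh) => x -> -> ->.
by rewrite rmorphD mulrDl.
Qed.

Lemma mulop_cst r u : mulop (fun=> r) u = r%:C *: u.
Proof.
apply/esym/mulop_unique; first exact: bmeas_cst.
exact: F_scale.
Qed.

Lemma mulop_ext g h u : g =1 h -> mulop g u = mulop h u.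
Proof. by move=> gh; congr mulop; apply/funext. Qed.

Lemma parallelogram_id (g : R) (z z' : R[i]) :
  csq (g%:C * z + z') + csq (z - g%:C * z') = csq (z + g%:C * z') + csq (g%:C * z - z').
Proof. by case: z => a c; case: z' => a' c'; rewrite /csq /=; ring. Qed.

Lemma F_sum_norm u v :
  (\int[nu]_x (csq (F u x) + csq (F v x))%:E = (rnorm u ^+ 2 + rnorm v ^+ 2)%:E)%E.
Proof.
rewrite EFinD -!F_norm /L2sq -ge0_integralD//.
- by move=> x _; rewrite lee_fin csq_ge0.
- by apply/measurable_EFinP; exact: csq_measurable (F_meas u).
- by move=> x _; rewrite lee_fin csq_ge0.
- by apply/measurable_EFinP; exact: csq_measurable (F_meas v).
Qed.

(** Inner products are not available in the spectral representation, only norms: the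
    symmetry follows by polarization from the pointwise identity
    [parallelogram_id]. *)
Lemma mulop_sym g u v : bmeas g -> rdot dot (mulop g u) v = rdot dot u (mulop g v).
Proof.
move=> bg; set gu := mulop g u; set gv := mulop g v.
have Iu := mulopP u bg; have Iv := mulopP v bg.
(* Expanding the four squares leaves only the mixed terms. *)
have key : rnorm (gu + v) ^+ 2 + rnorm (u - gv) ^+ 2 =
           rnorm (u + gv) ^+ 2 + rnorm (gu - v) ^+ 2.
  apply: EFin_inj; rewrite -(F_sum_norm (gu + v) (u - gv)).
  rewrite -(F_sum_norm (u + gv) (gu - v)).
  have mcs w : measurable_fun [set: X] (fun x => csq (F w x)).
    exact: csq_measurable (F_meas w).
  apply: ge0_ae_eq_integral => //.
  - by apply/measurable_EFinP; apply: measurable_funD.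
  - by apply/measurable_EFinP; apply: measurable_funD.
  - by move=> x _; rewrite lee_fin addr_ge0 ?csq_ge0.
  - by move=> x _; rewrite lee_fin addr_ge0 ?csq_ge0.
  have h1 := ae_and (F_add gu v) (F_sub u gv).
  have h2 := ae_and (F_add u gv) (F_sub gu v).
  apply: filterS3 (ae_and h1 h2) Iu Iv => x [[-> ->] [-> ->]] -> -> _.
  by rewrite parallelogram_id.
move: key; rewrite -!(rdotE hdot).
have N1 (w : H) : - w = (-1)%:C *: w by rewrite rmorphN1 scaleN1r.
rewrite !(N1 gv, N1 v) !(rdotDl, rdotDr, rdotZl, rdotZr) (rdotC _ v gu) (rdotC _ gv u).
by lra.
Qed.

(** Lebesgue's theorem.  The hypothesis holds for [0 <= t] only, whence the truncation
    of the family. *)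
Lemma mulop_dominated (g : R -> X -> R) u C :
  (forall t, measurable_fun [set: X] (g t)) -> (forall t x, 0 <= t -> `|g t x| <= C) ->
  (forall x, g t x @[t --> +oo] --> 0) ->
  rnorm (mulop (g t) u) @[t --> +oo] --> 0.
Proof.
move=> mg gC g0.
pose g' t x := if 0 <= t then g t x else 0.
have C0 (x : X) : 0 <= C by rewrite (le_trans _ (gC 0 x (lexx _))).
have mg' t : measurable_fun [set: X] (g' t).
  by rewrite /g'; case: (0 <= t).
have g'C t x : `|g' t x| <= C.
  by rewrite /g'; case: ifPn => [/gC//|_]; rewrite normr0 (C0 x).
have bg' t : bmeas (g' t) by split => //; exists C.
have g'E t : 0 <= t -> g' t = g t by move=> t0; apply/funext => x; rewrite /g' t0.
have g'0 x : g' t x @[t --> +oo] --> 0.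
  apply: cvg_trans (g0 x); apply: near_eq_cvg.
  by near=> t; rewrite g'E//.
suff h : rnorm (mulop (g' t) u) @[t --> +oo] --> 0.
  apply: cvg_trans h; apply: near_eq_cvg.
  by near=> t; rewrite g'E//.
apply/cvg_pinftyP => tn tny.
have sq0 : rnorm (mulop (g' (tn n)) u) ^+ 2 @[n --> \oo] --> (0 : R).
  have mc : measurable_fun [set: X] (fun x => csq (F u x)).
    exact: csq_measurable (F_meas u).
  have [] := @dominated_convergence _ X R nu setT measurableT
    (fun n x => (g' (tn n) x ^+ 2 * csq (F u x))%:E) (cst 0%E)
    (fun x => (C ^+ 2)%:E * (csq (F u x))%:E)%E.
  - by move=> n; apply/measurable_EFinP; apply: measurable_funM => //; exact: measurable_funX.
  - exact: measurable_cst.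
  - apply: aeW => x _; rewrite (_ : cst 0%E x = (0 ^+ 2 * csq (F u x))%:E); last first.
      by rewrite expr0n mul0r.
    apply: cvg_EFin; first exact: nearW.
    have h : g' (tn n) x @[n --> \oo] --> (0 : R).
      by move/cvg_pinftyP : (g'0 x); apply.
    by apply: cvgM (cvg_cst _); exact: (cvgM h h).
  - apply: integrableZl => //; apply/integrableP; split.
      exact/measurable_EFinP.
    under eq_integral do rewrite gee0_abs ?lee_fin ?csq_ge0//.
    by rewrite -/(L2sq nu (F u)) F_norm ltry.
  - apply: aeW => x n _; rewrite -EFinM lee_fin normrM (ger0_norm (csq_ge0 _)).
    rewrite ler_wpM2r ?csq_ge0// normrX lerXn2r ?nnegrE//.
    exact: C0 x.
  move=> _ _; rewrite integral_cst// mul0e => h.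
  have -> : (fun n => rnorm (mulop (g' (tn n)) u) ^+ 2) =
      fine \o (fun n => \int[nu]_x (g' (tn n) x ^+ 2 * csq (F u x))%:E)%E.
    apply/funext => n /=; apply: EFin_inj.
    rewrite -F_norm (L2sq_ae (F_meas _) (cmeasurableM (mg' _) (F_meas u)) (mulopP u (bg' _))).
    have e : (\int[nu]_x (g' (tn n) x ^+ 2 * csq (F u x))%:E =
        L2sq nu (fun x => (g' (tn n) x)%:C * F u x)%R)%E.
      by apply: eq_integral => x _; rewrite csqZ.
    rewrite e fineK// ge0_fin_numE ?L2sq_ge0//.
    apply: le_lt_trans (L2sq_mul_le nu (mg' _) (F_meas u) (g'C _)) _.
    by rewrite F_norm -EFinM ltry.
  exact: fine_cvg.
have -> : (fun n => rnorm (mulop (g' (tn n)) u)) =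
    (fun n => Num.sqrt (rnorm (mulop (g' (tn n)) u) ^+ 2)).
  by apply/funext => n; rewrite sqrtr_sqr ger0_norm// rnorm_ge0.
rewrite -(sqrtr0 R); apply: cvg_comp sq0 _; exact: sqrt_continuous.
Unshelve. all: by end_near. Qed.

End Multipliers.

(** * Mild solutions tested against dual paths *)

Section LimitsOfQuotients.
Context {R : realType}.
Implicit Types (f g : R -> R) (t s h : R).

Lemma is_derive_cvg f t l : is_derive t 1 f l ->
  h^-1 * (f (t + h) - f t) @[h --> 0^'] --> l.
Proof.
move=> [df <-]; rewrite /derive; apply: cvg_trans df.
by apply: near_eq_cvg; apply: nearW => h /=; rewrite [h *: (1 : R)]mulr1 (addrC t h).
Qed.

Lemma cvg_is_derive f t l : h^-1 * (f (t + h) - f t) @[h --> 0^'] --> l ->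
  is_derive t 1 f l.
Proof.
move=> cf.
have E : (fun h => h^-1 *: ((f \o shift t) (h *: 1) - f t)) = (fun h => h^-1 * (f (t + h) - f t)).
  by apply/funext => h /=; rewrite [h *: (1 : R)]mulr1 (addrC t h).
apply: DeriveDef.
  by rewrite /derivable E; apply/cvg_ex; exists l.
by rewrite /derive E; apply/cvg_lim.
Qed.

Lemma clamp_continuous (V : topologicalType) (f : R -> V) :
  {within `[0, +oo[, continuous f} -> continuous (fun t => f (Num.max t 0)).
Proof.
move=> /subspace_continuousP cf t.
have m0 : `[0, +oo[%classic (Num.max t 0) by rewrite /= in_itv/= andbT le_max lexx orbT.
have := cf _ m0; apply: cvg_comp => A.
rewrite /within /= => hA.
have cm : (fun s : R => Num.max s 0) @ t --> Num.max t 0.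
  by apply: continuous_max; [exact: cvg_id|exact: cvg_cst].
apply: (@filterS _ (nbhs t) _ _ _ _ (cm _ hA)) => s h; apply: h.
by rewrite /= in_itv/= andbT le_max lexx orbT.
Qed.

Lemma integral_antiderivative f G t : 0 <= t ->
  (forall s, is_derive s 1 G (f s)) -> continuous f ->
  (\int[@lebesgue_measure R]_(s in `[0, t]) f s = G t - G 0)%R.
Proof.
move=> t0 dG cf; have [t00|tp] := eqVneq t 0.
  by rewrite t00 set_itv1 Rintegral_set1 subrr.
have {}tp : 0 < t by rewrite lt_neqAle eq_sym tp.
rewrite /Rintegral (continuous_FTC2 (F := G) tp) //.
- exact: continuous_subspaceT.
- have cG := deriv_continuous dG; split.
  + by move=> s _; have [] := dG s.
  + by apply: cvg_at_right_filter; exact: cG.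
  + by apply: cvg_at_left_filter; exact: cG.
- by move=> s _; rewrite derive1E; have [_ ->] := dG s.
Qed.

End LimitsOfQuotients.

Section Mild.
Context {R : realType} {H : completeNormedModType R[i]} (dot : {dot H for Num.conj}).
Hypothesis hdot : induces_norm dot.
Variables (L : uop H) (S : R -> H * H -> H * H).
Hypothesis hS : unitary_group dot S.
Hypothesis hSgen : generates (wave_op L) S.
Variables (b bt : R -> R).
Hypothesis cbt : continuous bt.
Hypothesis bbt : forall t, 0 <= t -> bt t = b t.
Variable U : R -> H * H.
Hypothesis hU : mild_solution dot S b U.
Local Notation Re := complex.Re.
Local Notation rdot := (rdot dot).
Local Notation rdot2 := (rdot2 dot).
Implicit Types (x y w : H * H) (t s h : R).

Let Up t := U (Num.max t 0).

Lemma Up_continuous : continuous Up.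
Proof. exact: clamp_continuous hU.1. Qed.

Lemma S_continuous x : continuous (fun t => S t x).
Proof. exact: ug_continuous hS x. Qed.

Lemma S_unitary t x y : rdot2 (S t x) (S t y) = rdot2 x y.
Proof. by rewrite -!rdot2E (ug_dot hS). Qed.

Lemma S_opp t x : S t (S (- t) x) = x.
Proof. by rewrite -(ug_add hS) subrr (ug_0 hS). Qed.

(** Duhamel's formula paired with [S t w].  Since [S] is unitary, [S (t - s)] turns into
    [S s] acting on [w]: the integrand is a scalar function of [s] alone, and the
    formula can be differentiated in [t]. *)
Lemma mild_weak t w : 0 <= t -> rdot2 (U t) (S t w) = rdot2 (U 0) w -
  (\int[@lebesgue_measure R]_(s in `[0%R, t]) (2 * bt s * rdot (Up s).2 (S s w).2))%R.
Proof.
move=> t0; have [I hI ->] := hU.2 t t0.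
rewrite rdot2Dl rdot2Nl S_unitary; congr (_ - _).
rewrite -rdot2E; have [_ _ ->] := hI (S t w).
rewrite /=; apply: eq_Rintegral => s; rewrite inE /= in_itv/= => /andP[s0 st].
rewrite rdot2E.
have -> : S t w = S (t - s) (S s w) by rewrite -(ug_add hS) subrK.
rewrite S_unitary /rdot2 /= -[(2 * b s)%:C]/(real_complex R (2 * b s)).
rewrite rdotZl /Up (_ : Num.max s 0 = s); last exact/max_idPl.
have -> : rdot 0 (S s w).1 = 0 by rewrite /rdot linear0l.
by rewrite add0r bbt.
Qed.

Lemma mild_weak_deriv t w : 0 < t ->
  is_derive t 1 (fun t => rdot2 (Up t) (S t w)) (- (2 * bt t * rdot (Up t).2 (S t w).2)).
Proof.
move=> t0.
pose g s := 2 * bt s * rdot (Up s).2 (S s w).2.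
have cg : continuous g.
  move=> s; apply: cvgM; first by apply: cvgM; [exact: cvg_cst|exact: cbt].
  have := rdot2_cvg hdot (f := fun s => (0, (Up s).2)) (g := fun s => S s w)
     (l := (0, (Up s).2)) (k := S s w) (F := nbhs s).
  rewrite /rdot2 /= => h.
  have cU2 : (Up s').2 @[s' --> s] --> (Up s).2.
    by apply: cvg_comp (@Up_continuous s) _; exact: cvg_snd.
  have {}h := h _ _ (@S_continuous w s).
  have E (y : H) : rdot 0 y = 0 by rewrite /rdot linear0l.
  have : rdot 0 (S s0 w).1 + rdot (Up s0).2 (S s0 w).2 @[s0 --> s] -->
         rdot 0 (S s w).1 + rdot (Up s).2 (S s w).2.
    by apply: h; apply: cvg_pair => //; exact: cvg_cst.
  by under eq_fun do rewrite E add0r; rewrite E add0r.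
have [G [G0 dG]] := antiderivative_exists cg.
have dr : is_derive t 1 (fun s => rdot2 (U 0) w - G s) (- g t).
  by apply: is_deriv_eq (is_derivD (is_deriv_cst _ _) (is_derivN (dG t))) _; rewrite add0r.
apply: near_eq_is_derive dr; near=> s.
have s0 : 0 <= s.
  near: s; apply/nbhs_ballP; exists t => //= y.
  by rewrite /ball/= ltr_norml; lra.
rewrite /Up (_ : Num.max s 0 = s); last exact/max_idPl.
by rewrite mild_weak// (integral_antiderivative s0 dG cg) G0 subr0.
Unshelve. all: by end_near. Qed.

(** [k] solves the adjoint equation [k' = G k + 2 b (0, k2)], [G] being the generator of [S].
    In the difference quotient, [k (t + h)] is compared with [S h (k t)]; the path
    [S (t + h) w], [w = S (- t) (k t)], is covered by [mild_weak_deriv]. *)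
Lemma dual_path_deriv (k : R -> H * H) t y : 0 < t ->
  (udom L (k t).1 /\ udom L (k t).2) ->
  (h^-1)%:C *: (k (t + h) - k t) @[h --> 0^'] --> y ->
  y = (L (k t).2, - L (k t).1 + (2 * bt t)%:C *: (k t).2) ->
  {for t, continuous k} ->
  is_derive t 1 (fun t => rdot2 (Up t) (k t)) 0.
Proof.
move=> t0 hdom ky yE ck; apply: cvg_is_derive.
pose w := S (- t) (k t).
have Gk : (h^-1)%:C *: (S h (k t) - k t) @[h --> 0^'] --> (L (k t).2, - L (k t).1).
  exact: (hSgen _ _).1.
have ct : (fun h : R => t + h) @ 0^' --> t.
  apply: cvg_trans (_ : (fun h : R => t + h) @ 0 --> t); last first.
    rewrite -[X in _ --> X]addr0; apply: cvgD; [exact: cvg_cst|exact: cvg_id].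
  by apply: cvg_app; exact: cvg_within.
have d1 := is_derive_cvg (mild_weak_deriv w t0).
have c1 : Up (t + h) @[h --> 0^'] --> Up t.
  by apply: cvg_comp ct _; exact: Up_continuous.
have c2 : (h^-1)%:C *: (k (t + h) - S h (k t)) @[h --> 0^'] --> (0, (2 * bt t)%:C *: (k t).2).
  have -> : (0, (2 * bt t)%:C *: (k t).2) = y - (L (k t).2, - L (k t).1).
    by rewrite yE; congr pair; rewrite /= ?subrr// addrAC subrr add0r.
  have -> : (fun h : R => (h^-1)%:C *: (k (t + h) - S h (k t))) =
     (fun h => (h^-1)%:C *: (k (t + h) - k t) - (h^-1)%:C *: (S h (k t) - k t)).
    by apply/funext => h; rewrite -scalerBr opprB addrA subrK.
  exact: cvgB.
have c3 := rdot2_cvg hdot c1 c2.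
have E : (fun h => h^-1 * (rdot2 (Up (t + h)) (k (t + h)) - rdot2 (Up t) (k t))) =
  (fun h => rdot2 (Up (t + h)) ((h^-1)%:C *: (k (t + h) - S h (k t))) +
   h^-1 * (rdot2 (Up (t + h)) (S (t + h) w) - rdot2 (Up t) (S t w))).
  apply/funext => h; rewrite /w S_opp (addrC t h) (ug_add hS) S_opp rdot2Zr.
  by rewrite rdot2Dr rdot2Nr; ring.
rewrite E.
have Z : rdot2 (Up t) (0, (2 * bt t)%:C *: (k t).2) +
    - (2 * bt t * rdot (Up t).2 (S t w).2) = 0.
  rewrite /w S_opp /rdot2 /= rdotZr.
  have -> : rdot (Up t).1 0 = 0 by rewrite rdotC /rdot linear0l.
  by rewrite add0r subrr.
suff : rdot2 (Up (t + h)) ((h^-1)%:C *: (k (t + h) - S h (k t))) +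
    h^-1 * (rdot2 (Up (t + h)) (S (t + h) w) - rdot2 (Up t) (S t w)) @[h --> 0^'] -->
    rdot2 (Up t) (0, (2 * bt t)%:C *: (k t).2) +
    - (2 * bt t * rdot (Up t).2 (S t w).2) by rewrite Z.
by apply: cvgD; [exact: c3|exact: d1].
Qed.

(** The adjoint equation makes the pairing with every mild solution constant.  This is
    also the uniqueness argument for mild solutions. *)
Lemma dual_path_const (k : R -> H * H) (k' : R -> H * H) T : 0 <= T -> continuous k ->
  (forall t, 0 < t <= T -> udom L (k t).1 /\ udom L (k t).2) ->
  (forall t, 0 < t <= T -> (h^-1)%:C *: (k (t + h) - k t) @[h --> 0^'] --> k' t) ->
  (forall t, 0 < t <= T -> k' t = (L (k t).2, - L (k t).1 + (2 * bt t)%:C *: (k t).2)) ->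
  rdot2 (U T) (k T) = rdot2 (U 0) (k 0).
Proof.
move=> T0 ck dk kk' k'E.
have cphi : continuous (fun t => rdot2 (Up t) (k t)).
  by move=> t; apply: (rdot2_cvg hdot); [exact: Up_continuous|exact: ck].
have e0 t : 0 <= t -> Up t = U t by move=> t0; rewrite /Up; congr U; exact/max_idPl.
rewrite -!e0//.
apply/eqP; rewrite -subr_eq0; apply/eqP.
have [T00|Tp] := eqVneq T 0; first by rewrite T00 subrr.
have {}Tp : 0 < T by rewrite lt_neqAle eq_sym Tp.
have [|c _] := @MVT R (fun t => rdot2 (Up t) (k t)) (fun=> 0) 0 T Tp _ (continuous_subspaceT cphi).
  move=> t; rewrite in_itv/= => /andP[t0 tT].
  have ht : 0 < t <= T by rewrite t0 ltW.
  exact: dual_path_deriv t0 (dk t ht) (kk' t ht) (k'E t ht) (ck t).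
by rewrite mul0r.
Qed.

End Mild.

(** * Differentiable paths of multipliers *)

Section ScalarPaths.
Context {R : realType}.
Implicit Types (f b : R -> R) (s t r T C M xi n eps : R).

Lemma deriv_lipschitz f f' (A : set R) C : is_interval A ->
  (forall r, A r -> is_derive r 1 f (f' r)) -> (forall r, A r -> `|f' r| <= C) ->
  forall s t, A s -> A t -> `|f s - f t| <= C * `|s - t|.
Proof.
move=> iA df bf.
suff h s t : A s -> A t -> s <= t -> `|f s - f t| <= C * `|s - t|.
  move=> s t As At; have [st|/ltW ts] := leP s t; first exact: h.
  by rewrite distrC (distrC s); exact: h.
move=> As At st; rewrite distrC (distrC s) (ger0_norm (_ : 0 <= t - s)) ?subr_ge0//.
have -> : C * (t - s) = C * t - C * s by ring.
have inA r : s <= r <= t -> A r by move=> hr; exact: iA As At r hr.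
apply: (@deriv_le_norm _ f (fun r => C * r) f' (fun=> C)) => // r hr.
- by apply: df; exact: inA.
- by apply: is_deriv_eq (is_derivM (is_deriv_cst _ _) (is_deriv_id _)) _; rewrite mul0r add0r mulr1.
- by apply: bf; exact: inA.
Qed.

Lemma deriv_taylor f f' t C : 0 <= C ->
  forall s, (forall r, Num.min s t <= r <= Num.max s t -> is_derive r 1 f (f' r)) ->
  (forall r, Num.min s t <= r <= Num.max s t -> `|f' r - f' t| <= C) ->
  `|f s - f t - (s - t) * f' t| <= C * `|s - t|.
Proof.
move=> C0 s df bf.
pose A := [set r | Num.min s t <= r <= Num.max s t].
have iA : is_interval A.
  move=> x y; rewrite /A /= => /andP[a1 a2] /andP[b1 b2] z /andP[z1 z2].
  by rewrite (le_trans a1 z1) (le_trans z2 b2).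
have := @deriv_lipschitz (fun r => f r - r * f' t) (fun r => f' r - f' t) A C iA _ bf s t.
have -> : f s - s * f' t - (f t - t * f' t) = f s - f t - (s - t) * f' t by ring.
apply.
- move=> r hr; apply: is_deriv_eq (is_derivD (df r hr) (is_derivN (is_derivM (is_deriv_id _) (is_deriv_cst _ _)))) _.
  by rewrite mul1r mulr0 addr0.
- by rewrite /A /= ge_min le_max lexx.
- by rewrite /A /= ge_min le_max lexx !orbT.
Qed.

(** The adjoint equation of [dual_path_deriv] for a path of multipliers in [xi]. *)
Definition dual_mode b (k1 k2 : R -> R -> R) := forall xi t,
  is_derive t 1 (k1 xi) (xi * k2 xi t) /\
  is_derive t 1 (k2 xi) (- (xi * k1 xi t) + 2 * b t * k2 xi t).

Lemma dual_mode_lipschitz b k1 k2 n T : continuous b -> dual_mode b k1 k2 ->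
  (exists M, forall xi t, 0 <= t <= T -> `|k1 xi t| <= M /\ `|k2 xi t| <= M) ->
  exists C, 0 <= C /\ forall xi, 0 <= xi <= n -> forall s t, 0 <= s <= T -> 0 <= t <= T ->
    `|k1 xi s - k1 xi t| <= C * `|s - t| /\ `|k2 xi s - k2 xi t| <= C * `|s - t|.
Proof.
move=> cb hk [M hM].
have [B hB] := continuous_bounded T cb.
have hB' t : 0 <= t <= T -> `|b t| <= B by move=> /andP[t0 tT]; apply: hB; rewrite ger0_norm.
exists (`|n| * `|M| + 2 * `|B| * `|M|); split.
  by rewrite addr_ge0 ?mulr_ge0.
move=> xi /andP[xi0 xin] s t hs ht.
have Mr r : 0 <= r <= T -> `|k1 xi r| <= `|M| /\ `|k2 xi r| <= `|M|.
  by move=> /hM-/(_ xi)[h1 h2]; split; [apply: le_trans h1 _|apply: le_trans h2 _]; exact: ler_norm.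
have xin' : `|xi| <= `|n| by rewrite !ger0_norm// (le_trans xi0).
have iA : is_interval [set r | 0 <= r <= T].
  move=> x y /= /andP[a1 a2] /andP[b1 b2] z /andP[z1 z2].
  by rewrite (le_trans a1 z1) (le_trans z2 b2).
split.
  apply: (deriv_lipschitz iA (f' := fun t => xi * k2 xi t)) => // r hr; first exact: (hk xi r).1.
  rewrite normrM; apply: le_trans (_ : `|n| * `|M| <= _).
    by apply: ler_pM => //; exact: (Mr r hr).2.
  by rewrite lerDl !mulr_ge0.
apply: (deriv_lipschitz iA (f' := fun t => - (xi * k1 xi t) + 2 * b t * k2 xi t)) => // r hr.
  exact: (hk xi r).2.
apply: le_trans (ler_normD _ _) _; rewrite normrN !normrM (ger0_norm (_ : 0 <= 2))//.
apply: lerD; first by apply: ler_pM => //; exact: (Mr r hr).1.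
apply: ler_pM => //; last exact: (Mr r hr).2.
by rewrite ler_wpM2l//; apply: le_trans (hB' r hr) _; exact: ler_norm.
Qed.

(** Uniformity for [xi] in a bounded set turns pointwise derivatives of multipliers into
    derivatives in operator norm. *)
Lemma dual_mode_taylor b k1 k2 n t : continuous b -> dual_mode b k1 k2 -> 0 < t ->
  (forall T, exists M, forall xi t, 0 <= t <= T -> `|k1 xi t| <= M /\ `|k2 xi t| <= M) ->
  forall eps, 0 < eps -> exists2 e, 0 < e & forall s xi, `|s - t| < e -> 0 <= xi <= n ->
    `|k1 xi s - k1 xi t - (s - t) * (xi * k2 xi t)| <= eps * `|s - t| /\
    `|k2 xi s - k2 xi t - (s - t) * (- (xi * k1 xi t) + 2 * b t * k2 xi t)| <= eps * `|s - t|.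
Proof.
move=> cb hk t0 hM eps eps0.
pose T := t + 1.
have [C [C0 hC]] := dual_mode_lipschitz n cb hk (hM T).
have [M {}hM] := hM T.
have [B hB] := continuous_bounded T cb.
have tT : 0 <= t <= T by rewrite /T; apply/andP; split; lra.
pose K := `|n| * C + 2 * `|M| + 2 * `|B| * C + 1.
have K1 : 0 < K.
  have h1 : 0 <= `|n| * C by rewrite mulr_ge0.
  have h2 : 0 <= 2 * `|M| by rewrite mulr_ge0.
  have h3 : 0 <= 2 * `|B| * C by rewrite !mulr_ge0.
  by rewrite /K; lra.
have eK : 0 < eps / K by rewrite divr_gt0.
have := cb t => /cvgrPdist_lt/(_ _ eK) /nbhs_ballP[e1 /= e10 he1].
exists (Num.min (Num.min e1 (eps / K)) (Num.min t 1)).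
  by rewrite !lt_min e10 eK t0 ltr01.
move=> s xi; rewrite !lt_min => /andP[/andP[s1 s2] /andP[s3 s4]] hxi.
have [xi0 xin] := andP hxi.
have xin' : `|xi| <= `|n| by rewrite !ger0_norm// (le_trans xi0).
pose A := [set r | Num.min s t <= r <= Num.max s t].
have near r : A r -> [/\ `|r - t| <= `|s - t|, 0 <= r <= T & `|b r - b t| <= eps / K].
  move=> hr.
  have d : `|r - t| <= `|s - t|.
    move: hr; rewrite /A /=; have [st|/ltW st] := leP s t => /andP[h1 h2].
      by rewrite !ler0_norm ?subr_le0//; lra.
    by rewrite !ger0_norm ?subr_ge0//; lra.
  split => //.
    have := le_lt_trans d s3; have := le_lt_trans d s4; rewrite !ltr_norml /T.
    by move=> /andP[? ?] /andP[? ?]; apply/andP; split; lra.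
  rewrite distrC; apply/ltW; apply: he1; rewrite /ball/= distrC.
  exact: le_lt_trans s1.
have dK r : A r -> `|r - t| <= eps / K.
  by move=> /near[h _ _]; apply: le_trans h _; exact: ltW.
have bound r : A r -> `|k1 xi r - k1 xi t| <= C * (eps / K) /\
    `|k2 xi r - k2 xi t| <= C * (eps / K).
  move=> Ar; have [_ h2 _] := near r Ar; have [h3 h4] := hC xi hxi r t h2 tT.
  split; [apply: le_trans h3 _|apply: le_trans h4 _]; by rewrite ler_wpM2l// dK.
have epsE : eps = K * (eps / K) by rewrite mulrCA divff ?mulr1// gt_eqF.
have Mt : `|k2 xi t| <= `|M|.
  by have [_ h] := hM xi t tT; apply: le_trans h _; exact: ler_norm.
split.
  apply: (deriv_taylor (f' := fun t => xi * k2 xi t) (ltW eps0)) => r Ar; first exact: (hk xi r).1.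
  have [_ h2] := bound r Ar.
  rewrite -mulrBr normrM; apply: le_trans (_ : `|n| * (C * (eps / K)) <= _).
    exact: ler_pM.
  have h : (`|n| * C) * (eps / K) <= K * (eps / K).
    rewrite ler_wpM2r ?(ltW eK)// /K -!addrA lerDl.
    by rewrite !addr_ge0// !mulr_ge0.
  by rewrite (mulrA `|n| C); apply: le_trans h _; rewrite -epsE.
apply: (deriv_taylor (f' := fun t => - (xi * k1 xi t) + 2 * b t * k2 xi t) (ltW eps0)) => r Ar.
  exact: (hk xi r).2.
have [h1 h2] := bound r Ar; have [_ hr hb] := near r Ar.
have -> : - (xi * k1 xi r) + 2 * b r * k2 xi r - (- (xi * k1 xi t) + 2 * b t * k2 xi t) =
  - xi * (k1 xi r - k1 xi t) + (2 * b r * (k2 xi r - k2 xi t) + 2 * (b r - b t) * k2 xi t).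
  by ring.
apply: le_trans (ler_normD _ _) _; apply: le_trans (lerD (lexx _) (ler_normD _ _)) _.
rewrite !normrM normrN (ger0_norm (_ : 0 <= 2))//.
have Br : `|b r| <= `|B|.
  apply: le_trans (ler_norm B); apply: hB.
  by have /andP[r0 rT] := hr; rewrite ger0_norm.
have t1 : `|xi| * `|k1 xi r - k1 xi t| <= `|n| * (C * (eps / K)) by exact: ler_pM.
have t2 : 2 * `|b r| * `|k2 xi r - k2 xi t| <= 2 * `|B| * (C * (eps / K)).
  by apply: ler_pM; rewrite ?mulr_ge0 ?ler_wpM2l.
have t3 : 2 * `|b r - b t| * `|k2 xi t| <= 2 * (eps / K) * `|M|.
  by apply: ler_pM; rewrite ?mulr_ge0 ?ler_wpM2l.
apply: le_trans (lerD t1 (lerD t2 t3)) _.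
rewrite [leRHS]epsE /K.
have -> : `|n| * (C * (eps / K)) + (2 * `|B| * (C * (eps / K)) + 2 * (eps / K) * `|M|) =
   (`|n| * C + 2 * `|M| + 2 * `|B| * C) * (eps / K) by ring.
by rewrite ler_wpM2r ?(ltW eK)// lerDl.
Qed.

End ScalarPaths.

Section MultiplierPaths.
Context {R : realType} {H : completeNormedModType R[i]} (dot : {dot H for Num.conj}).
Hypothesis hdot : induces_norm dot.
Context {L : uop H} {d : measure_display} {X : measurableType d}.
Context {nu : {measure set X -> \bar R}} {F : H -> X -> R[i]} {m : X -> R}.
Hypothesis hF : spectral_rep L nu F m.
Local Notation mulop := (@mulop R H d X nu F).
Implicit Types (u v a : H) (g : X -> R) (s t r T C eps : R).

Lemma mulop_scal r g u : bmeas g -> r%:C *: mulop g u = mulop (fun x => r * g x) u.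
Proof.
by move=> bg; rewrite -(mulop_comp hF u (bmeas_cst r) bg) (mulop_cst hF).
Qed.

Lemma mulop_sub g g' u : bmeas g -> bmeas g' ->
  mulop g u - mulop g' u = mulop (fun x => g x - g' x) u.
Proof.
move=> bg bg'; rewrite (mulop_plus hF u bg (bmeasN bg')); congr (_ + _).
have -> : (fun x => - g' x) = (fun x => -1 * g' x) by apply/funext => x; rewrite mulN1r.
by rewrite -mulop_scal// rmorphN1 scaleN1r.
Qed.

Lemma L_mulop g a : bmeas g -> bmeas (fun x => m x * g x) ->
  udom L (mulop g a) /\ L (mulop g a) = mulop (fun x => m x * g x) a.
Proof.
move=> bg bmg.
have e : {ae nu, forall x, F (mulop (fun x => m x * g x) a) x = (m x)%:C * F (mulop g a) x}.
  apply: filterS2 (mulopP hF a bmg) (mulopP hF a bg) => x -> ->.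
  by rewrite rmorphM mulrA.
have dg : udom L (mulop g a).
  apply/(sr_dom hF)/L2P; split; first exact: cmeasurableM (sr_measurable hF) (F_meas hF _).
  rewrite -(L2sq_ae (F_meas hF _) (cmeasurableM (sr_measurable hF) (F_meas hF _)) e).
  by rewrite (F_norm hF) ltry.
split => //; apply: (F_inj hF).
by apply: filterS2 (sr_mult hF dg) e => x -> ->.
Qed.

Lemma mulop_path_continuous (c : R -> X -> R) a : (forall t, 0 <= t -> bmeas (c t)) ->
  (forall T, exists C, forall s t x, 0 <= s <= T -> 0 <= t <= T ->
    `|c s x - c t x| <= C * `|s - t|) ->
  continuous (fun t => mulop (c (Num.max t 0)) a).
Proof.
move=> bc hc t; apply/rcvgP.
have p0 (s : R) : 0 <= Num.max s 0 by rewrite le_max lexx orbT.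
have [C hC] := hc (Num.max t 0 + 1).
have hl : C * `|Num.max s 0 - Num.max t 0| * rnorm a @[s --> t] -->
    C * `|Num.max t 0 - Num.max t 0| * rnorm a.
  apply: cvgM; last exact: cvg_cst.
  apply: cvgM; first exact: cvg_cst.
  apply: cvg_norm; apply: cvgB; last exact: cvg_cst.
  by apply: continuous_max; [exact: cvg_id|exact: cvg_cst].
rewrite subrr normr0 mulr0 mul0r in hl.
apply: (squeeze_cvgr _ (cvg_cst 0) hl).
near=> s; rewrite rnorm_ge0/= (mulop_sub _ (bc _ (p0 s)) (bc _ (p0 t))).
apply: (mulop_norm hF).
  by have := bmeasD (bc _ (p0 s)) (bmeasN (bc _ (p0 t))).
have ts : `|t - s| < 1 by near: s; apply: cvgr_dist_lt; rewrite ?ltr01//; exact: cvg_id.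
move=> x; apply: hC; rewrite p0/=.
  move: ts; rewrite ltr_norml => /andP[? ?]; rewrite ge_max; apply/andP; split.
    have : t <= Num.max t 0 by rewrite le_max lexx.
    lra.
  by rewrite addr_ge0.
by rewrite lerDl ler01.
Unshelve. all: by end_near. Qed.

Lemma mulop_path_deriv (c : R -> X -> R) (c' : X -> R) a t : (forall t, 0 <= t -> bmeas (c t)) ->
  bmeas c' -> 0 < t ->
  (forall eps, 0 < eps -> exists2 e, 0 < e & forall s x, `|s - t| < e ->
    `|c s x - c t x - (s - t) * c' x| <= eps * `|s - t|) ->
  (h^-1)%:C *: (mulop (c (Num.max (t + h) 0)) a - mulop (c (Num.max t 0)) a) @[h --> 0^']
    --> mulop c' a.
Proof.
move=> bc bc' t0 hc; apply/rcvgP/cvgr0Pnorm_le => eps eps0.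
pose eps' := eps / (rnorm a + 1).
have a1 : 0 < rnorm a + 1 by rewrite ltr_wpDl ?rnorm_ge0.
have eps'0 : 0 < eps' by rewrite divr_gt0.
have [e e0 he] := hc eps' eps'0.
near=> h.
have h0 : h != 0 by near: h; exact: nbhs_dnbhs_neq.
have he' : `|h| < Num.min e t.
  near: h; apply: dnbhs0_lt; rewrite lt_min e0; exact: t0.
have [h1 h2] : `|h| < e /\ `|h| < t by move: he'; rewrite lt_min => /andP.
have th0 : 0 <= t + h by move: h2; rewrite ltr_norml => /andP[? _]; lra.
rewrite (_ : Num.max (t + h) 0 = t + h); last exact/max_idPl.
rewrite (_ : Num.max t 0 = t); last by apply/max_idPl; exact: ltW.
have bt := bc t (ltW t0); have bth := bc _ th0.
have bd := bmeasD bth (bmeasN bt).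
rewrite ger0_norm ?rnorm_ge0// mulop_sub// mulop_scal//.
rewrite mulop_sub//; last by apply: bmeasM => //; exact: bmeas_cst.
apply: le_trans (_ : eps' * rnorm a <= _).
  apply: (mulop_norm hF).
    apply: bmeasD; last exact: bmeasN.
    by apply: bmeasM => //; exact: bmeas_cst.
  move=> x; have := he (t + h) x; rewrite addrAC subrr add0r => /(_ h1) hx.
  have -> : h^-1 * (c (t + h) x - c t x) - c' x = h^-1 * (c (t + h) x - c t x - h * c' x).
    by field.
  by rewrite normrM normfV mulrC ler_pdivrMr ?normr_gt0.
rewrite /eps' -mulrA ler_piMr ?(ltW eps0)// mulrC ler_pdivrMr// mul1r lerDl ler01.
done.
Unshelve. all: by end_near. Qed.

End MultiplierPaths.

(** * Mild solutions in the spectral representation *)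

Section MildPropagator.
Context {R : realType} {H : completeNormedModType R[i]} (dot : {dot H for Num.conj}).
Hypothesis hdot : induces_norm dot.
Variables (L : uop H).
Context {d : measure_display} {X : measurableType d}.
Context {nu : {measure set X -> \bar R}} {F : H -> X -> R[i]} {m : X -> R}.
Hypothesis hF : spectral_rep L nu F m.
Variable S : R -> H * H -> H * H.
Hypothesis hS : unitary_group dot S.
Hypothesis hSgen : generates (wave_op L) S.
Variables (b bt : R -> R).
Hypothesis cbt : continuous bt.
Hypothesis bbt : forall t, 0 <= t -> bt t = b t.
Variable U : R -> H * H.
Hypothesis hU : mild_solution dot S b U.
Local Notation mulop := (@mulop R H d X nu F).
Local Notation rdot := (rdot dot).
Local Notation rdot2 := (rdot2 dot).
Implicit Types (u v a : H) (s t r T C eps n : R).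

(** Cutting off the large frequencies makes the multiplication by [m] bounded, so that the
    dual paths stay in the domain of the generator. *)
Definition cut n (g : R -> R) (x : X) : R := if m x <= n then g (m x) else 0.

Lemma cut_bmeas n (g : R -> R) C : measurable_fun [set: R] g ->
  (forall xi : R, 0 <= xi <= n -> `|g xi| <= C) -> bmeas (cut n g).
Proof.
move=> mg gC; have mm := sr_measurable hF; split.
  apply: measurable_fun_ifT => //; first exact: measurable_fun_ler.
  exact: measurableT_comp.
exists `|C| => x; rewrite /cut; case: ifPn => h; last by rewrite normr0.
by apply: le_trans (ler_norm C); apply: gC; rewrite (sr_ge0 hF).
Qed.

Lemma dual_pairing (k1 k2 : R -> R -> R) n a T : dual_mode bt k1 k2 -> 0 <= T ->
  (forall t, measurable_fun [set: R] (k1 ^~ t) /\ measurable_fun [set: R] (k2 ^~ t)) ->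
  (forall T : R, exists M : R, forall (xi t : R), 0 <= t <= T -> `|k1 xi t| <= M /\ `|k2 xi t| <= M) ->
  rdot2 (U T) (mulop (cut n (k1 ^~ T)) a, mulop (cut n (k2 ^~ T)) a) =
  rdot2 (U 0) (mulop (cut n (k1 ^~ 0)) a, mulop (cut n (k2 ^~ 0)) a).
Proof.
move=> hk T0 mk bk.
pose c1 t := cut n (k1 ^~ t); pose c2 t := cut n (k2 ^~ t).
have bc t : 0 <= t -> bmeas (c1 t) /\ bmeas (c2 t).
  move=> t0; have [M hM] := bk t.
  by split; apply: (@cut_bmeas n _ M) => [|xi _]; try (exact: (mk t).1);
    try (exact: (mk t).2); have := hM xi t; rewrite t0 lexx => /(_ isT)[].
have bmc t : 0 <= t -> bmeas (fun x => m x * c1 t x) /\ bmeas (fun x => m x * c2 t x).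
  move=> t0; have [M hM] := bk t; have [[m1 _] [m2 _]] := bc t t0.
  have mm := sr_measurable hF.
  split; (split; first exact: measurable_funM); exists (`|n| * `|M|) => x.
    rewrite /c1 /cut; case: ifPn => h; last by rewrite mulr0 normr0 mulr_ge0.
    have m0 := sr_ge0 hF x; rewrite normrM ler_pM//.
      by rewrite !ger0_norm// (le_trans m0).
    by apply: le_trans (ler_norm M); apply: (hM _ t _).1; rewrite t0 lexx.
  rewrite /c2 /cut; case: ifPn => h; last by rewrite mulr0 normr0 mulr_ge0.
  have m0 := sr_ge0 hF x; rewrite normrM ler_pM//.
    by rewrite !ger0_norm// (le_trans m0).
  by apply: le_trans (ler_norm M); apply: (hM _ t _).2; rewrite t0 lexx.
pose k t := (mulop (c1 (Num.max t 0)) a, mulop (c2 (Num.max t 0)) a).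
have kE t : 0 <= t -> k t = (mulop (c1 t) a, mulop (c2 t) a).
  by move=> t0; rewrite /k (_ : Num.max t 0 = t)//; exact/max_idPl.
rewrite -/(c1 T) -/(c2 T) -/(c1 0) -/(c2 0) -!kE//.
pose c1' t x := m x * c2 t x.
pose c2' t x := - (m x * c1 t x) + 2 * bt t * c2 t x.
have bc1' t : 0 <= t -> bmeas (c1' t) by move=> /bmc[].
have bc2' t : 0 <= t -> bmeas (c2' t).
  move=> t0; apply: bmeasD; first by apply: bmeasN; exact: (bmc t t0).1.
  by apply: bmeasM; [exact: bmeas_cst|exact: (bc t t0).2].
have lip T' : exists C : R, forall s t x, 0 <= s <= T' -> 0 <= t <= T' ->
    `|c1 s x - c1 t x| <= C * `|s - t| /\ `|c2 s x - c2 t x| <= C * `|s - t|.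
  have [C [C0 hC]] := dual_mode_lipschitz n cbt hk (bk T').
  exists C => s t x hs ht; rewrite /c1 /c2 /cut; case: ifPn => h.
    by apply: hC => //; rewrite (sr_ge0 hF).
  by rewrite subrr normr0 mulr_ge0.
have tay t : 0 < t -> forall eps, 0 < eps -> exists2 e, 0 < e & forall s x, `|s - t| < e ->
    `|c1 s x - c1 t x - (s - t) * c1' t x| <= eps * `|s - t| /\
    `|c2 s x - c2 t x - (s - t) * c2' t x| <= eps * `|s - t|.
  move=> t0 eps eps0; have [e e0 he] := dual_mode_taylor n cbt hk t0 bk eps0.
  exists e => // s x hs; rewrite /c1 /c2 /c1' /c2' /c1 /c2 /cut; case: ifPn => h.
    by apply: he => //; rewrite (sr_ge0 hF).
  by rewrite !(mulr0, subrr, oppr0, addr0, normr0) mulr_ge0// ltW.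
apply: (dual_path_const hdot hS hSgen cbt bbt hU
   (k' := fun t => (mulop (c1' t) a, mulop (c2' t) a))) => //.
- move=> t; apply: cvg_pair.
    apply: (mulop_path_continuous hF) => [s /bc[]//|T'].
    by have [C hC] := lip T'; exists C => s t' x hs ht; exact: (hC s t' x hs ht).1.
  apply: (mulop_path_continuous hF) => [s /bc[]//|T'].
  by have [C hC] := lip T'; exists C => s t' x hs ht; exact: (hC s t' x hs ht).2.
- move=> t /andP[t0 _]; rewrite kE ?ltW//=.
  have [[b1 b2] [b3 b4]] := (bc t (ltW t0), bmc t (ltW t0)).
  by split; [exact: (L_mulop hF a b1 b3).1|exact: (L_mulop hF a b2 b4).1].
- move=> t /andP[t0 _].
  have e : (fun h => (h^-1)%:C *: (k (t + h) - k t)) =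
    (fun h => ((h^-1)%:C *: (mulop (c1 (Num.max (t + h) 0)) a - mulop (c1 (Num.max t 0)) a),
               (h^-1)%:C *: (mulop (c2 (Num.max (t + h) 0)) a - mulop (c2 (Num.max t 0)) a))).
    by apply/funext => h.
  rewrite e; apply: cvg_pair.
    apply: (mulop_path_deriv hF) => [s /bc[]//||//|eps eps0]; first exact/bc1'/ltW.
    by have [e' e0 he] := tay t t0 eps eps0; exists e' => // s x hs; exact: (he s x hs).1.
  apply: (mulop_path_deriv hF) => [s /bc[]//||//|eps eps0]; first exact/bc2'/ltW.
  by have [e' e0 he] := tay t t0 eps eps0; exists e' => // s x hs; exact: (he s x hs).2.
- move=> t /andP[/ltW t0 _]; rewrite kE//=.
  have [[b1 b2] [b3 b4]] := (bc t t0, bmc t t0).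
  rewrite (L_mulop hF a b1 b3).2 (L_mulop hF a b2 b4).2; congr pair.
  rewrite (mulop_scal hF _ _ b2) /c2' (mulop_plus hF a (bmeasN b3)); last first.
    by apply: bmeasM => //; exact: bmeas_cst.
  congr (_ + _).
  have -> : (fun x => - (m x * c1 t x)) = (fun x => -1 * (m x * c1 t x)).
    by apply/funext => x; rewrite mulN1r.
  by rewrite -(mulop_scal hF)// rmorphN1 scaleN1r.
Qed.

Lemma rdot_eq u v : (forall a, rdot u a = rdot v a) -> u = v.
Proof.
move=> h; apply/eqP; rewrite -subr_eq0; apply/eqP/rnorm0_eq0.
apply/eqP; rewrite -sqrf_eq0 -(rdotE hdot).
have N1 (w : H) : - w = (-1)%:C *: w by rewrite rmorphN1 scaleN1r.
by rewrite {1}N1 rdotDl rdotZl h; apply/eqP; ring.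
Qed.

(** The multipliers are moved to the solution by symmetry; as [a] is arbitrary, the
    constancy of the pairing becomes an identity of functions on the spectral
    side. *)
Lemma dual_equation (k1 k2 : R -> R -> R) n T : dual_mode bt k1 k2 -> 0 <= T ->
  (forall t, measurable_fun [set: R] (k1 ^~ t) /\ measurable_fun [set: R] (k2 ^~ t)) ->
  (forall T : R, exists M : R, forall (xi t : R), 0 <= t <= T -> `|k1 xi t| <= M /\ `|k2 xi t| <= M) ->
  {ae nu, forall x, m x <= n ->
    (k1 (m x) T)%:C * F (U T).1 x + (k2 (m x) T)%:C * F (U T).2 x =
    (k1 (m x) 0)%:C * F (U 0).1 x + (k2 (m x) 0)%:C * F (U 0).2 x}.
Proof.
move=> hk T0 mk bk.
have bc t : 0 <= t -> bmeas (cut n (k1 ^~ t)) /\ bmeas (cut n (k2 ^~ t)).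
  move=> t0; have [M hM] := bk t.
  by split; apply: (@cut_bmeas n _ M) => [|xi _]; try (exact: (mk t).1);
    try (exact: (mk t).2); have := hM xi t; rewrite t0 lexx => /(_ isT)[].
have [bT1 bT2] := bc T T0; have [b01 b02] := bc 0 (lexx _).
have e : mulop (cut n (k1 ^~ T)) (U T).1 + mulop (cut n (k2 ^~ T)) (U T).2 =
         mulop (cut n (k1 ^~ 0)) (U 0).1 + mulop (cut n (k2 ^~ 0)) (U 0).2.
  apply: rdot_eq => a; rewrite !rdotDl !(mulop_sym hdot hF)//.
  exact: dual_pairing.
have h1 := ae_and (F_add hF (mulop (cut n (k1 ^~ T)) (U T).1) (mulop (cut n (k2 ^~ T)) (U T).2))
   (ae_and (mulopP hF (U T).1 bT1) (mulopP hF (U T).2 bT2)).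
have h2 := ae_and (F_add hF (mulop (cut n (k1 ^~ 0)) (U 0).1) (mulop (cut n (k2 ^~ 0)) (U 0).2))
   (ae_and (mulopP hF (U 0).1 b01) (mulopP hF (U 0).2 b02)).
rewrite e in h1.
apply: filterS2 h1 h2 => x [e1 [e2 e3]] [e4 [e5 e6]] mn.
by move: e1; rewrite e4 e2 e3 e5 e6 /cut mn => <-.
Qed.

Lemma ae_all_cuts (P : X -> Prop) : (forall n : nat, {ae nu, forall x, m x <= n%:R -> P x}) ->
  {ae nu, forall x, P x}.
Proof.
move=> h; have h' := ae_foralln h.
apply: filterS h' => x hx; apply: (hx (Num.truncn (m x)).+1).
by apply/ltW; exact: truncnS_gt.
Qed.

(** The rows of the inverse of the fundamental matrix, multiplied by [lam], are dual modes.
    They yield two linear equations for the two components of the solution, which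
    are solved by Cramer's rule with determinant [1]. *)
Lemma mild_propagator lam w T : (forall t, 0 <= bt t) -> propagator bt lam w -> 0 <= T ->
  {ae nu, forall x,
    (lam T)%:C * F (U T).1 x =
      ((w true (m x) T).1)%:C * F (U 0).1 x + ((w false (m x) T).1)%:C * F (U 0).2 x /\
    (lam T)%:C * F (U T).2 x =
      ((w true (m x) T).2)%:C * F (U 0).1 x + ((w false (m x) T).2)%:C * F (U 0).2 x}.
Proof.
move=> b0 hw T0; have hl := pr_lam hw; have [l0 [lp dl]] := hl.
(* [(Q2, - P2)] and [(- Q1, P1)] for the columns [(P1, Q1)], [(P2, Q2)]; the factor [lam]
   turns [- b] and [b] on the diagonal into [0] and [2 b]. *)
pose ka1 xi t := lam t * (w false xi t).2; pose ka2 xi t := - (lam t * (w false xi t).1).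
pose kb1 xi t := - (lam t * (w true xi t).2); pose kb2 xi t := lam t * (w true xi t).1.
have da : dual_mode bt ka1 ka2.
  move=> xi t; have [d1 d2] := pr_mode hw false xi t; split.
    by apply: is_deriv_eq (is_derivM (dl t) d2) _; rewrite /ka2; ring.
  by apply: is_deriv_eq (is_derivN (is_derivM (dl t) d1)) _; rewrite /ka1 /ka2; ring.
have db : dual_mode bt kb1 kb2.
  move=> xi t; have [d1 d2] := pr_mode hw true xi t; split.
    by apply: is_deriv_eq (is_derivN (is_derivM (dl t) d2)) _; rewrite /kb2; ring.
  by apply: is_deriv_eq (is_derivM (dl t) d1) _; rewrite /kb1 /kb2; ring.
have ma t : measurable_fun [set: R] (ka1 ^~ t) /\ measurable_fun [set: R] (ka2 ^~ t).
  split; first by apply: measurable_funM => //; exact: pr_meas2 hw _ _.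
  by apply: measurableT_comp => //; apply: measurable_funM => //; exact: pr_meas1 hw _ _.
have mb t : measurable_fun [set: R] (kb1 ^~ t) /\ measurable_fun [set: R] (kb2 ^~ t).
  split; last by apply: measurable_funM => //; exact: pr_meas1 hw _ _.
  by apply: measurableT_comp => //; apply: measurable_funM => //; exact: pr_meas2 hw _ _.
have bd j T' xi t : 0 <= t <= T' -> `|lam t * (w j xi t).1| <= lam T' ^+ 2 /\
     `|lam t * (w j xi t).2| <= lam T' ^+ 2.
  move=> /andP[t0 tT]; have [h1 h2] := propagator_le_lam j xi b0 hw t0.
  have hT := lam_ndecr b0 hl tT.
  by rewrite !normrM gtr0_norm//; split; apply: ler_pM; rewrite ?(ltW (lp _))//;
    [apply: le_trans h1 _|apply: le_trans h2 _].
have bda T' : exists M : R, forall (xi t : R), 0 <= t <= T' -> `|ka1 xi t| <= M /\ `|ka2 xi t| <= M.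
  exists (lam T' ^+ 2) => xi t ht; have [h1 h2] := bd false T' xi t ht.
  by rewrite /ka1 /ka2 normrN.
have bdb T' : exists M : R, forall (xi t : R), 0 <= t <= T' -> `|kb1 xi t| <= M /\ `|kb2 xi t| <= M.
  exists (lam T' ^+ 2) => xi t ht; have [h1 h2] := bd true T' xi t ht.
  by rewrite /kb1 /kb2 normrN.
apply: ae_all_cuts => n.
have Ea := dual_equation n%:R da T0 ma bda.
have Eb := dual_equation n%:R db T0 mb bdb.
apply: filterS2 Ea Eb => x ea eb mn.
have {}ea := ea mn; have {}eb := eb mn.
have det := propagator_det (m x) T hw.
move: ea eb; rewrite /ka1 /ka2 /kb1 /kb2 !(pr_init hw) l0 /= !(mulr0, mulr1, oppr0).
rewrite !(rmorph0, rmorph1, mul0r, mul1r, addr0, add0r) => <- <-.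
set P := (w true (m x) T).1; set Q := (w true (m x) T).2.
set P' := (w false (m x) T).1; set Q' := (w false (m x) T).2.
have det' : P%:C * Q'%:C - P'%:C * Q%:C = 1 :> R[i].
  by rewrite -!rmorphM -rmorphB /= det.
rewrite !rmorphN !rmorphM /=; split.
  by rewrite -[LHS]mul1r -det'; ring.
by rewrite -[LHS]mul1r -det'; ring.
Qed.

End MildPropagator.

(** * Completions *)

Lemma linear_map0 (K : pzRingType) (V W : lmodType K) (f : V -> W) : linear f -> f 0 = 0.
Proof.
move=> fl; have -> : (0 : V) = -1 *: 0 + 0 by rewrite scaler0 addr0.
by rewrite fl scaleN1r addNr.
Qed.

Section Completions.
Context {R : realType} {V : lmodType R[i]} {P : set V} {nrm : V -> R}.
Context {E : completeNormedModType R[i]} {iota : V -> E}.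
Hypothesis hE : is_completion P nrm iota.

Lemma completion_seq (e : E) : exists2 p : nat -> V,
  forall n, P (p n) & iota (p n) @[n --> \oo] --> e.
Proof.
have [_ _ dn] := hE.
have h (n : nat) : exists p, P p /\ rnorm (iota p - e) < n.+1%:R^-1.
  have [||y [By [p Pp py]]] := dn (ball e (n.+1%:R^-1)%:C).
  - exists e; apply: ballxx; rewrite ltcR invr_gt0 ltr0n//.
  - by apply: ball_open; rewrite ltcR invr_gt0 ltr0n.
  exists p => //; move: By; rewrite py -ball_normE /ball_ /= distrC normE ltcR.
  by [].
have [p hp] := choice h.
exists p => [n|]; first by have [] := hp n.
apply/rcvgP; apply: (squeeze_cvgr _ (cvg_cst 0) (@cvg_harmonic R)).
by apply: nearW => n; rewrite rnorm_ge0/= ltW//; have [] := hp n.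
Qed.

Hypothesis P_lin : forall (a : R[i]) x y, P x -> P y -> P (a *: x + y).

(** Applied to [J] and to the inclusion of [Eg] into [E], which are only known to be
    continuous extensions of linear maps. *)
Lemma completion_linear (G : normedModType R[i]) (T : E -> G) : continuous T ->
  (forall (a : R[i]) x y, P x -> P y ->
     T (iota (a *: x + y)) = a *: T (iota x) + T (iota y)) -> linear T.
Proof.
move=> cT Tl a e f.
have [p Pp pe] := completion_seq e; have [q Pq qf] := completion_seq f.
have [il _ _] := hE.
have h1 : T (iota (a *: p n + q n)) @[n --> \oo] --> T (a *: e + f).
  apply: continuous_cvg; first exact: cT.
  under eq_fun do rewrite il//.
  by apply: cvgD => //; exact: cvgZr.
have h2 : T (iota (a *: p n + q n)) @[n --> \oo] --> a *: T e + T f.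
  under eq_fun do rewrite Tl//.
  by apply: cvgD; [apply: cvgZr|]; apply: continuous_cvg => //; exact: cT.
exact: rcvg_unique h1 h2.
Qed.

Lemma completion_sub x y : P x -> P y -> iota (x - y) = iota x - iota y.
Proof.
have [il _ _] := hE => Px Py.
by rewrite addrC -scaleN1r il// scaleN1r addrC.
Qed.

End Completions.

Lemma cvg_of_increments (R : realType) (V : completeNormedModType R[i])
  (W : normedModType R[i]) (f : nat -> V) (g : nat -> W) (l : W) :
  (forall k n, rnorm (f k - f n) <= rnorm (g k - g n)) -> g n @[n --> \oo] --> l ->
  exists l' : V, f n @[n --> \oo] --> l'.
Proof.
move=> fg /rcvgP/cvgr0Pnorm_lt gl.
suff h : cvg (f n @[n --> \oo]) by exists (lim (f n @[n --> \oo])).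
apply: cauchy_cvg; apply/cauchyP => e e0.
have eE : e = (complex.Re e)%:C by apply: ge0_ReE; exact: ltW.
have [|K _ hK] := gl (complex.Re e / 2); first by rewrite divr_gt0// -ltcR -eE.
exists (f K); exists K => // n /= Kn.
rewrite -ball_normE /ball_ /= normE eE ltcR; apply: le_lt_trans (fg _ _) _.
have := hK n Kn; have := hK K (leqnn K); rewrite !ger0_norm ?rnorm_ge0// => h1 h2.
have := rnormD (g K - l) (l - g n); rewrite addrA subrK -(rnormN (l - _)) opprB; lra.
Qed.

(** * The dissipation coefficient *)

Section Coefficient.
Context {R : realType}.
Implicit Types (f b : R -> R) (t s h c k x : R).

Lemma japanese_ge t : 0 <= t -> t <= japanese t.
Proof.
move=> t0; rewrite /japanese -[leLHS]ger0_norm// -sqrtr_sqr ler_wsqrtr//.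
by rewrite lerDr ler01.
Qed.

Lemma japanese0 : japanese (0 : R) = 1.
Proof. by rewrite /japanese expr0n addr0 sqrtr1. Qed.

(** The difference quotients are bounded near [t]. *)
Lemma C1_halfline_continuous b b' : C1_halfline b b' -> {within `[0, +oo[, continuous b}.
Proof.
move=> [db _]; apply/subspace_continuousP => t.
rewrite /= in_itv/= andbT => t0.
have /cvgr_norm_lt h := db t t0.
have {h} := h (`|b' t| + 1); rewrite ltrDl ltr01 => /(_ isT) h.
have {h} : nbhs t [set s | s != t -> 0 <= s -> `|(s - t)^-1 * (b s - b t)| < `|b' t| + 1] by [].
move=> h; apply/cvgrPdist_lt => e e0.
suff hs : nbhs t [set s | 0 <= s -> `|b t - b s| < e].
  apply: (@filterS _ (nbhs t) _ _ _ _ hs) => s; rewrite /= in_itv/= andbT.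
  by move=> hs' s0; exact: hs'.
near=> s => s0.
have [->|st] := eqVneq s t; first by rewrite subrr normr0.
have hs : s != t -> 0 <= s -> `|(s - t)^-1 * (b s - b t)| < `|b' t| + 1 by near: s.
have {hs} := hs st s0; rewrite normrM normfV mulrC ltr_pdivrMr ?normr_gt0 ?subr_eq0// => hs.
rewrite distrC (lt_le_trans hs)//.
have p0 : 0 < `|b' t| + 1 by rewrite ltr_wpDl ?ltr01.
rewrite -ler_pdivlMl// distrC; near: s.
by apply: cvgr_dist_le; rewrite ?mulr_gt0 ?invr_gt0//; exact: cvg_id.
Unshelve. all: by end_near. Qed.

Lemma C1_halfline_derive b b' t : C1_halfline b b' -> 0 < t ->
  is_derive t 1 (fun s => b (Num.max s 0)) (b' t).
Proof.
move=> [db _] t0; apply: cvg_is_derive.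
have := db t (ltW t0) => h; apply: cvg_trans h.
have -> : Num.max t 0 = t by apply/max_idPl; exact: ltW.
move=> A hA.
have {hA} : nbhs t [set s | s != t -> 0 <= s -> A ((s - t)^-1 * (b s - b t))] by exact: hA.
move=> /nbhs_ballP[e /= e0 he].
apply/nbhs_ballP; exists (Num.min e t) => /=; first by rewrite lt_min e0.
move=> h /=; rewrite /ball /= sub0r normrN lt_min => /andP[h1 h2] h0.
have th0 : 0 <= t + h by move: h2; rewrite ltr_norml => /andP[? _]; lra.
have -> : Num.max (t + h) 0 = t + h by exact/max_idPl.
have := he (t + h); rewrite /ball /= opprD addrA subrr sub0r normrN addrAC subrr add0r.
by apply => //; rewrite -subr_eq0 addrAC subrr add0r.
Qed.

Lemma limsup_lt f c : (limf_esup (fun t => (f t)%:E) +oo%R < c%:E)%E ->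
  exists2 k, k < c & exists t0, forall t, t0 <= t -> f t <= k.
Proof.
move=> /ereal_inf_lt[_ [V [M [_ hM]] <-]] Vc.
have ub t : M < t -> ((f t)%:E <= ereal_sup ((fun t => (f t)%:E) @` V))%E.
  by move=> Mt; apply: ereal_sup_ubound; exists t => //; exact: hM.
case: (ereal_sup _) Vc ub => [k|//|] Vc ub.
  exists k; first by rewrite -lte_fin.
  by exists (M + 1) => t Mt; rewrite -lee_fin ub//; lra.
by have := ub (M + 1); rewrite ltrDl ltr01 leNgt ltNyr => /(_ isT).
Qed.

(** On the half-line the functions are extended by their value at [0], which keeps them
    continuous; derivatives are then needed for positive times only. *)
Lemma dissipation_clamp b b' C1 C2 : C1_halfline b b' -> (forall t, 0 <= t -> 0 <= b t) ->
  (forall t, 0 <= t -> `|b t| <= C1 * (japanese t)^-1) ->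
  (forall t, 0 <= t -> `|b' t| <= C2 * (japanese t) ^- 2) ->
  dissipation (fun t => b (Num.max t 0)) b' C1 C2.
Proof.
move=> hb b0 hC hC'.
have C10 : 0 <= C1 by have := hC 0 (lexx _); rewrite japanese0 invr1 mulr1; exact: le_trans.
have C20 : 0 <= C2.
  by have := hC' 0 (lexx _); rewrite japanese0 expr1n invr1 mulr1; exact: le_trans.
split.
- exact: clamp_continuous (C1_halfline_continuous hb).
- by move=> t; apply: b0; rewrite le_max lexx orbT.
- by move=> t t0; exact: C1_halfline_derive.
- move=> t t0; rewrite (_ : Num.max t 0 = t); last by apply/max_idPl; exact: ltW.
  apply: le_trans (hC t (ltW t0)) _; rewrite ler_wpM2l// lef_pV2 ?posrE//.
    exact/japanese_ge/ltW.
  exact: lt_le_trans t0 (japanese_ge (ltW t0)).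
- move=> t t0; apply: le_trans (hC' t (ltW t0)) _; rewrite ler_wpM2l//.
  have jt := japanese_ge (ltW t0); have j0 := lt_le_trans t0 jt.
  by rewrite lef_pV2 ?posrE ?exprn_gt0// lerXn2r ?nnegrE// ltW.
Qed.

Lemma non_critical_clamp b mu :
  (limf_esup (fun t => (t * b t)%:E) +oo%R < (2^-1)%:E)%E \/
  ((2^-1)%:E < limf_einf (fun t => (t * b t)%:E) +oo%R)%E ->
  (limf_esup (fun t => (t * b t)%:E) +oo%R < mu%:E)%E ->
  exists t0, non_critical (fun t => b (Num.max t 0)) mu t0.
Proof.
move=> hC /limsup_lt[k kmu [t1 h1]].
have bE t s : Num.max s 0 <= t -> b (Num.max t 0) = b t /\ s <= t.
  rewrite ge_max => /andP[st t0]; split => //.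
  by rewrite (_ : Num.max t 0 = t)//; exact/max_idPl.
have bmu s : t1 <= s -> forall t, Num.max s 0 <= t -> t * b (Num.max t 0) <= mu.
  move=> t1s t /bE[-> st]; apply: le_trans (h1 t (le_trans t1s st)) _; exact: ltW.
have mt1 s : t1 <= Num.max t1 s by rewrite le_max lexx.
have mt2 s : s <= Num.max t1 s by rewrite le_max lexx orbT.
case: hC => [/limsup_lt[k' k2 [t2 h2]]|].
  exists (Num.max (Num.max t1 t2) 0); split; first exact: bmu.
  left; exists k' => // t /bE[-> st]; apply: h2; exact: le_trans st.
rewrite /limf_einf lteNr => /limsup_lt[k' k2 [t2 h2]].
exists (Num.max (Num.max t1 t2) 0); split; first exact: bmu.
right; exists (- k') => [|t /bE[-> st]]; first by rewrite ltrNr.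
by rewrite lerNl; apply: h2; exact: le_trans st.
Qed.

Lemma lambda_prim b t : continuous (fun s => b (Num.max s 0)) -> 0 <= t ->
  lambda b t = expR (prim (fun s => b (Num.max s 0)) t).
Proof.
move=> cb t0; have [p0 dp] := primP cb; congr expR.
rewrite -[RHS]subr0 -[X in _ = _ - X]p0 -(integral_antiderivative t0 dp cb).
apply: eq_Rintegral => s; rewrite inE /= in_itv/= => /andP[s0 _].
by rewrite (_ : Num.max s 0 = s)//; exact/max_idPl.
Qed.

End Coefficient.

(** * The energy space *)

(** The component [true] is the first one, as for the columns of [propagator]. *)
Definition prj (T : Type) (i : bool) (p : T * T) : T := if i then p.1 else p.2.

Section EnergySpaces.
Context {R : realType} {H : completeNormedModType R[i]} (dot : {dot H for Num.conj}).
Hypothesis hdot : induces_norm dot.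
Context {L : uop H}.
Hypothesis L_lin : linear_op L.
Context {d : measure_display} {X : measurableType d}.
Context {nu : {measure set X -> \bar R}} {F : H -> X -> R[i]} {m : X -> R}.
Hypothesis hF : spectral_rep L nu F m.
Local Notation mulop := (@mulop R H d X nu F).
Local Notation rdot := (rdot dot).
Local Notation Im := complex.Im.
Implicit Types (u v k : H) (x y : X) (t r : R) (a : R[i]) (p q h : H * H).

(** Multiplication by [supp] is the orthogonal projection onto the complement of the kernel
    of [L]. *)
Definition supp x : R := if 0 < m x then 1 else 0.

Lemma bmeas_if (Q : X -> bool) (g : X -> R) (C : R) : measurable_fun [set: X] Q ->
  measurable_fun [set: X] g -> (forall x, Q x -> `|g x| <= C) ->
  bmeas (fun x => if Q x then g x else 0).
Proof.
move=> mQ mg gC; split; first exact: measurable_fun_ifT.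
exists `|C| => x; case: ifPn => Qx; last by rewrite normr0.
by apply: le_trans (ler_norm C); exact: gC.
Qed.

Lemma measurable_supp : measurable_fun [set: X] (fun x => 0 < m x).
Proof. by apply: measurable_fun_ltr => //; exact: sr_measurable hF. Qed.

Lemma bmeas_supp : bmeas supp.
Proof.
by apply: (@bmeas_if _ (fun=> 1) 1) => [||x _]; [exact: measurable_supp|by []|rewrite normr1].
Qed.

Lemma supp_ae u : mulop supp u = u -> {ae nu, forall x, m x = 0 -> F u x = 0}.
Proof.
move=> e; have := mulopP hF u bmeas_supp; rewrite e.
by apply: filterS => x ex mx; rewrite ex /supp mx ltxx mul0r.
Qed.

Lemma ae_supp u : {ae nu, forall x, m x = 0 -> F u x = 0} -> mulop supp u = u.
Proof.
move=> e; apply: (F_inj hF); apply: filterS2 (mulopP hF u bmeas_supp) e => x -> h.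
rewrite /supp; case: ifPn; first by rewrite mul1r.
by rewrite -leNgt => mx; rewrite h ?mulr0//; apply/eqP; rewrite eq_le mx (sr_ge0 hF).
Qed.

Lemma mulop_supp_lin a u v : mulop supp u = u -> mulop supp v = v ->
  mulop supp (a *: u + v) = a *: u + v.
Proof.
move=> eu ev; rewrite (mulop_add hF _ _ bmeas_supp) (mulop_scale hF _ _ bmeas_supp).
by rewrite eu ev.
Qed.

(** The part of [u] carried by [m = 0] lies in the kernel of [L]; being orthogonal to [u]
    and a projection of [u], it is [0]. *)
Lemma orth_ker_supp u : orth_ker dot L u -> mulop supp u = u.
Proof.
move=> ou; have bs := bmeas_supp.
pose q x := 1 + - supp x.
have bq : bmeas q by apply: bmeasD; [exact: bmeas_cst|exact: bmeasN].
have mq0 : (fun x => m x * q x) = (fun=> 0 * 0).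
  apply/funext => x; rewrite /q /supp mul0r; case: ifPn => [|h]; first by rewrite subrr mulr0.
  rewrite oppr0 addr0 mulr1; apply/eqP; rewrite eq_le (sr_ge0 hF) andbT leNgt//.
have bmq : bmeas (fun x => m x * q x) by rewrite mq0; exact: bmeas_cst.
have [dq Lq] := L_mulop hF u bq bmq.
have Lq0 : L (mulop q u) = 0.
  by rewrite Lq mq0 (mulop_cst hF) mul0r rmorph0 scale0r.
have qq : mulop q (mulop q u) = mulop q u.
  rewrite (mulop_comp hF _ bq bq); apply: mulop_ext => x.
  by rewrite /q /supp; case: ifP => _; rewrite ?(subrr, mulr0, oppr0, addr0, mulr1).
have r0 : rdot u (mulop q u) = 0 by rewrite /rdot (ou _ dq Lq0).
have q0 : mulop q u = 0.
  apply: rnorm0_eq0; apply/eqP; rewrite -sqrf_eq0 -(rdotE hdot).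
  by rewrite (mulop_sym hdot hF _ _ bq) qq r0.
have : u - mulop supp u = 0.
  rewrite -q0 (mulop_plus hF u (bmeas_cst 1) (bmeasN bs)) (mulop_cst hF) scale1r.
  congr (_ + _); have -> : (fun x => - supp x) = (fun x => -1 * supp x).
    by apply/funext => x; rewrite mulN1r.
  by rewrite -(mulop_scal hF)// rmorphN1 scaleN1r.
by move/eqP; rewrite subr_eq0 => /eqP.
Qed.

(** The real part of the inner product is treated with [mulop_sym]; the imaginary part is
    the real part for the vector multiplied by [- i]. *)
Lemma supp_orth_ker u : mulop supp u = u -> orth_ker dot L u.
Proof.
move=> su k dk Lk; have bs := bmeas_supp.
have k0 : mulop supp k = 0.
  apply: (F_eq0 hF); have h0 : {ae nu, forall x, F (L k) x = 0} by rewrite Lk; exact: F0 hF.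
  apply: filterS3 (mulopP hF k bs) (sr_mult hF dk) h0 => x -> -> h.
  rewrite /supp; case: ifPn => mx; last by rewrite mul0r.
  move/eqP: h; rewrite mulf_eq0 => /orP[|/eqP->]; last by rewrite mulr0.
  by move=> /eqP/complexI mx0; rewrite mx0 ltxx in mx.
have rd v : mulop supp v = v -> rdot v k = 0.
  move=> sv; rewrite -sv (mulop_sym hdot hF _ _ bs) k0.
  by rewrite rdotC -(scale0r (0 : H)) -(rmorph0 (real_complex R)) rdotZl mul0r.
have r1 := rd _ su.
(* The real part of [- i z] is the imaginary part of [z]. *)
have r2 : rdot (- 'i%C *: u) k = 0.
  by apply: rd; rewrite (mulop_scale hF _ _ bs) su.
move: r1 r2; rewrite /rdot linearZl_LR /=.
case: (dot u k) => z1 z2 /= ->; rewrite !(oppr0, mul0r, mulN1r, sub0r, opprK) => ->.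
by [].
Qed.

Lemma orth_ker_lin a u v : orth_ker dot L u -> orth_ker dot L v -> orth_ker dot L (a *: u + v).
Proof.
by move=> hu hv k dk Lk; rewrite linearDl linearZl_LR /= (hu k)// (hv k)// addr0; exact: mulr0.
Qed.

Lemma energy_data_lin a p q : energy_data dot L p -> energy_data dot L q ->
  energy_data dot L (a *: p + q).
Proof.
move=> [dp op] [dq oq]; split; first exact: (L_lin.2 a _ _ dp dq).1.
exact: orth_ker_lin.
Qed.

Context {E : completeNormedModType R[i]} {iota : H * H -> E}.
Hypothesis hE : is_completion (energy_data dot L) (energy_norm L) iota.
Context {J : E -> H * H}.
Hypothesis hJ : energy_identification dot L iota J.

Lemma J_linear : linear J.
Proof.
have [cJ Ji] := hJ; apply: (completion_linear hE) => // a p q Pp Pq.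
rewrite !Ji//; last exact: energy_data_lin.
by rewrite (L_lin.2 a _ _ Pp.1 Pq.1).2.
Qed.

Lemma J_sub (e f : E) : J (e - f) = J e - J f.
Proof. by rewrite addrC -scaleN1r J_linear scaleN1r addrC. Qed.

(** [J] is isometric on the data, hence everywhere by density and continuity. *)
Lemma J_norm (e : E) : norm2 (J e) = rnorm e.
Proof.
have [cJ Ji] := hJ; have [p Pp pe] := completion_seq hE e; have [_ inrm _] := hE.
have h1 : norm2 (J (iota (p n))) @[n --> \oo] --> norm2 (J e).
  by apply: (norm2_cvg hdot); apply: continuous_cvg => //; exact: cJ.
have h2 : norm2 (J (iota (p n))) @[n --> \oo] --> rnorm e.
  have -> : (fun n => norm2 (J (iota (p n)))) = (fun n => rnorm (iota (p n))).
    by apply/funext => n; rewrite Ji// inrm.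
  exact: rnorm_cvg.
exact: (cvg_unique _ h1 h2).
Qed.

Lemma J_inj (e f : E) : J e = J f -> e = f.
Proof.
move=> ef; apply/eqP; rewrite -subr_eq0; apply/eqP/rnorm0_eq0.
by rewrite -J_norm J_sub ef subrr /norm2 rnorm0 expr0n addr0 sqrtr0.
Qed.

(** Truncating [f.1] to [m >= 1 / t] allows to divide by [m], which gives genuine data; their
    images form a Cauchy sequence because [J] is isometric. *)
Lemma J_range (f : H * H) : mulop supp f.1 = f.1 -> exists e, J e = f.
Proof.
move=> sf; have [cJ Ji] := hJ; have [il inrm _] := hE.
have mm := sr_measurable hF.
pose Q t x := 1 <= t * m x.
have mQ t : measurable_fun [set: X] (Q t).
  by apply: measurable_fun_ler => //; exact: measurable_funM.
pose r t x : R := if Q t x then 1 else 0.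
(* The multiplier [q t] inverts [m] where [1 <= t m]. *)
pose q t x : R := if Q t x then m x `^ (-1) else 0.
have mpos t x : 0 <= t -> Q t x -> 0 < m x.
  move=> t0 h; rewrite lt_neqAle (sr_ge0 hF) andbT eq_sym; apply/negP => /eqP e.
  by move: h; rewrite /Q e mulr0 ler10.
have br t : bmeas (r t).
  by apply: (@bmeas_if _ (fun=> 1) 1) => // x _; rewrite normr1.
have bq t : 0 <= t -> bmeas (q t).
  move=> t0; apply: (@bmeas_if _ _ t) => //.
    by apply: (measurableT_comp (measurable_powR _)).
  move=> x Qx; have m0 := mpos _ _ t0 Qx.
  by rewrite ger0_norm ?powR_ge0// powR_inv1 ?(ltW m0)// -[leLHS]mul1r ler_pdivrMr.
have mq t : 0 <= t -> (fun x => m x * q t x) = r t.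
  move=> t0; apply/funext => x; rewrite /q /r; case: ifPn => Qx; last by rewrite mulr0.
  have m0 := mpos _ _ t0 Qx.
  by rewrite powR_inv1 ?(ltW m0)// mulfV// gt_eqF.
pose s n : R := n%:R.
have s0 n : 0 <= s n by rewrite ler0n.
pose p (n : nat) := (mulop (q (s n)) f.1, f.2).
have Lp n : udom L (p n).1 /\ L (p n).1 = mulop (r (s n)) f.1.
  by have := @L_mulop _ _ _ _ _ _ _ _ hF (q (s n)) f.1 (bq _ (s0 n)); rewrite mq//; exact.
have Pp n : energy_data dot L (p n).
  split; first exact: (Lp n).1.
  apply: supp_orth_ker; rewrite (mulop_comp hF _ bmeas_supp (bq _ (s0 n))).
  rewrite /p /=; apply: mulop_ext => x; rewrite /q; case: ifPn => [Qx|_]; last by rewrite mulr0.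
  by rewrite /supp (mpos _ _ (s0 n) Qx) mul1r.
have cr : mulop (r (s n)) f.1 @[n --> \oo] --> f.1.
  apply/rcvgP; have h : rnorm (mulop (fun x => r t x - supp x) f.1) @[t --> +oo] --> (0 : R).
    apply: (@mulop_dominated _ _ _ _ _ _ _ _ hF _ f.1 1).
    - move=> t; apply: measurable_funB; [exact: (br t).1|exact: bmeas_supp.1].
    - move=> t x t0; rewrite /r /supp; case: ifPn => Qx; first by rewrite (mpos _ _ t0 Qx) subrr normr0.
      by case: ifP => _; rewrite !(sub0r, subr0, normrN, normr0, normr1) ?ler01.
    - move=> x; rewrite /supp; case: ifPn => mx.
        apply: cvg_near_cst; near=> t.
        rewrite /r (_ : Q t x = true) ?subrr// /Q -ler_pdivrMr// mul1r.
        by near: t; apply: nbhs_pinfty_ge; exact: num_real.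
      apply: cvg_near_cst; near=> t.
      rewrite /r (_ : Q t x = false) ?subr0//; apply/negP => /mpos h.
      by move/negP: mx; apply; apply: h; near: t; apply: nbhs_pinfty_ge; exact: num_real.
  have -> : (fun n => rnorm (mulop (r (s n)) f.1 - f.1)) =
            (fun n => rnorm (mulop (fun x => r (s n) x - supp x) f.1)).
    by apply/funext => n; rewrite -{2}sf (mulop_sub hF _ (br _) bmeas_supp).
  by apply: cvg_comp h; exact: cvgr_idn.
have [|e he] := @cvg_of_increments R E H (fun n => iota (p n)) _ _ _ cr.
  move=> k n; rewrite -J_norm J_sub !Ji// (Lp k).2 (Lp n).2 /norm2 /= subrr rnorm0.
  by rewrite expr0n addr0 sqrtr_sqr ger0_norm// rnorm_ge0.
exists e; have h1 : J (iota (p n)) @[n --> \oo] --> J e.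
  by apply: continuous_cvg => //; exact: cJ.
have h2 : J (iota (p n)) @[n --> \oo] --> f.
  rewrite (surjective_pairing f).
  have -> : (fun n => J (iota (p n))) = (fun n => (mulop (r (s n)) f.1, f.2)).
    by apply/funext => n; rewrite Ji// (Lp n).2.
  by apply: cvg_pair => //; exact: cvg_cst.
exact: (@rcvg_unique _ (H * H)%type _ _ _ _ _ _ h1 h2).
Unshelve. all: by end_near. Qed.

(** * The weighted energy space *)

Context {N g : R}.
Hypotheses (N0 : 0 < N) (g0 : 0 <= g).
Context {Eg : completeNormedModType R[i]} {iotag : H * H -> Eg}.
Local Notation data_g := (energy_data_g dot L nu F m g).
Hypothesis hEg : is_completion data_g (energy_norm_g nu F m N g) iotag.
Context {inc : Eg -> E}.
Hypothesis hinc : extends_identity data_g iotag iota inc.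
Implicit Type z : Eg.

Lemma range_pow_lin a u v : range_pow nu F m g u -> range_pow nu F m g v ->
  range_pow nu F m g (a *: u + v).
Proof.
move=> [w ew] [w' ew']; exists (a *: w + w').
have h1 := ae_and (F_lin hF a u v) (F_lin hF a w w').
by apply: filterS3 h1 ew ew' => x [-> ->] -> ->; rewrite mulrDr mulrCA.
Qed.

Lemma energy_data_g_lin a p q : data_g p -> data_g q -> data_g (a *: p + q).
Proof.
move=> [dp rp op rp2 op2] [dq rq oq rq2 oq2]; split.
- exact: (L_lin.2 a _ _ dp dq).1.
- exact: range_pow_lin.
- exact: orth_ker_lin.
- exact: range_pow_lin.
- exact: orth_ker_lin.
Qed.

Lemma energy_data_g_sub p : data_g p -> energy_data dot L p.
Proof. by move=> [? _ ? _ _]; split. Qed.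

Lemma inc_linear : linear inc.
Proof.
have [cinc hi] := hinc; have [il _ _] := hE.
apply: (completion_linear hEg) => // a p q Pp Pq.
rewrite !hi//; last exact: energy_data_g_lin.
by rewrite il//; exact: energy_data_g_sub.
Qed.

(** The inverse of the weight of component [j].  Unlike the weight it is bounded, so it
    defines an operator on [H]. *)
Definition reg (j : bool) x : R := (Num.min (m x) N) `^ (if j then g + 1 else g).

Lemma reg_exp_ge0 (j : bool) : 0 <= (if j then g + 1 else g).
Proof. by case: j => //; rewrite addr_ge0. Qed.

Lemma bm_ge0 x : 0 <= Num.min (m x) N.
Proof. by rewrite le_min (sr_ge0 hF) ltW. Qed.

Lemma bm_gt0 x : 0 < m x -> 0 < Num.min (m x) N.
Proof. by move=> mx; rewrite lt_min mx. Qed.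

Lemma bm_meas : measurable_fun [set: X] (fun x => Num.min (m x) N).
Proof. by apply: measurable_minr => //; exact: sr_measurable hF. Qed.

Lemma bmeas_reg j : bmeas (reg j).
Proof.
split; first exact: (measurableT_comp (measurable_powR _) bm_meas).
exists (N `^ (if j then g + 1 else g)) => x; rewrite ger0_norm ?powR_ge0//.
by apply: ge0_ler_powR; rewrite ?reg_exp_ge0 ?nnegrE ?bm_ge0 ?(ltW N0)// ge_min lexx orbT.
Qed.

(** The pair [h] whose norm is the weighted norm of the data [p]. *)
Definition weighted p h : Prop := {ae nu, forall x,
  F h.1 x = (Num.min (m x) N `^ (- g - 1) * m x)%:C * F p.1 x /\
  F h.2 x = (Num.min (m x) N `^ (- g))%:C * F p.2 x}.

Lemma weighted_lin a p q h h' : weighted p h -> weighted q h' ->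
  weighted (a *: p + q) (a *: h + h').
Proof.
move=> w1 w2.
have l1 := ae_and (F_lin hF a p.1 q.1) (F_lin hF a p.2 q.2).
have l2 := ae_and (F_lin hF a h.1 h'.1) (F_lin hF a h.2 h'.2).
apply: filterS3 (ae_and l1 l2) w1 w2 => x [[e1 e2] [e3 e4]] [e5 e6] [e7 e8] /=.
by rewrite e1 e2 e3 e4 e5 e6 e7 e8; split; ring.
Qed.

Lemma L2norm_ae u (f : X -> R[i]) : cmeasurable f -> {ae nu, forall x, F u x = f x} ->
  fine (L2norm nu f) = rnorm u.
Proof.
move=> mf uf; have e : L2sq nu f = (rnorm u ^+ 2)%:E.
  by rewrite -(L2sq_ae (F_meas hF u) mf uf) (F_norm hF).
have -> : (L2norm nu f = (L2sq nu f) `^ 2^-1)%E.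
  by rewrite L2sqE -poweRrM mulfV ?pnatr_eq0// poweRe1// Lnorm_ge0.
by rewrite e poweR_EFin /= powR12_sqrt ?sqr_ge0// sqrtr_sqr ger0_norm// rnorm_ge0.
Qed.

Lemma weighted_norm p h : weighted p h -> energy_norm_g nu F m N g p = norm2 h.
Proof.
move=> w; rewrite /energy_norm_g /norm2.
have mm := sr_measurable hF.
have mp r : measurable_fun [set: X] (fun x => Num.min (m x) N `^ r).
  exact: (measurableT_comp (measurable_powR _) bm_meas).
rewrite (@L2norm_ae h.1).
- rewrite (@L2norm_ae h.2)//; first by apply: cmeasurableM (F_meas hF _).
  by apply: filterS w => x [].
- by apply: cmeasurableM (F_meas hF _); exact: measurable_funM.
- by apply: filterS w => x [].
Qed.

(** Where [m <= N] the weight is a power of [m] and is compensated by the ranges of the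
    powers of [L]; where [N < m] it is bounded. *)
Lemma weighted_exists p : data_g p -> exists h, weighted p h.
Proof.
move=> [dp [w1 e1] op [w2 e2] op2]; have mm := sr_measurable hF.
pose lo x : R := if 0 < m x <= N then 1 else 0.
pose hi r x : R := if N < m x then N `^ r else 0.
have blo : bmeas lo.
  apply: (@bmeas_if _ (fun=> 1) 1) => [||x _]; rewrite ?normr1//.
  by apply: measurable_and; [exact: measurable_fun_ltr|exact: measurable_fun_ler].
have bhi r : bmeas (hi r).
  by apply: (@bmeas_if _ (fun=> N `^ r) `|N `^ r|) => //; exact: measurable_fun_ltr.
exists (mulop lo w1 + mulop (hi (- g - 1)) (L p.1), mulop lo w2 + mulop (hi (- g)) p.2).
have s2 := supp_ae (orth_ker_supp op2).
have a1 := ae_and (F_add hF (mulop lo w1) (mulop (hi (- g - 1)) (L p.1)))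
  (F_add hF (mulop lo w2) (mulop (hi (- g)) p.2)).
have a2 := ae_and (ae_and (mulopP hF w1 blo) (mulopP hF (L p.1) (bhi (- g - 1))))
  (ae_and (mulopP hF w2 blo) (mulopP hF p.2 (bhi (- g)))).
have a3 := ae_and (ae_and e1 e2) (ae_and s2 (sr_mult hF dp)).
apply: filterS3 a1 a2 a3 => x [E1 E2] [[E3 E4] [E5 E6]] [[E7 E8] [E9 E10]] /=.
rewrite E1 E2 E3 E4 E5 E6 E10 /lo /hi.
case: (ltP 0 (m x)) => mx /=; last first.
  have mx0 : m x = 0 by apply/eqP; rewrite eq_le mx (sr_ge0 hF).
  by rewrite mx0 ltNge (ltW N0) /= (E9 mx0) !(mulr0, mul0r, addr0).
have mx' : m x != 0 by rewrite gt_eqF.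
case: (leP (m x) N) => mN /=; rewrite !(mul0r, mul1r, add0r, addr0); last first.
  by rewrite rmorphM mulrA.
rewrite E7 E8 !mulrA -!rmorphM /= powRN.
have mg : m x `^ g != 0 by rewrite gt_eqF// powR_gt0.
have -> : m x `^ (- g - 1) = (m x `^ g)^-1 * (m x)^-1.
  by rewrite powRD ?mx' ?implybT// powRN powR_inv1// ltW.
by rewrite mulVf// mul1r -mulrA mulrA mulfVK// mulVf// mul1r.
Qed.

(** Elements of the completion have no weighted components of their own; instead, [h] yields
    [J (inc z)] after multiplication by the inverse weights. *)
Definition represents (z : Eg) h : Prop :=
  [/\ mulop (reg true) h.1 = (J (inc z)).1, mulop (reg false) h.2 = (J (inc z)).2,
      mulop supp h.1 = h.1 & mulop supp h.2 = h.2].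

Lemma weighted_represents p h : data_g p -> weighted p h -> represents (iotag p) h.
Proof.
move=> Pp w; have [dp _ op _ op2] := Pp.
have [cinc hi] := hinc; have [cJ Ji] := hJ.
have s2 := supp_ae (orth_ker_supp op2).
rewrite /represents hi// Ji ?energy_data_g_sub//=; split.
- apply/esym/(mulop_unique hF); first exact: bmeas_reg.
  apply: filterS2 w (sr_mult hF dp) => x [-> _] ->; rewrite mulrA -rmorphM /=.
  case: (ltP 0 (m x)) => mx; last first.
    have -> : m x = 0 by apply/eqP; rewrite eq_le mx (sr_ge0 hF).
    by rewrite !mulr0.
  rewrite mulrA -powRD; last by rewrite (gt_eqF (bm_gt0 mx)) implybT.
  by rewrite (_ : g + 1 + (- g - 1) = 0) ?powRr0 ?mul1r//; ring.
- apply/esym/(mulop_unique hF); first exact: bmeas_reg.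
  apply: filterS2 w s2 => x [_ ->] s0; rewrite mulrA -rmorphM /=.
  case: (ltP 0 (m x)) => mx; last first.
    by rewrite s0 ?mulr0//; apply/eqP; rewrite eq_le mx (sr_ge0 hF).
  rewrite -powRD; last by rewrite (gt_eqF (bm_gt0 mx)) implybT.
  by rewrite subrr powRr0 mul1r.
- apply: (ae_supp); apply: filterS w => x [-> _] ->.
  by rewrite mulr0 mul0r.
- apply: (ae_supp); apply: filterS2 w s2 => x [_ ->] s0 mx.
  by rewrite s0// mulr0.
Qed.

Lemma represents_lin a z z' h h' : represents z h -> represents z' h' ->
  represents (a *: z + z') (a *: h + h').
Proof.
move=> [r1 r2 r3 r4] [s1 s2 s3 s4]; rewrite /represents inc_linear (J_linear).
by split => /=; rewrite ?(mulop_supp_lin)// (mulop_add hF) ?(mulop_scale hF)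
  ?r1 ?r2 ?s1 ?s2//; exact: bmeas_reg.
Qed.

Lemma reg_inj j u : mulop (reg j) u = 0 -> mulop supp u = u -> u = 0.
Proof.
move=> r0 su; apply: (F_eq0 hF).
have e0 : {ae nu, forall x, F (mulop (reg j) u) x = 0} by rewrite r0; exact: F0 hF.
apply: filterS3 (mulopP hF u (bmeas_reg j)) e0 (supp_ae su) => x -> h s0.
case: (ltP 0 (m x)) => mx; last by apply: s0; apply/eqP; rewrite eq_le mx (sr_ge0 hF).
move/eqP: h; rewrite mulf_eq0 => /orP[/eqP/complexI h|/eqP//].
by have := powR_gt0 (if j then g + 1 else g) (bm_gt0 mx); rewrite -/(reg j x) h ltxx.
Qed.

Lemma represents0 h : represents 0 h -> h = 0.
Proof.
rewrite /represents (linear_map0 inc_linear) (linear_map0 (J_linear)) /=.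
by case: h => h1 h2 [/= r1 r2 r3 r4]; rewrite (reg_inj r1 r3) (reg_inj r2 r4).
Qed.

(** The weighted data of an approximating sequence form a Cauchy sequence in [H * H],
    because their norms are those of the completion.  Only bounded multipliers occur
    in the relation between [h] and [z], so that it passes to the limit. *)
Lemma represents_exists z : exists2 h, represents z h & norm2 h = rnorm z.
Proof.
have [cinc hi] := hinc; have [cJ Ji] := hJ; have [il inrm _] := hEg.
have [p Pp pz] := completion_seq hEg z.
have /choice[h hw] n : exists h, weighted (p n) h by exact: weighted_exists.
have sub (i n : nat) : weighted (p i - p n) (h i - h n).
  have := weighted_lin (-1) (hw n) (hw i).
  by rewrite !scaleN1r ![- _ + _]addrC.
have inc_sub (i n : nat) : norm2 (h i - h n) = rnorm (iotag (p i) - iotag (p n)).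
  rewrite -(completion_sub hEg)// -(weighted_norm (sub i n)) inrm//.
  by rewrite addrC -scaleN1r; exact: energy_data_g_lin.
have [l1 hl1] : exists l : H, (h n).1 @[n --> \oo] --> l.
  apply: (cvg_of_increments _ pz) => i n; rewrite -inc_sub.
  exact: (norm2_fst (h i - h n)).
have [l2 hl2] : exists l : H, (h n).2 @[n --> \oo] --> l.
  apply: (cvg_of_increments _ pz) => i n; rewrite -inc_sub.
  exact: (norm2_snd (h i - h n)).
have lim g' (f : nat -> H) l : bmeas g' -> f n @[n --> \oo] --> l ->
    mulop g' (f n) @[n --> \oo] --> mulop g' l.
  move=> bg /rcvgP fl; apply/rcvgP; have [C gC] := bg.2.
  have hl : C * rnorm (f n - l) @[n --> \oo] --> C * 0.
    by apply: cvgM fl; exact: cvg_cst.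
  rewrite mulr0 in hl; apply: (squeeze_cvgr _ (cvg_cst 0) hl).
  apply: nearW => n; rewrite rnorm_ge0/= -(mulop_opp hF _ bg) -(mulop_add hF _ _ bg).
  exact: (mulop_norm hF).
have jlim : J (inc (iotag (p n))) @[n --> \oo] --> J (inc z).
  apply: continuous_cvg; first exact: cJ.
  by apply: continuous_cvg => //; exact: cinc.
have rep n := weighted_represents (Pp n) (hw n).
exists (l1, l2).
  split => /=.
  - apply: (rcvg_unique (lim _ _ _ (bmeas_reg true) hl1)).
    have -> : (fun n => mulop (reg true) (h n).1) = (fun n => (J (inc (iotag (p n)))).1).
      by apply/funext => n; have [] := rep n.
    by apply: cvg_comp jlim _; exact: cvg_fst.
  - apply: (rcvg_unique (lim _ _ _ (bmeas_reg false) hl2)).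
    have -> : (fun n => mulop (reg false) (h n).2) = (fun n => (J (inc (iotag (p n)))).2).
      by apply/funext => n; have [] := rep n.
    by apply: cvg_comp jlim _; exact: cvg_snd.
  - apply: (rcvg_unique (lim _ _ _ (bmeas_supp) hl1)).
    have -> : (fun n => mulop supp (h n).1) = (fun n => (h n).1).
      by apply/funext => n; have [] := rep n.
    by [].
  - apply: (rcvg_unique (lim _ _ _ (bmeas_supp) hl2)).
    have -> : (fun n => mulop supp (h n).2) = (fun n => (h n).2).
      by apply/funext => n; have [] := rep n.
    by [].
have hl : h n @[n --> \oo] --> (l1, l2).
  have -> : h = fun n => ((h n).1, (h n).2) by apply/funext => n; rewrite -surjective_pairing.
  exact: cvg_pair.
apply: (cvg_unique _ (norm2_cvg hdot hl)) => //.
have -> : (fun n => norm2 (h n)) = (fun n => rnorm (iotag (p n))).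
  by apply/funext => n; rewrite inrm// (weighted_norm (hw n)).
exact: rnorm_cvg.
Qed.

(** * The wave operator *)

Context {bt lam : R -> R} {w : bool -> R -> R -> R * R}.
Hypothesis hw : propagator bt lam w.
Context {Z : bool -> R -> R * R} {C : R}.
Hypothesis Zm : forall i j, measurable_fun [set: R] (fun xi => prj i (Z j xi)).
Hypothesis C0 : 0 <= C.
Hypothesis wC : forall i j (xi t : R), 0 < xi -> 0 <= t ->
  `|prj i (w j xi t)| <= C * weight N g j xi.
Hypothesis ZC : forall i j (xi : R), 0 < xi -> `|prj i (Z j xi)| <= C * weight N g j xi.
Hypothesis Zdet : forall xi : R, 0 < xi ->
  (Z true xi).1 * (Z false xi).2 - (Z false xi).1 * (Z true xi).2 = 1.
Hypothesis Zlim : forall i j (xi : R), 0 < xi ->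
  prj i (w j xi t) - (prj i (rotation true xi t) * (Z j xi).1
                      + prj i (rotation false xi t) * (Z j xi).2) @[t --> +oo] --> 0.

(** A multiplier that is singular where [m] is small becomes bounded when it is applied
    after the inverse weight. *)
Definition regularized (c : R -> R) j x : R := supp x * (c (m x) * reg j x).

Lemma regularized_le (c : R -> R) (M : R) j x : 0 <= M ->
  (forall xi : R, 0 < xi -> `|c xi| <= M * weight N g j xi) -> `|regularized c j x| <= M.
Proof.
move=> M0 cM; rewrite /regularized /supp; case: ifPn => mx; last by rewrite mul0r normr0.
rewrite mul1r normrM (ger0_norm (powR_ge0 _ _)).
apply: le_trans (ler_wpM2r (powR_ge0 _ _) (cM _ mx)) _.
have m0 : Num.min (m x) N `^ (if j then g + 1 else g) != 0.
  by rewrite gt_eqF// powR_gt0// lt_min mx.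
by rewrite /weight powRN mulrAC -mulrA mulfV// mulr1.
Qed.

Lemma bmeas_regularized (c : R -> R) (M : R) j : measurable_fun [set: R] c -> 0 <= M ->
  (forall xi : R, 0 < xi -> `|c xi| <= M * weight N g j xi) -> bmeas (regularized c j).
Proof.
move=> mc M0 cM; split; last by exists M => x; exact: regularized_le.
apply: measurable_funM; first exact: (bmeas_supp).1.
apply: measurable_funM; last exact: (bmeas_reg j).1.
exact: measurableT_comp mc (sr_measurable hF).
Qed.

Definition wave_mult i j := regularized (fun xi => prj i (Z j xi)) j.

Lemma bmeas_wave i j : bmeas (wave_mult i j).
Proof. exact: bmeas_regularized (Zm i j) C0 (@ZC i j). Qed.

Lemma wave_mult_le i j x : `|wave_mult i j x| <= C.
Proof. exact: regularized_le C0 (@ZC i j). Qed.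

(** The limit matrix applied to [J (inc z)], in terms of the representative [h] of [z]. *)
Definition wave_map h : H * H :=
  (mulop (wave_mult true true) h.1 + mulop (wave_mult true false) h.2,
   mulop (wave_mult false true) h.1 + mulop (wave_mult false false) h.2).

Lemma wave_map_lin a h h' : wave_map (a *: h + h') = a *: wave_map h + wave_map h'.
Proof.
have B := bmeas_wave.
rewrite /wave_map /= !(mulop_add hF _ _ (B _ _)) !(mulop_scale hF _ _ (B _ _)).
congr pair; rewrite /= scalerDr; rewrite -!addrA; congr (_ + _); by rewrite addrCA.
Qed.

Lemma wave_map_supp h : mulop supp (wave_map h).1 = (wave_map h).1.
Proof.
have B := bmeas_wave; have bs := bmeas_supp.
rewrite /= (mulop_add hF _ _ bs) !(mulop_comp hF _ bs (B _ _)); congr (_ + _);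
by apply: mulop_ext => x; rewrite /wave_mult /regularized /supp; case: ifP; rewrite ?(mul0r, mul1r).
Qed.

Lemma wave_map_norm h : norm2 (wave_map h) <= 4 * C * norm2 h.
Proof.
have B i j u : rnorm (mulop (wave_mult i j) u) <= C * rnorm u.
  by apply: (mulop_norm hF); [exact: bmeas_wave|exact: wave_mult_le].
have h1 := ler_wpM2l C0 (norm2_fst h); have h2 := ler_wpM2l C0 (norm2_snd h).
have c i := le_trans (rnormD _ _) (lerD (B i true h.1) (B i false h.2)).
apply: le_trans (norm2_le _) _; apply: le_trans (lerD (c true) (c false)) _.
by move: h1 h2; move: (C * rnorm h.1) (C * rnorm h.2) => r s; rewrite -mulrA; lra.
Qed.

(** The determinant of the limit matrix is [1] and the inverse weights do not vanish where
    [0 < m]. *)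
Lemma wave_map_inj h : mulop supp h.1 = h.1 -> mulop supp h.2 = h.2 ->
  wave_map h = 0 -> h = 0.
Proof.
case: h => h1 h2 /= s1 s2; rewrite /wave_map /= => -[e1 e2].
have B := bmeas_wave.
have z1 : {ae nu, forall x, F (mulop (wave_mult true true) h1 + mulop (wave_mult true false) h2) x = 0}.
  by rewrite e1; exact: F0 hF.
have z2 : {ae nu, forall x, F (mulop (wave_mult false true) h1 + mulop (wave_mult false false) h2) x = 0}.
  by rewrite e2; exact: F0 hF.
have i1 := ae_and (mulopP hF h1 (B true true)) (mulopP hF h2 (B true false)).
have i2 := ae_and (mulopP hF h1 (B false true)) (mulopP hF h2 (B false false)).
have a1 := F_add hF (mulop (wave_mult true true) h1) (mulop (wave_mult true false) h2).
have a2 := F_add hF (mulop (wave_mult false true) h1) (mulop (wave_mult false false) h2).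
have s := ae_and (supp_ae s1) (supp_ae s2).
have k : {ae nu, forall x, F h1 x = 0 /\ F h2 x = 0}.
  apply: filterS3 (ae_and z1 z2) (ae_and (ae_and i1 i2) (ae_and a1 a2)) s.
  move=> x [Z1 Z2] [[[I1 I2] [I3 I4]] [A1 A2]] [S1 S2].
  case: (ltP 0 (m x)) => mx; last first.
    have mx0 : m x = 0 by apply/eqP; rewrite eq_le mx (sr_ge0 hF).
    by split; [exact: S1|exact: S2].
  move: A1 A2; rewrite Z1 Z2 I1 I2 I3 I4 /wave_mult /regularized /supp mx !mul1r.
  have := Zdet mx; rewrite /prj /=.
  case: (Z true (m x)) => z11 z21; case: (Z false (m x)) => z12 z22 /= det.
  rewrite !rmorphM /= => E1 E2.
  have det' : z11%:C * z22%:C - z12%:C * z21%:C = 1 :> R[i].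
    by rewrite -!rmorphM -rmorphB /= det.
  have r0 j : (reg j x)%:C != 0 :> R[i].
    by apply/eqP => /complexI/eqP; rewrite gt_eqF// powR_gt0// lt_min mx.
  split; [apply: (mulfI (r0 true))|apply: (mulfI (r0 false))]; rewrite mulr0 -[LHS]mul1r -det'.
    transitivity (z22%:C * (z11%:C * (reg true x)%:C * F h1 x + z12%:C * (reg false x)%:C * F h2 x)
      - z12%:C * (z21%:C * (reg true x)%:C * F h1 x + z22%:C * (reg false x)%:C * F h2 x)).
      by ring.
    by rewrite -E1 -E2 !mulr0 subrr.
  transitivity (z11%:C * (z21%:C * (reg true x)%:C * F h1 x + z22%:C * (reg false x)%:C * F h2 x)
    - z21%:C * (z11%:C * (reg true x)%:C * F h1 x + z12%:C * (reg false x)%:C * F h2 x)).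
    by ring.
  by rewrite -E1 -E2 !mulr0 subrr.
by congr pair; apply: (F_eq0 hF); apply: filterS k => x [].
Qed.

Lemma represents_unique z h h' : represents z h -> represents z h' -> h = h'.
Proof.
move=> rh rh'; have := represents_lin (-1) rh' rh.
rewrite scaleN1r addNr => /(represents0).
by rewrite scaleN1r addrC => /eqP; rewrite subr_eq0 => /eqP.
Qed.

(** The wave operator is defined through its graph, because [h] exists but is not given as a
    function of [z]. *)
Definition wave_graph z (e : E) : Prop := exists2 h, represents z h & J e = wave_map h.

Lemma wave_graph_fun z e e' : wave_graph z e -> wave_graph z e' -> e = e'.
Proof.
move=> [h rh eh] [h' rh' eh']; apply: (J_inj).
by rewrite eh eh' (represents_unique rh rh').
Qed.

Definition wave z : E := xget 0 [set e | wave_graph z e].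

Lemma waveP z : wave_graph z (wave z).
Proof.
apply: (@xgetPex _ 0 [set e | wave_graph z e]).
have [h rh _] := represents_exists z.
have [e he] := J_range (wave_map_supp h).
by exists e, h.
Qed.

Lemma wave_linear : linear wave.
Proof.
move=> a z z'; apply: wave_graph_fun (waveP _) _.
have [h rh eh] := waveP z; have [h' rh' eh'] := waveP z'.
exists (a *: h + h'); first exact: (represents_lin).
by rewrite (J_linear) eh eh' wave_map_lin.
Qed.

Lemma represents_rnorm z h : represents z h -> norm2 h = rnorm z.
Proof.
move=> rh; have [h' rh' <-] := represents_exists z.
by rewrite (represents_unique rh rh').
Qed.

Lemma wave_bounded z : rnorm (wave z) <= 4 * C * rnorm z.
Proof.
have [h rh eh] := waveP z.
by rewrite -(J_norm) eh -(represents_rnorm rh) wave_map_norm.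
Qed.

Lemma wave_ker z : wave z = 0 -> z = 0.
Proof.
move=> z0; have [h rh] := waveP z; rewrite z0 (linear_map0 (J_linear)) => eh.
have [_ _ s1 s2] := rh; apply: rnorm0_eq0; rewrite -(represents_rnorm rh).
by rewrite (wave_map_inj s1 s2 (esym eh)) /norm2 rnorm0 expr0n addr0 sqrtr0.
Qed.

(** The distance between the damped mode and the free mode with the limit matrix applied to
    its data, regularized. *)
Definition error_mult i t j := regularized (fun xi => prj i (w j xi t) -
  (prj i (rotation true xi t) * (Z j xi).1 + prj i (rotation false xi t) * (Z j xi).2)) j.

Lemma measurable_prj i j t : measurable_fun [set: R] (fun xi => prj i (w j xi t)).
Proof. by case: i; [exact: pr_meas1 hw j t|exact: pr_meas2 hw j t]. Qed.

Lemma measurable_prj_rotation i j t :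
  measurable_fun [set: R] (fun xi => prj i (rotation j xi t)).
Proof.
by case: i; [exact: (pr_meas1 rotation_propagator)|exact: (pr_meas2 rotation_propagator)].
Qed.

Lemma prj_rotation_le i j (xi t : R) : `|prj i (rotation j xi t)| <= 1.
Proof.
by case: i; case: j; rewrite /rotation /prj /= ?normrN ?norm_cos_le1 ?norm_sin_le1.
Qed.

Lemma error_meas i t j : measurable_fun [set: X] (error_mult i t j).
Proof.
apply: measurable_funM; first exact: (bmeas_supp).1.
apply: measurable_funM; last exact: (bmeas_reg j).1.
apply: (measurableT_comp (f := fun xi => prj i (w j xi t) -
  (prj i (rotation true xi t) * (Z j xi).1 + prj i (rotation false xi t) * (Z j xi).2)));
  last exact: sr_measurable hF.
apply: measurable_funB; first exact: measurable_prj.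
by apply: measurable_funD; apply: measurable_funM; try exact: measurable_prj_rotation;
  [exact: (Zm true j)|exact: (Zm false j)].
Qed.

Lemma error_le i t j x : 0 <= t -> `|error_mult i t j x| <= 3 * C.
Proof.
move=> t0; apply: regularized_le => [|xi xi0]; first by rewrite mulr_ge0.
apply: le_trans (ler_normB _ _) _.
have h1 := wC i j xi0 t0.
have h2 := ler_normD (prj i (rotation true xi t) * (Z j xi).1) (prj i (rotation false xi t) * (Z j xi).2).
have h3 : `|prj i (rotation true xi t) * (Z j xi).1| <= C * weight N g j xi.
  rewrite normrM -[leRHS]mul1r ler_pM// ?prj_rotation_le//; exact: (ZC true).
have h4 : `|prj i (rotation false xi t) * (Z j xi).2| <= C * weight N g j xi.
  rewrite normrM -[leRHS]mul1r ler_pM// ?prj_rotation_le//; exact: (ZC false).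
lra.
Qed.

Lemma bmeas_error i t j : 0 <= t -> bmeas (error_mult i t j).
Proof.
by move=> t0; split; [exact: error_meas|exists (3 * C) => x; exact: error_le].
Qed.

Lemma error_cvg i j x : error_mult i t j x @[t --> +oo] --> 0.
Proof.
rewrite /error_mult /regularized /supp; case: ifPn => mx; last first.
  by under eq_fun do rewrite mul0r; exact: cvg_cst.
under eq_fun do rewrite mul1r.
by rewrite -(mul0r (reg j x)); apply: cvgM (cvg_cst _); exact: Zlim.
Qed.

(** In the spectral representation the difference of the two solutions is the error
    multiplier applied to [h]; it is bounded and tends to [0] pointwise, so that
    dominated convergence applies. *)
Lemma asymptotics h (U V : R -> H * H) :
  [/\ mulop (reg true) h.1 = (U 0).1, mulop (reg false) h.2 = (U 0).2,
      mulop supp h.1 = h.1 & mulop supp h.2 = h.2] -> V 0 = wave_map h ->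
  (forall i t, 0 <= t -> {ae nu, forall x, (lam t)%:C * F (prj i (U t)) x =
     (prj i (w true (m x) t))%:C * F (U 0).1 x + (prj i (w false (m x) t))%:C * F (U 0).2 x}) ->
  (forall i t, 0 <= t -> {ae nu, forall x, F (prj i (V t)) x =
     (prj i (rotation true (m x) t))%:C * F (V 0).1 x
     + (prj i (rotation false (m x) t))%:C * F (V 0).2 x}) ->
  norm2 ((lam t)%:C *: U t - V t) @[t --> +oo] --> 0.
Proof.
move=> [r1 r2 s1 s2] V0 hU hV; have B := bmeas_wave.
have key i t : 0 <= t -> (lam t)%:C *: prj i (U t) - prj i (V t) =
    mulop (error_mult i t true) h.1 + mulop (error_mult i t false) h.2.
  move=> t0; apply: (F_inj hF).
  have a1 := ae_and (F_sub hF ((lam t)%:C *: prj i (U t)) (prj i (V t)))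
     (F_scale hF (lam t)%:C (prj i (U t))).
  have a2 := ae_and (F_add hF (mulop (error_mult i t true) h.1) (mulop (error_mult i t false) h.2))
     (ae_and (mulopP hF h.1 (bmeas_error i true t0)) (mulopP hF h.2 (bmeas_error i false t0))).
  have a3 := ae_and (hU i t t0) (hV i t t0).
  have a4 : {ae nu, forall x, F (U 0).1 x = (reg true x)%:C * F h.1 x /\
                              F (U 0).2 x = (reg false x)%:C * F h.2 x}.
    rewrite -r1 -r2.
    by have := ae_and (mulopP hF h.1 (bmeas_reg true)) (mulopP hF h.2 (bmeas_reg false)).
  have a5 : {ae nu, forall x,
     F (V 0).1 x = (wave_mult true true x)%:C * F h.1 x + (wave_mult true false x)%:C * F h.2 x /\
     F (V 0).2 x = (wave_mult false true x)%:C * F h.1 x + (wave_mult false false x)%:C * F h.2 x}.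
    rewrite V0 /=.
    have c1 := ae_and (mulopP hF h.1 (B true true)) (mulopP hF h.2 (B true false)).
    have c2 := ae_and (mulopP hF h.1 (B false true)) (mulopP hF h.2 (B false false)).
    have c3 := ae_and (F_add hF (mulop (wave_mult true true) h.1) (mulop (wave_mult true false) h.2))
       (F_add hF (mulop (wave_mult false true) h.1) (mulop (wave_mult false false) h.2)).
    by apply: filterS3 c1 c2 c3 => x [<- <-] [<- <-] [E1 E2]; split.
  have a6 := ae_and (supp_ae s1) (supp_ae s2).
  apply: filterS3 (ae_and a1 a2) (ae_and a3 a4) (ae_and a5 a6).
  move=> x [[-> ->] [-> [-> ->]]] [[-> ->] [-> ->]] [[-> ->] [S1 S2]].
  rewrite /error_mult /wave_mult /regularized /supp; case: (ltP 0 (m x)) => mx; last first.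
    have mx0 : m x = 0 by apply/eqP; rewrite eq_le mx (sr_ge0 hF).
    by rewrite (S1 mx0) (S2 mx0) !(mulr0, addr0, subr0).
  rewrite !mul1r /= !(rmorphM, rmorphB, rmorphD) /=; ring.
have lim i : rnorm ((lam t)%:C *: prj i (U t) - prj i (V t)) @[t --> +oo] --> 0.
  have lj j u : rnorm (mulop (error_mult i t j) u) @[t --> +oo] --> 0.
    apply: (@mulop_dominated _ _ _ _ _ _ _ _ hF (fun t => error_mult i t j) u (3 * C)).
    - by move=> t; exact: error_meas.
    - by move=> t x; exact: error_le.
    - by move=> x; exact: error_cvg.
  have hl : rnorm (mulop (error_mult i t true) h.1) + rnorm (mulop (error_mult i t false) h.2)
      @[t --> +oo] --> 0 + 0 by apply: cvgD; exact: lj.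
  rewrite addr0 in hl; apply: (squeeze_cvgr _ (cvg_cst 0) hl).
  near=> t; have t0 : 0 <= t by near: t; apply: nbhs_pinfty_ge; exact: num_real.
  by rewrite rnorm_ge0/= key// rnormD.
have hl : rnorm ((lam t)%:C *: prj true (U t) - prj true (V t)) +
  rnorm ((lam t)%:C *: prj false (U t) - prj false (V t)) @[t --> +oo] --> 0 + 0.
  by apply: cvgD; exact: lim.
rewrite addr0 in hl; apply: (squeeze_cvgr _ (cvg_cst 0) hl).
by apply: nearW => t; rewrite norm2_ge0/= norm2_le.
Unshelve. all: by end_near. Qed.

End EnergySpaces.

(** * Existence and injectivity of the wave operator *)

Unset Implicit Arguments.

Theorem theorem3p1 (R : realType)
    (H : completeNormedModType R[i]) (dot : {dot H for Num.conj})
    (hdot : induces_norm dot) (hsep : separable H)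
    (A L : uop H)
    (hAcl : closed_op A) (hAsa : selfadjoint_op dot A) (hApos : nonneg_op dot A)
    (hL : sqrt_op dot A L)
    (d : measure_display) (X : measurableType d)
    (nu : {measure set X -> \bar R}) (F : H -> X -> R[i]) (m : X -> R)
    (hF : spectral_rep L nu F m)
    (E : completeNormedModType R[i]) (iota : H * H -> E)
    (hE : is_completion (energy_data dot L) (energy_norm L) iota)
    (J : E -> H * H) (hJ : energy_identification dot L iota J)
    (S : R -> H * H -> H * H) (hS : unitary_group dot S)
    (hSgen : generates (wave_op L) S)
    (b b' : R -> R) (hb : C1_halfline b b')
    (hA1 : forall t : R, 0 <= t -> 0 <= b t)
    (C1 C2 : R)
    (hA2 : forall t : R, 0 <= t -> `|b t| <= C1 * (japanese t)^-1)
    (hA2' : forall t : R, 0 <= t -> `|b' t| <= C2 * (japanese t) ^- 2)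
    (hC : (limf_esup (fun t : R => (t * b t)%:E) +oo%R < (2^-1)%:E)%E \/
          ((2^-1)%:E < limf_einf (fun t : R => (t * b t)%:E) +oo%R)%E)
    (mup : R) (hmup : (limf_esup (fun t : R => (t * b t)%:E) +oo%R < mup%:E)%E)
    (gamma : R) (hgamma : gamma = Num.max (mup - 1) 0)
    (N : R) (hN : 0 < N)
    (Eg : completeNormedModType R[i]) (iotag : H * H -> Eg)
    (hEg : is_completion (energy_data_g dot L nu F m gamma)
                         (energy_norm_g nu F m N gamma) iotag)
    (inc : Eg -> E)
    (hinc : extends_identity (energy_data_g dot L nu F m gamma) iotag iota inc) :
  exists W : {linear Eg -> E},
    [/\ exists M : R, forall x, rnorm (W x) <= M * rnorm x,
        forall (x : Eg) (u v : R -> E),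
          energy_solution dot S J b (inc x) u ->
          energy_solution dot S J (fun=> 0) (W x) v ->
          rnorm ((lambda b t)%:C *: u t - v t) @[t --> +oo] --> (0 : R) &
        [set x | W x = 0] = [set 0]].

Proof.
have [[L_lin _ _] _ _ _] := hL.
have g0 : 0 <= gamma by rewrite hgamma le_max lexx orbT.
have mug : mup <= gamma + 1 by rewrite hgamma -lerBlDr le_max lexx.
pose bt t := b (Num.max t 0).
have hd : dissipation bt b' C1 C2 by exact: dissipation_clamp.
have [t0 hn] := non_critical_clamp hC hmup.
have [cbt bt0 _ _ _] := hd.
have [w hw] := propagator_exists cbt.
have [Z [C [Zmeas C0 bnd Zdet Zlim]]] := wave_matrix hd hn hw hN g0 mug.
have Zm i j : measurable_fun [set: R] (fun xi => prj i (Z j xi)).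
  by case: i; [exact: (Zmeas j).1|exact: (Zmeas j).2].
have wC i j (xi t : R) : 0 < xi -> 0 <= t -> `|prj i (w j xi t)| <= C * weight N gamma j xi.
  by move=> xi0 pt; have [] := bnd j xi t xi0 pt; case: i.
have ZC i j (xi : R) : 0 < xi -> `|prj i (Z j xi)| <= C * weight N gamma j xi.
  by move=> xi0; have [] := bnd j xi 0 xi0 (lexx _); case: i.
have Zl i j (xi : R) : 0 < xi ->
    prj i (w j xi t) - (prj i (rotation true xi t) * (Z j xi).1
                        + prj i (rotation false xi t) * (Z j xi).2) @[t --> +oo] --> 0.
  by move=> xi0; have [] := Zlim j xi xi0; case: i.
pose W := @wave R H d X nu F m E J N gamma Eg inc Z.
have Wl : linear W by exact: (wave_linear hdot L_lin hF hE hJ hN g0 hEg hinc Zm C0 ZC).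
pose WL : {linear Eg -> E} := HB.pack W (GRing.isLinear.Build _ _ _ _ W Wl).
exists WL; split.
- by exists (4 * C) => x; exact: (wave_bounded hdot L_lin hF hE hJ hN g0 hEg hinc Zm C0 ZC).
- move=> x u v [mu u0] [mv v0].
  have [h rh eh] := waveP hdot L_lin hF hE hJ hN g0 hEg hinc Zm C0 ZC x.
  have bbt t : 0 <= t -> bt t = b t.
    by move=> pt; rewrite /bt (_ : Num.max t 0 = t)//; exact/max_idPl.
  have hU i t : 0 <= t -> {ae nu, forall y, (expR (prim bt t))%:C * F (prj i (J (u t))) y =
     (prj i (w true (m y) t))%:C * F (J (u 0)).1 y + (prj i (w false (m y) t))%:C * F (J (u 0)).2 y}.
    move=> pt; have := mild_propagator hdot hF hS hSgen cbt bbt mu bt0 hw pt.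
    by apply: filterS => y []; case: i.
  have hV i t : 0 <= t -> {ae nu, forall y, F (prj i (J (v t))) y =
     (prj i (rotation true (m y) t))%:C * F (J (v 0)).1 y
     + (prj i (rotation false (m y) t))%:C * F (J (v 0)).2 y}.
    move=> pt; have c0 : continuous (fun _ : R => 0 : R) by move=> s; exact: cvg_cst.
    have := mild_propagator hdot hF hS hSgen c0 (fun _ _ => erefl) mv (fun _ => lexx _)
      rotation_propagator pt.
    by apply: filterS => y; rewrite !mul1r => -[]; case: i.
  have rh0 := rh; rewrite /represents -u0 in rh0.
  have J0 := etrans (congr1 J v0) eh.
  have := asymptotics hF hN g0 hw Zm C0 wC ZC Zl rh0 J0 hU hV.
  apply: cvg_trans; apply: near_eq_cvg; near=> t.
  have pt : 0 <= t by near: t; apply: nbhs_pinfty_ge; exact: num_real.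
  rewrite (lambda_prim cbt pt) -(J_norm hdot hE hJ) (J_sub L_lin hE hJ).
  by rewrite -[_ *: u t]addr0 (J_linear L_lin hE hJ) (linear_map0 (J_linear L_lin hE hJ)) addr0.
- apply/seteqP; split => x /=.
    exact: (wave_ker hdot L_lin hF hE hJ hN g0 hEg hinc Zm C0 ZC Zdet).
  by move=> ->; exact: linear_map0 Wl.
Unshelve. all: by end_near. Qed.
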